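(* Let $1<p<\infty$, $\frac1p+\frac1q=1$, and let $w$ be a decreasing positive weight function on $I=(0,a)$, $0<a\le\infty$, such that $W(t)=\int_0^t w\,dm<\infty$ for all $t\in I$. Then $$(\Lambda_{p,w})'=\mathcal M_{q,w}.$$ If in addition $W(\infty)=\int_0^\infty w\,dm=\infty$ when $I=(0,\infty)$, then the dual space $(\Lambda_{p,w})^*$ is isometric to $\mathcal M_{q,w}$. In fact for every $F\in(\Lambda_{p,w})^*$ there exists $f\in\mathcal M_{q,w}$ such that $$F(g)=\int_I fg\,dm,\qquad g\in\Lambda_{p,w},$$ and $$\begin{aligned}\|F\|=\|f\|_{\mathcal M_{q,w}}&=\inf\left\{\left(\int_I(g^* )^q w^{1-q}\,dm\right)^{1/q}: f\prec g\right\}\\&=\inf\left\{\left(\int_I(f^* )^q v^{1-q}\,dm\right)^{1/q}: v\prec w,\ v>0,\ v\text{ decreasing}\right\}\\&=\left(\int_I (f^0)^q w^{1-q}\,dm\right)^{1/q},\end{aligned}$$ where $f^0=(f^* )^0$ is the level function of $f$ with respect to $w$.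
   Context: $m$ is Lebesgue measure; functions are identified when equal a.e.; ''decreasing'' means non-increasing. $L^0(I)$ is the space of real Lebesgue measurable functions on $I$. $f^*$ is the decreasing rearrangement of $f\in L^0(I)$ with respect to $m$. $f\prec g$ means $\int_0^x f^*\,dm\le\int_0^x g^*\,dm$ for all $x\in I$. $\Lambda_{p,w}=\{f\in L^0(I):\|f\|_{\Lambda_{p,w}}=(\int_I(f^* )^p w\,dm)^{1/p}<\infty\}$. The Köthe dual $X'$ of a Banach function space $X\subset L^0(I)$ is the set of $f\in L^0(I)$ with $\|f\|_{X'}=\sup\{\int_I|fg|\,dm:\|g\|_X\le1\}<\infty$; $X^*$ is the Banach dual. $\mathcal M_{q,w}$ is the set of $f\in L^0(I)$ such that $f\prec g$ for some $g\in L^0(I)$ with $\int_I(g^* )^q w^{1-q}\,dm<\infty$, equivalently such that $\int_I(f^* )^q v^{1-q}\,dm<\infty$ for some positive decreasing weight $v\prec w$; its norm is $\|f\|_{\mathcal M_{q,w}}=\inf\{(\int_I(g^* )^q w^{1-q}\,dm)^{1/q}: f\prec g\}$. Level function (Halperin). For $f\in L^0(I)$ with $f^*$ finite and integrable on the finite intervals $(0,t)$, $t\in I$, and $0\le\alpha<\beta<\infty$, $(\alpha,\beta)\subset I$, put $W(\alpha,\beta)=\int_\alpha^\beta w\,dm$, $F(\alpha,\beta)=\int_\alpha^\beta f^*\,dm$, $R(\alpha,\beta)=F(\alpha,\beta)/W(\alpha,\beta)$, and, if $a=\infty$, $R(\alpha,\infty)=\limsup_{t\to\infty}R(\alpha,t)$.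 An interval $(\alpha,\beta)\subset I$ ($\beta\le\infty$) is a level interval if $R(\alpha,\beta)>0$ and $R(\alpha,t)\le R(\alpha,\beta)$ for each $t\in(\alpha,\beta)$; it is a maximal level interval if not contained in a larger level interval. Maximal level intervals are pairwise disjoint, hence at most countably many. The level function is $f^0(t)=R(\alpha,\beta)w(t)$ if $t$ belongs to a maximal level interval $(\alpha,\beta)$, and $f^0(t)=f^*(t)$ otherwise. *)

(* Defs.v *)
From HB Require Import structures.
From mathcomp Require Import all_boot all_order all_algebra.
From mathcomp Require Import all_classical all_reals all_analysis.

Set Implicit Arguments.
Unset Strict Implicit.
Unset Printing Implicit Defensive.

Import Order.TTheory GRing.Theory Num.Theory.
Import numFieldNormedType.Exports.

Local Open Scope classical_set_scope.
Local Open Scope ring_scope.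
Local Open Scope ereal_scope.

(* Lebesgue measure on the sigma-algebra of Lebesgue (Caratheodory) measurable
   sets; its carrier is convertible to R. *)
Notation leb := (@completed_lebesgue_measure _).

Section spaces.
Context {R : realType}.
Implicit Types (a b : \bar R) (p q : R) (f g v w : R -> R).

(* oitv s b = (s, b); in particular I = (0, a) is oitv 0 a, where a <= +oo. *)
Definition oitv (s : R) (b : \bar R) : set R :=
  [set x : R | s%:E < x%:E /\ x%:E < b].

(* A function on I is given by a total function of which only the values on I
   are used; functions equal a.e. on I represent the same element of L0. *)
Definition L0 a : set (R -> R) :=
  [set f | measurable_fun
             (oitv 0 a : set (caratheodory_type (@wlength R idfun)^*%mu)) f].

Definition ae_eq_on a f g : Prop :=
  {ae leb, forall x : R, oitv 0 a x -> f x = g x}.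

Definition distribution_fun a f (l : R) : \bar R :=
  leb (oitv 0 a `&` [set x : R | (l < `|f x|)%R]).

(* The decreasing rearrangement f^*, with value +oo where no level l works. *)
Definition rearrangement a f (t : R) : \bar R :=
  ereal_inf [set l%:E | l in [set l : R | (0 <= l)%R /\
                                          distribution_fun a f l <= t%:E]].

Definition submajorized a f g : Prop :=
  forall x : R, oitv 0 a x ->
    \int[leb]_(t in oitv 0 x%:E) rearrangement a f t <=
    \int[leb]_(t in oitv 0 x%:E) rearrangement a g t.

Definition decreasing_on a w : Prop :=
  forall x y : R, oitv 0 a x -> oitv 0 a y -> (x <= y)%R -> (w y <= w x)%R.

Definition positive_on a w : Prop := forall x : R, oitv 0 a x -> (0 < w x)%R.

Definition lorentz_norm a p w f : \bar R :=
  (\int[leb]_(t in oitv 0 a) (rearrangement a f t `^ p * (w t)%:E)) `^ p^-1.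

Definition lorentz a p w : set (R -> R) :=
  [set f | L0 a f /\ lorentz_norm a p w f < +oo].

Definition kothe_norm a (X : set (R -> R)) (N : (R -> R) -> \bar R) f : \bar R :=
  ereal_sup [set \int[leb]_(x in oitv 0 a) (`|f x * g x|%:E) |
             g in [set g | X g /\ N g <= 1]].

Definition kothe_dual a (X : set (R -> R)) (N : (R -> R) -> \bar R) :
    set (R -> R) :=
  [set f | L0 a f /\ kothe_norm a X N f < +oo].

(* (int_I h^q v^(1-q) dm)^(1/q) *)
Definition inv_weight_norm a q v (h : R -> \bar R) : \bar R :=
  (\int[leb]_(t in oitv 0 a) (h t `^ q * (v t `^ (1 - q))%:E)) `^ q^-1.

Definition Mspace a q w : set (R -> R) :=
  [set f | L0 a f /\
     exists g, [/\ L0 a g, submajorized a f g &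
       \int[leb]_(t in oitv 0 a)
         (rearrangement a g t `^ q * (w t `^ (1 - q))%:E) < +oo]].

Definition Mnorm a q w f : \bar R :=
  ereal_inf [set inv_weight_norm a q w (rearrangement a g) |
             g in [set g | L0 a g /\ submajorized a f g]].

(* An element of the Banach dual of (X, N), with X a set of representatives:
   F matters only on X. Boundedness makes F constant on classes of a.e. equal
   functions, as N vanishes on the difference of two such functions. *)
Definition dual_functional (X : set (R -> R)) (N : (R -> R) -> \bar R)
    (F : (R -> R) -> R) : Prop :=
  (forall (c : R) g h, X g -> X h ->
     F (fun x => c * g x + h x)%R = (c * F g + F h)%R) /\
  (exists C : R, forall g, X g -> `|F g|%:E <= C%:E * N g).

Definition dual_norm (X : set (R -> R)) (N : (R -> R) -> \bar R)
    (F : (R -> R) -> R) : \bar R :=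
  ereal_sup [set `|F g|%:E | g in [set g | X g /\ N g <= 1]].

(* (X, NX)^* is linearly isometric to (Y, NY). Two functionals are equal when
   they agree on X, and two elements of Y are equal when they agree a.e. on I. *)
Definition dual_isometric_to a (X : set (R -> R)) (NX : (R -> R) -> \bar R)
    (Y : set (R -> R)) (NY : (R -> R) -> \bar R) : Prop :=
  exists Phi : (R -> R) -> ((R -> R) -> R),
  [/\ (forall f, Y f -> dual_functional X NX (Phi f)) /\
      (forall f h, Y f -> Y h ->
         (forall g, X g -> Phi f g = Phi h g) <-> ae_eq_on a f h),
      forall (c : R) f h, Y f -> Y h -> forall g, X g ->
        Phi (fun x => c * f x + h x)%R g = (c * Phi f g + Phi h g)%R,
      forall f, Y f -> dual_norm X NX (Phi f) = NY f &
      forall F, dual_functional X NX F ->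
        exists2 f, Y f & forall g, X g -> F g = Phi f g].

End spaces.

Section level_function.
Context {R : realType}.
Variables (a : \bar R) (w f : R -> R).

Definition mean_ratio_fin (s t : R) : \bar R :=
  (\int[leb]_(x in oitv s t%:E) rearrangement a f x) /
  (\int[leb]_(x in oitv s t%:E) (w x)%:E).

Definition mean_ratio (s : R) (b : \bar R) : \bar R :=
  if b is t%:E then mean_ratio_fin s t
  else limf_esup (mean_ratio_fin s) (pinfty_nbhs R).

Definition level_interval (s : R) (b : \bar R) : Prop :=
  [/\ (0 <= s)%R /\ s%:E < b, oitv s b `<=` oitv 0 a, 0 < mean_ratio s b &
      forall t : R, oitv s b t -> mean_ratio s t%:E <= mean_ratio s b].

Definition maximal_level_interval (s : R) (b : \bar R) : Prop :=
  level_interval s b /\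
  forall s' b', level_interval s' b' -> oitv s b `<=` oitv s' b' ->
    oitv s' b' = oitv s b.

(* The maximal level interval containing t, when there is one, is unique. *)
Definition level_fun (t : R) : \bar R :=
  match pselect (exists sb : R * \bar R,
          maximal_level_interval sb.1 sb.2 /\ oitv sb.1 sb.2 t) with
  | left ex => mean_ratio (projT1 (cid ex)).1 (projT1 (cid ex)).2 * (w t)%:E
  | right _ => rearrangement a f t
  end.

End level_function.

(* Main.v *)
Require Import Defs.
From HB Require Import structures.
From mathcomp Require Import all_boot all_order all_algebra.
From mathcomp Require Import all_classical all_reals all_analysis.
From mathcomp Require Import measurable_realfun ring lra.

Set Implicit Arguments.
Unset Strict Implicit.
Unset Printing Implicit Defensive.

Import Order.TTheory GRing.Theory Num.Theory.
Import numFieldNormedType.Exports.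

Local Open Scope classical_set_scope.
Local Open Scope ring_scope.

(* Let F and W be the primitives of f^* and w. The least concave majorant of F,
   seen as a function of W, has slope s(t), and psi = s w is the level function of f
   up to a null set. Majorants dominate, so f is submajorized by psi, and F meets its
   majorant at the contact points, between which s is constant.

   Upper bounds: if f is submajorized by g, and v by w, then the inequalities of
   Hardy-Littlewood, Hardy and Hoelder bound int |f h| by
   (int (g^* )^q v^(1-q))^(1/q) times the norm of h. Taking v = w f^* / psi inside the
   level intervals and v = w outside gives f^* / v = psi / w, whence
   int (f^* )^q v^(1-q) <= int psi^q w^(1-q).

   Lower bound: test f against eta(|f|), where eta is increasing and
   eta(f^* ) = s^(q-1). Since s^(q-1) is constant between contact points,
   int psi^q w^(1-q) = int psi s^(q-1) <= int f^* s^(q-1), which is at most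
   the Koethe norm of f times (int psi^q w^(1-q))^(1/p). When W is bounded, contact
   points may be missing; f is then replaced by a truncation.

   Duality: if W is unbounded, functions of Lambda have level sets of finite measure,
   so the norm is order continuous. For a fixed positive h in Lambda, a bounded
   functional G induces a finite charge A |-> G(1_A h), absolutely continuous with
   respect to m, and its density divided by h represents G. *)

(** * Layer cake *)

(** The majorant is handled through supporting lines only; W is never inverted and nothing is
    differentiated. At a level l > 0 the contact points are the maximisers of F - l W; they move
    left as l grows, and s(t) is the level at which they pass t. Existence then reduces to one fact:
    F - l W attains its maximum. For finite a this is compactness; for W unbounded it follows from F
    <= k W^(1/p), k the Koethe norm, because the exponent is below 1; for W bounded on (0, oo) the
    supremum may only be approached at infinity, which forces the truncation and a factor c > 1
    tending to 1. The slope s may have many jumps, so the integral of psi is identified with the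
    majorant by comparing increments. In the lower bound one integral occurs on both sides, on the
    right to the power 1/p, and must be finite before it is divided out: s is first cut off at a
    small and a large level. Halperin's maximal intervals turn out to be those between the extreme
    contact points of a level; outside them f^* and psi agree only a.e. *)

Section layer_cake.
Context {d : measure_display} {X : measurableType d} {R : realType}.
Local Open Scope ereal_scope.

(** Tonelli on the subgraph of [h]: the fibre over x is the interval (0, h x), of length [h x], also
    when [h x = +oo]. The factor [u] stays inside as a density. *)
Lemma layer_cake (mu : {sigma_finite_measure set X -> \bar R}) (D : set X)
    (u h : X -> \bar R) :
  measurable D -> measurable_fun D u -> measurable_fun D h ->
  (forall x, D x -> 0 <= u x) -> (forall x, D x -> 0 <= h x) ->
  \int[mu]_(x in D) (u x * h x) =
  \int[lebesgue_measure]_(c in `]0%R, +oo[)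
    \int[mu]_(x in D `&` [set x | c%:E < h x]) u x.
Proof.
move=> mD mu_ mh u0 h0.
pose hD := h \_ D; pose uD := u \_ D.
have mhD : measurable_fun setT hD by exact/(measurable_restrictT h).
have muD : measurable_fun setT uD by exact/(measurable_restrictT u).
have uD0 x : 0 <= uD x by apply: erestrict_ge0.
pose A : set (X * measurableTypeR R) :=
  (setT `*` `]0%R, +oo[%classic) `&` [set z | z.2%:E < hD z.1].
have mA : measurable A.
  apply: measurableI; first by apply: measurableX.
  rewrite -[X in measurable X]setTI.
  apply: measurable_lte => //.
    by apply/measurable_EFinP; exact: measurable_snd.
  by apply: measurableT_comp => //; exact: measurable_fst.
pose f (z : X * measurableTypeR R) := uD z.1 * (\1_A z)%:E.
have mf : measurable_fun setT f.
  apply: emeasurable_funM.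
    by apply: measurableT_comp => //; exact: measurable_fst.
  by apply/measurable_EFinP; exact: measurable_indic.
have f0 z : 0 <= f z by rewrite mule_ge0// lee_fin.
have FT := @fubini_tonelli _ _ _ _ R mu lebesgue_measure f mf f0.
rewrite integral_mkcond [in RHS]integral_mkcond.
transitivity (\int[mu]_x \int[lebesgue_measure]_y f (x, y)).
  apply: eq_integral => x _; apply/esym; rewrite /f/= ge0_integralZl//; last first.
    by apply/measurable_EFinP/measurableT_comp; first exact: measurable_indic.
  rewrite /uD !patchE; case: ifPn => [|_]; last by rewrite mul0e.
  rewrite inE => Dx; congr (_ * _).
  pose S := [set c : R | (0 < c)%R /\ c%:E < h x].
  transitivity (\int[lebesgue_measure]_y (\1_S y : R)%:E).
    apply: eq_integral => y _; congr (_%:E); rewrite !indicE; congr ((nat_of_bool _)%:R).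
    apply/idP/idP; rewrite !inE /S /A/= /hD patchE mem_set//=.
      by case=> -[_]; rewrite in_itv/= andbT.
    by move=> [y0 yh]; split => //; split => //; rewrite in_itv/= y0.
  have hx0 := h0 _ Dx.
  case hxE : (h x) hx0 => [r| |] // hx0.
    have -> : S = `]0%R, r[%classic.
      by rewrite /S hxE; apply/seteqP; split=> c /=; rewrite in_itv/= lte_fin => /andP.
    rewrite integral_indic// setIT; have := @lebesgue_measure_itv R `]0%R, r[.
    rewrite /= lte_fin => ->.
    by case: ltP => [_|r0]; [rewrite oppr0 adde0|apply/eqP; rewrite eq_le hx0 lee_fin].
  have -> : S = `]0%R, +oo[%classic.
    by rewrite /S hxE; apply/seteqP; split=> c /=; rewrite in_itv/= andbT ltry; [case|].
  by rewrite integral_indic// setIT; have := @lebesgue_measure_itv R `]0%R, +oo[; rewrite /= ltry.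
rewrite FT; apply: eq_integral => c _.
rewrite patchE; case: ifPn => c0; last first.
  under eq_integral => x _.
    rewrite /f indicE memNset/=; last by move=> [[_ +] _]; rewrite /= -inE; apply/negP.
    rewrite mule0; over.
  by rewrite integral0.
rewrite [RHS]integral_mkcond; apply: eq_integral => x _.
rewrite /f/= /uD !patchE indicE.
have -> : ((x, c) \in A) = (x \in D `&` [set x | c%:E < h x]).
  move: c0; rewrite inE => /= c0.
  apply/idP/idP; rewrite !inE /A/= /hD.
    move=> [_]; rewrite patchE; case: ifPn => [|_]; first by rewrite inE.
    by rewrite lte_fin; move: c0; rewrite in_itv/= andbT => c0 /(lt_trans c0); rewrite ltxx.
  by move=> [Dx ch]; split => //; rewrite patchE mem_set.
rewrite in_setI; case: (x \in D) => /=; last by rewrite mul0e.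
by case: (x \in _); rewrite ?mule1 ?mule0.
Qed.

End layer_cake.

Lemma nonincreasing_emeasurable {R : realType} (D : set R) (g : R -> \bar R) :
  is_interval D -> {in D &, {homo g : x y / x <= y >-> (y <= x)%E}} ->
  measurable_fun (D : set (measurableTypeR R)) g.
Proof.
move=> iD gD mD; apply: (measurability _ (ErealGenOInfty.measurableE R)) => //.
move=> /= _ [_ [a ->]] <-; apply: is_interval_measurable => s t /=.
rewrite !in_itv/= !andbT => -[Ds gs] [Dt gt] u /andP[su ut].
have Du : D u by apply: iD Ds Dt _ _; rewrite su.
by split => //; rewrite in_itv/= andbT (lt_le_trans gt)// gD// inE.
Qed.

(** The common pattern of the Hardy-Littlewood and Hardy inequalities and of the resonance estimate
    below. With [u] and [v] constant 1 it compares two integrals through the measures of superlevel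
    sets. *)
Lemma le_integral_layers {d d' : measure_display} {X : measurableType d}
    {Y : measurableType d'} {R : realType}
    (mu : {sigma_finite_measure set X -> \bar R})
    (nu : {sigma_finite_measure set Y -> \bar R}) (D : set X) (E : set Y)
    (u h : X -> \bar R) (v k : Y -> \bar R) :
  measurable D -> measurable_fun D u -> measurable_fun D h ->
  (forall x, D x -> 0 <= u x)%E -> (forall x, D x -> 0 <= h x)%E ->
  measurable E -> measurable_fun E v -> measurable_fun E k ->
  (forall x, E x -> 0 <= v x)%E -> (forall x, E x -> 0 <= k x)%E ->
  (forall c : R, (0 < c)%R ->
    \int[mu]_(x in D `&` [set x | (c%:E < h x)%E]) u x <=
    \int[nu]_(x in E `&` [set x | (c%:E < k x)%E]) v x)%E ->
  (\int[mu]_(x in D) (u x * h x) <= \int[nu]_(x in E) (v x * k x))%E.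
Proof.
move=> mD mu_ mh u0 h0 mE mv mk v0 k0 uv; rewrite !layer_cake//.
(* The layer integrals decrease as c grows, and monotonicity alone makes them measurable in c. *)
have msec d0 (Z : measurableType d0) (la : {sigma_finite_measure set Z -> \bar R})
    (B : set Z) (a b : Z -> \bar R) : measurable B -> measurable_fun B a ->
    measurable_fun B b -> (forall x, B x -> 0 <= a x)%E ->
    measurable_fun (`]0, +oo[%classic : set (measurableTypeR R))
     (fun c => \int[la]_(x in B `&` [set x | (c%:E < b x)%E]) a x)%E.
  move=> mB ma mb a0; apply: nonincreasing_emeasurable.
    exact: interval_is_interval.
  move=> c c' _ _ cc'; apply: ge0_subset_integral => //.
  - exact: emeasurable_fun_o_infty.
  - exact: emeasurable_fun_o_infty.
  - by apply: measurable_funS ma => //; exact: subIsetl.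
  - by move=> z [Bz _]; exact: a0.
  - by move=> z [Bz /= cb]; split => //=; rewrite (le_lt_trans _ cb)// lee_fin.
apply: ge0_le_integral => //.
- by move=> c _; apply: integral_ge0 => x [Dx _]; exact: u0.
- exact: msec.
- exact: msec.
- by move=> c /=; rewrite in_itv/= andbT; exact: uv.
Qed.

(** * Lebesgue measure on intervals and rearrangements *)

Section lebesgue_interval.
Context {R : realType}.
Local Notation T := (caratheodory_type (@wlength R idfun)^*%mu).
Local Open Scope ereal_scope.

Lemma measurable_leb (A : set R) :
  measurable (A : set (measurableTypeR R)) -> measurable (A : set T).
Proof. exact: sub_caratheodory. Qed.

Lemma measurable_fun_leb d (U : measurableType d) (D : set R) (f : R -> U) :
  measurable (D : set (measurableTypeR R)) ->
  measurable_fun (D : set (measurableTypeR R)) f ->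
  measurable_fun (D : set T) f.
Proof. by move=> mD mf _ Y mY; apply: measurable_leb; exact: mf. Qed.

Lemma is_interval_oitv (s : R) b : is_interval (oitv s b).
Proof.
move=> x y [sx _] [_ yb] z /andP[xz zy]; split.
  by rewrite (lt_le_trans sx)// lee_fin.
by rewrite (le_lt_trans _ yb)// lee_fin.
Qed.

Lemma borel_oitv (s : R) b : measurable (oitv s b : set (measurableTypeR R)).
Proof. by apply: is_interval_measurable; exact: is_interval_oitv. Qed.

Lemma measurable_oitv (s : R) b : measurable (oitv s b : set T).
Proof. by apply: measurable_leb; exact: borel_oitv. Qed.

Lemma leb_oitv (s : R) b : s%:E <= b -> leb (oitv s b) = b - s%:E.
Proof.
move=> sb; have -> : leb (oitv s b) = lebesgue_measure (oitv s b) by [].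
case: b sb => [t| |] //= sb.
- have -> : oitv s t%:E = `]s, t[%classic.
    by apply/seteqP; split => x; rewrite /oitv/= in_itv/= !lte_fin => /andP.
  rewrite lebesgue_measure_itv/= lte_fin; case: ltP => // ts.
  by rewrite -EFinB; apply/eqP; rewrite eqe eq_sym subr_eq0 eq_le ts -lee_fin.
- have -> : oitv s +oo = `]s, +oo[%classic.
    by apply/seteqP; split => x; rewrite /oitv/= in_itv/= andbT lte_fin ltry => // -[].
  by rewrite lebesgue_measure_itv/= ltry.
Qed.

Lemma leb_oitv0 b : 0 <= b -> leb (@oitv R 0 b) = b.
Proof. by move=> b0; rewrite leb_oitv// sube0. Qed.

Lemma leb_set1 (x : R) : leb [set x] = 0.
Proof.
have -> : leb [set x] = lebesgue_measure [set x] by [].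
exact: lebesgue_measure_set1.
Qed.

Lemma leb_countable (A : set R) : countable A -> leb A = 0.
Proof.
have -> : leb A = lebesgue_measure A by [].
exact: countable_lebesgue_measure0.
Qed.

Lemma countable_negligible (A : set R) : countable A -> leb.-negligible A.
Proof.
move=> cA; exists A; split => //; last exact: leb_countable.
apply: measurable_leb; exact: countable_measurable.
Qed.

Lemma oitv_sub0 (s : R) b : (0 <= s)%R -> oitv s b `<=` oitv 0 b.
Proof. by move=> s0 x [sx xb]; split => //; rewrite (le_lt_trans _ sx)// lee_fin. Qed.

Lemma oitv_subr (s : R) b b' : b <= b' -> oitv s b `<=` oitv s b'.
Proof. by move=> bb' x [sx xb]; split => //; rewrite (lt_le_trans xb). Qed.

Lemma rat_between (x y : \bar R) : x < y -> exists r : rat, x < (ratr r)%:E < y.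
Proof.
move=> xy; have [u [v [uv xu vy]]] : exists u v : R, [/\ (u < v)%R, x <= u%:E & v%:E <= y].
  case: x y xy => [x| |] [y| |]//.
  - by exists x, y.
  - by exists x, (x + 1)%R; rewrite ltrDl leey.
  - by exists (y - 1)%R, y; rewrite gtrBl leNye.
  - by exists 0%R, 1%R; rewrite leNye leey.
have [r] := rat_in_itvoo uv; rewrite in_itv/= => /andP[ur rv].
by exists r; rewrite (le_lt_trans xu) ?lte_fin// (lt_le_trans _ vy)// lte_fin.
Qed.

Lemma measure_bigcup_sup (F : (set T)^nat) : (forall n, measurable (F n)) ->
  nondecreasing_seq F -> leb (\bigcup_n F n) = ereal_sup (range (leb \o F)).
Proof.
move=> mF ndF; apply: (@cvg_unique _ _ ((leb \o F) n @[n --> \oo])) => //.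
  by apply: nondecreasing_cvg_mu => //; exact: bigcupT_measurable.
apply: ereal_nondecreasing_cvgn => m n mn; apply: le_measure; rewrite ?inE//.
exact/subsetPset/ndF.
Qed.

(* The nonempty intervals (u t, v t) are pairwise disjoint. *)
Lemma interlaced_negligible (E : set R) (u v : R -> \bar R) :
  (forall t t', E t -> E t' -> (t < t')%R -> v t' <= u t) ->
  leb.-negligible (E `&` [set t | u t < v t]).
Proof.
move=> uv; apply: countable_negligible.
suff : countable (\bigcup_(r in [set: rat])
    (E `&` [set t | u t < (ratr r)%:E < v t])).
  apply: sub_countable; apply: subset_card_le => t [Et /= utvt].
  have [r /andP[ur rv]] : exists r : rat, u t < (ratr r)%:E < v t.
    exact: rat_between.
  by exists r => //; split => //=; rewrite ur rv.
apply: bigcup_countable; first exact: countableP.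
move=> r _; set S := (X in countable X).
have S1 t t' : S t -> S t' -> t = t'.
  wlog tt' : t t' / (t < t')%R.
    move=> H St St'; have [/H|/H|//] := ltgtP t t'; first exact.
    by move=> /(_ St' St).
  move=> [Et /andP[ut _]] [Et' /andP[_ vt']]; exfalso.
  by have := uv _ _ Et Et' tt'; rewrite leNgt (lt_trans ut vt').
have [->|/set0P[t St]] := eqVneq S set0; first exact: countable0.
rewrite (_ : S = [set t]) ?countable1//.
by apply/seteqP; split => [t' St'|_ ->//] /=; exact: S1.
Qed.

Lemma ge0_integral_oitv_split (u : R -> \bar R) (r s t : R) :
  (r <= s <= t)%R -> measurable_fun (oitv r t%:E : set T) u ->
  (forall x, oitv r t%:E x -> 0 <= u x) ->
  \int[leb]_(x in oitv r t%:E) u x =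
  \int[leb]_(x in oitv r s%:E) u x + \int[leb]_(x in oitv s t%:E) u x.
Proof.
move=> /andP[rs st] mu u0.
have [->|st'] := eqVneq s t.
  have -> : oitv t t%:E = set0.
    by rewrite -subset0 => x [tx xt]; move: (lt_trans tx xt); rewrite ltxx.
  by rewrite integral_set0 adde0.
have {}st : (s < t)%R by rewrite lt_neqAle st'.
have E : oitv r t%:E `\ s = oitv r s%:E `|` oitv s t%:E.
  apply/seteqP; split => x.
    move=> [[x0 xt] /= xs]; have [xs'|xs'|//] := ltgtP x s.
      by left; split => //; rewrite lte_fin.
    by right; split => //; rewrite lte_fin.
  case=> -[].
    move=> x0 xs; split; first by split => //; rewrite (lt_trans xs)// lte_fin.
    by move=> xE; move: xs; rewrite xE ltxx.
  move=> sx xt; split; first by split => //; rewrite (le_lt_trans _ sx)// lee_fin.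
  by move=> xE; move: sx; rewrite xE ltxx.
transitivity (\int[leb]_(x in oitv r t%:E `\ s) u x); last first.
  rewrite E ge0_integral_setU//; do ?exact: measurable_oitv.
  - by rewrite -E; apply: measurable_funS mu; [exact: measurable_oitv|exact: subDsetl].
  - by move=> x; rewrite -E => -[+ _]; exact: u0.
  - apply/disj_setPRL => x [sx _] [_ xs].
    by move: (lt_trans sx xs); rewrite ltxx.
have ms : measurable ([set s] : set T) by apply: measurable_leb.
by apply: ge0_negligible_integral => //; [exact: measurable_oitv|exact: leb_set1].
Qed.

Lemma ge0_integral_setID (A B : set T) (u : R -> \bar R) :
  measurable A -> measurable B -> measurable_fun A u ->
  (forall x, A x -> 0 <= u x) ->
  \int[leb]_(x in A) u x =
  \int[leb]_(x in A `&` B) u x + \int[leb]_(x in A `&` ~` B) u x.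
Proof.
move=> mA mB mu u0; have AE : A = (A `&` B) `|` (A `&` ~` B).
  by rewrite -setIUr setUv setIT.
rewrite [in LHS]AE ge0_integral_setU//.
- exact: measurableI.
- by apply: measurableI => //; exact: measurableC.
- by rewrite -AE.
- by rewrite -AE.
- by apply/disj_setPS => x [[_ Bx] [_ nBx]]; exact: nBx.
Qed.

Lemma integral_indic_mul (A B : set T) (u : R -> \bar R) :
  measurable A -> measurable B -> B `<=` A ->
  \int[leb]_(x in A) (u x * (\1_B x)%:E) = \int[leb]_(x in B) u x.
Proof.
move=> mA mB BA; rewrite [RHS]integral_mkcond [LHS]integral_mkcond.
apply: eq_integral => x _; rewrite !patchE indicE.
have [xB|xB] := boolP (x \in B).
  by rewrite mem_set ?mule1//; apply: BA; rewrite inE in xB.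
by rewrite mule0; case: ifP.
Qed.

End lebesgue_interval.

(** * Decreasing rearrangements and the Hardy-Littlewood inequality *)

Section rearrangement_theory.
Context {R : realType}.
Local Notation T := (caratheodory_type (@wlength R idfun)^*%mu).
Variable a : \bar R.
Hypothesis a_ge0 : (0 <= a)%E.
Implicit Types f g : R -> R.
Local Open Scope ereal_scope.

Lemma rearrangement_ge0 f t : 0 <= rearrangement a f t.
Proof. by apply: le_ereal_inf_tmp => _ [l [l0 _] <-]; rewrite lee_fin. Qed.

Lemma rearrangement_le f t l : (0 <= l)%R ->
  distribution_fun a f l <= t%:E -> rearrangement a f t <= l%:E.
Proof. by move=> l0 fl; apply: ereal_inf_lbound; exists l. Qed.

Lemma rearrangement_nonincr f s t : (s <= t)%R ->
  rearrangement a f t <= rearrangement a f s.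
Proof.
move=> st; apply: le_ereal_inf_tmp => _ [l [l0 fl] <-].
by apply: rearrangement_le => //; rewrite (le_trans fl)// lee_fin.
Qed.

Lemma measurable_rearrangement f (D : set T) : measurable D ->
  measurable_fun D (rearrangement a f).
Proof.
move=> mD; apply: (measurable_funS (measurableT : measurable (setT : set T)) (@subsetT _ D)).
apply: measurable_fun_leb => //.
apply: nonincreasing_emeasurable => // x y _ _; exact: rearrangement_nonincr.
Qed.

Lemma measurable_level f (l : R) : L0 a f ->
  measurable (oitv 0 a `&` [set x : R | (l < `|f x|)%R] : set T).
Proof.
move=> mf; have mf' : measurable_fun (oitv 0 a : set T) (fun x => `|f x|%:E).
  by apply/measurable_EFinP/measurableT_comp => //.
have := @emeasurable_fun_o_infty _ T R _ _ (measurable_oitv 0 a) mf' l%:E.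
by congr measurable; apply/seteqP; split => x [Ix /=]; rewrite lte_fin.
Qed.

Lemma distribution_fun_ge0 f l : 0 <= distribution_fun a f l.
Proof. exact: measure_ge0. Qed.

Lemma distribution_fun_le_length f l : L0 a f -> distribution_fun a f l <= a.
Proof.
move=> mf; rewrite -[leRHS](@leb_oitv0 R)//.
apply: le_measure; rewrite ?inE.
- exact: measurable_level.
- exact: measurable_oitv.
- exact: subIsetl.
Qed.

Lemma distribution_fun_nonincr f l l' : L0 a f -> (l <= l')%R ->
  distribution_fun a f l' <= distribution_fun a f l.
Proof.
move=> mf ll'; apply: le_measure; rewrite ?inE; do ?exact: measurable_level.
by move=> x [Ix /= l'x]; split => //=; rewrite (le_lt_trans ll').
Qed.

(** Right-continuity of the distribution function: the set where |f| > l is the increasing union of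
    the sets where |f| > l + 1/(n+1). *)
Lemma distribution_fun_gt f (l t : R) : L0 a f ->
  t%:E < distribution_fun a f l ->
  exists2 l', (l < l')%R & t%:E < distribution_fun a f l'.
Proof.
move=> mf tl.
pose F n := oitv 0 a `&` [set x : R | (l + n.+1%:R^-1 < `|f x|)%R] : set T.
have FE : \bigcup_n F n = oitv 0 a `&` [set x : R | (l < `|f x|)%R].
  apply/seteqP; split => [x [n _ [Ix /= xn]]|x [Ix /= lx]].
    by split => //=; rewrite (lt_trans _ xn)// ltrDl.
  have e0 : (0 < `|f x| - l)%R by rewrite subr_gt0.
  exists (Num.truncn (`|f x| - l)^-1) => //; split => //=.
  rewrite -ltrBrDl -[ltRHS]invrK ltf_pV2 ?posrE// ?invr_gt0//.
  exact: truncnS_gt.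
have mF n : measurable (F n) by exact: measurable_level.
move: tl; rewrite /distribution_fun -FE measure_bigcup_sup//; last first.
  apply/nondecreasing_seqP => n; apply/subsetPset => x [Ix /= nx]; split => //=.
  by rewrite (le_lt_trans _ nx)// lerD2l lef_pV2 ?posrE// ler_nat.
move=> /ereal_sup_gt[_ [n _ <-] /= tn].
by exists (l + n.+1%:R^-1)%R => //; rewrite ltrDl.
Qed.

(** The rearrangement is the generalised inverse of the distribution function. The strict form from
    right to left needs right-continuity: a level above l that is still exceeded on measure more
    than t separates l from the infimum. *)
Lemma rearrangement_gtE f (l t : R) : L0 a f -> (0 <= l)%R ->
  (l%:E < rearrangement a f t) = (t%:E < distribution_fun a f l).
Proof.
move=> mf l0; apply/idP/idP => [|tl].
  by apply: contraLR; rewrite -!leNgt; exact: rearrangement_le.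
have [l' ll' tl'] := distribution_fun_gt mf tl.
apply: (@lt_le_trans _ _ l'%:E); first by rewrite lte_fin.
apply: le_ereal_inf_tmp => _ [m [m0 fm] <-]; rewrite lee_fin leNgt.
apply/negP => /ltW /(distribution_fun_nonincr mf) /(lt_le_trans tl').
by rewrite ltNge fm.
Qed.

Lemma rearrangement_level f (l : R) : L0 a f -> (0 <= l)%R ->
  oitv 0 a `&` [set t : R | l%:E < rearrangement a f t] =
  oitv 0 (distribution_fun a f l).
Proof.
move=> mf l0; apply/seteqP; split => t.
  by move=> [[t0 ta] /=]; rewrite rearrangement_gtE// => tl; split.
move=> [t0 tl]; split; last by rewrite /= rearrangement_gtE.
by split => //; rewrite (lt_le_trans tl)//; exact: distribution_fun_le_length.
Qed.

(** Right-continuity of the rearrangement. If it exceeded l at t, then t would be smaller than the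
    measure of the level set, and so would some rational s > t, at which the rearrangement would
    also exceed l. *)
Lemma rearrangement_le_right f (t : R) (x : \bar R) : L0 a f -> 0 <= x ->
  (forall s : R, (t < s)%R -> s%:E < a -> rearrangement a f s <= x) ->
  rearrangement a f t <= x.
Proof.
case: x => [l| |]// mf l0 H; last exact: leey.
rewrite leNgt rearrangement_gtE//; apply/negP => tl.
have [r /andP[tr rl]] := rat_between tl.
have := H (ratr r); rewrite lte_fin in tr; move=> /(_ tr).
move=> /(_ (lt_le_trans rl (distribution_fun_le_length _ mf))).
by rewrite leNgt rearrangement_gtE// rl.
Qed.

Lemma le_rearrangement f g (t : R) : L0 a f -> L0 a g ->
  (forall x, oitv 0 a x -> `|f x| <= `|g x|)%R ->
  rearrangement a f t <= rearrangement a g t.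
Proof.
move=> mf mg fg; apply: le_ereal_inf_tmp => _ [l [l0 gl] <-].
apply: rearrangement_le => //; apply: le_trans gl.
apply: le_measure; rewrite ?inE; do ?exact: measurable_level.
by move=> x [Ix /= lx]; split => //=; rewrite (lt_le_trans lx)// fg.
Qed.

Lemma rearrangement_scale f (c t : R) : (0 < c)%R -> L0 a f ->
  rearrangement a (fun x => c * f x)%R t <= c%:E * rearrangement a f t.
Proof.
move=> c0 mf; rewrite -lee_pdivrMl//; apply: le_ereal_inf_tmp => _ [l [l0 fl] <-].
rewrite lee_pdivrMl// -EFinM; apply: rearrangement_le; first by rewrite mulr_ge0// ltW.
apply: le_trans fl; rewrite /distribution_fun le_eqVlt; apply/orP; left; apply/eqP.
congr (leb _); apply/seteqP; split => x [Ix /=].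
  by rewrite normrM (gtr0_norm c0) ltr_pM2l.
by move=> lx; split => //=; rewrite normrM (gtr0_norm c0) ltr_pM2l.
Qed.

(* Each layer |f| > l, restricted to E, is no longer than the corresponding
   layer of the rearrangement restricted to (0, m E). *)
Lemma integral_le_rearrangement f (E : set T) : L0 a f -> measurable E ->
  E `<=` oitv 0 a ->
  \int[leb]_(x in E) `|f x|%:E <=
  \int[leb]_(t in oitv 0 (leb E)) rearrangement a f t.
Proof.
move=> mf mE Ea.
have mf' : measurable_fun E (fun x => `|f x|%:E).
  apply/measurable_EFinP/measurableT_comp => //.
  by apply: measurable_funS mf => //; exact: measurable_oitv.
under eq_integral do rewrite -[_%:E]mul1e.
under [leRHS]eq_integral do rewrite -[rearrangement _ _ _]mul1e.
have mI := @measurable_oitv R 0 (leb E).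
apply: (le_integral_layers mE (measurable_cst 1) mf' _ _ mI (measurable_cst 1)
  (measurable_rearrangement f mI)).
- by move=> x _; exact: lee01.
- by move=> x _; rewrite lee_fin.
- by move=> x _; exact: lee01.
- by move=> x _; exact: rearrangement_ge0.
move=> c c0; rewrite !integral_cst//; last 2 first.
- apply: emeasurable_fun_o_infty; first exact: measurable_oitv.
  by apply: measurable_rearrangement; exact: measurable_oitv.
- exact: emeasurable_fun_o_infty.
rewrite !mul1e.
have -> : oitv 0 (leb E) `&` [set t : R | c%:E < rearrangement a f t] =
    oitv 0 (mine (leb E) (distribution_fun a f c)).
  apply/seteqP; split => t.
    by move=> [[t0 tE] /=]; rewrite rearrangement_gtE// ?(ltW c0)// => tc; split => //; rewrite lt_min tE.
  by move=> [t0]; rewrite lt_min => /andP[tE tc]; split => //=; rewrite rearrangement_gtE// ltW.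
rewrite [leRHS]leb_oitv0; last by rewrite le_min measure_ge0 distribution_fun_ge0.
have mEc : measurable (E `&` [set x | c%:E < `|f x|%:E]) by exact: emeasurable_fun_o_infty.
rewrite le_min; apply/andP; split; apply: le_measure; rewrite ?inE//.
  exact: measurable_level.
by move=> x [Ex /=]; rewrite lte_fin => cx; split => //; exact: Ea.
Qed.

(** The layer of |g| at c and the layer (0, d) of its rearrangement have the same measure d, so
    [integral_le_rearrangement] compares the integrals of |f| and of the rearrangement of f over
    them. *)
Lemma hardy_littlewood f g : L0 a f -> L0 a g ->
  \int[leb]_(x in oitv 0 a) `|f x * g x|%:E <=
  \int[leb]_(t in oitv 0 a) (rearrangement a f t * rearrangement a g t).
Proof.
move=> mf mg; under eq_integral do rewrite normrM EFinM.
have mI := @measurable_oitv R 0 a.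
have mabs (h : R -> R) : L0 a h -> measurable_fun (oitv 0 a : set T) (fun x => `|h x|%:E).
  by move=> mh; apply/measurable_EFinP/measurableT_comp.
have r0 (h : R -> R) t : oitv 0 a t -> 0 <= rearrangement a h t.
  by move=> _; exact: rearrangement_ge0.
apply: (le_integral_layers mI (mabs _ mf) (mabs _ mg) _ _ mI
  (measurable_rearrangement f mI) (measurable_rearrangement g mI) (r0 f) (r0 g)).
- by move=> x _; rewrite lee_fin.
- by move=> x _; rewrite lee_fin.
move=> c c0; rewrite rearrangement_level ?(ltW c0)//.
have -> : oitv 0 a `&` [set x | c%:E < `|g x|%:E] =
    oitv 0 a `&` [set x | (c < `|g x|)%R].
  by apply/seteqP; split => x [Ix /=]; rewrite ?lte_fin.
by apply: (integral_le_rearrangement mf (measurable_level _ mg)); exact: subIsetl.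
Qed.

End rearrangement_theory.

(** * Hardy's inequality and rearrangements of monotone functions *)

Section decreasing_functions.
Context {R : realType}.
Local Notation T := (caratheodory_type (@wlength R idfun)^*%mu).
Variable a : \bar R.
Hypothesis a_gt0 : (0 < a)%E.
Implicit Types f g : R -> R.
Local Open Scope ereal_scope.

Let mI := @measurable_oitv R 0 a.

(** b is the supremum of S, or 0 when S is empty; S is then (0, b) with or without its right
    endpoint. *)
Lemma down_closed_oitv (S : set R) : S `<=` oitv 0 a ->
  (forall x y, S y -> (0 < x <= y)%R -> S x) ->
  exists b, [/\ 0 <= b, b <= a, oitv 0 b `<=` S & forall x, S x -> x%:E <= b].
Proof.
move=> Sa Sd; exists (maxe 0 (ereal_sup (EFin @` S))); split.
- by rewrite le_max lexx.
- rewrite ge_max (ltW a_gt0)/=; apply: ge_ereal_sup => _ [x Sx <-].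
  by have [_ /ltW] := Sa _ Sx.
- move=> x [x0]; rewrite lt_max => /orP[/(lt_trans x0)|]; first by rewrite ltxx.
  move=> /ereal_sup_gt[_ [y Sy <-]] xy; apply: Sd Sy _.
  by rewrite -!lte_fin x0 -lee_fin ltW.
- by move=> x Sx; rewrite le_max; apply/orP; right; apply: ereal_sup_ubound; exists x.
Qed.

Lemma ge0_integral_down_closed (S : set T) (b : \bar R) (u : R -> \bar R) :
  0 <= b -> S `<=` oitv 0 a -> oitv 0 b `<=` S -> (forall x, S x -> x%:E <= b) ->
  measurable S -> measurable_fun S u -> (forall x, S x -> 0 <= u x) ->
  \int[leb]_(x in S) u x = \int[leb]_(x in oitv 0 b) u x.
Proof.
move=> b0 Sa bS Sb mS mu u0.
(* The only possible discrepancy is the endpoint b. For b = +oo, [fine b] is 0, and discarding that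
   single point from both sides is harmless. *)
have mN : measurable ([set fine b] : set T) by apply: measurable_leb.
have N0 : leb ([set fine b] : set T) = 0 by exact: leb_set1.
rewrite (ge0_negligible_integral mN mS mu u0 N0).
rewrite [RHS](ge0_negligible_integral mN (measurable_oitv 0 b)
  (measurable_funS mS bS mu) (fun x bx => u0 x (bS x bx)) N0).
congr (\int[leb]_(x in _) u x); apply/seteqP; split => x [].
  move=> Sx xb; split => //; have [x0 _] := Sa _ Sx; split => //.
  rewrite lt_neqAle Sb// andbT; apply/eqP => xE.
  by apply: xb; rewrite /= -xE.
by move=> bx xb; split => //; exact: bS.
Qed.

(** Monotone convergence along intervals (0, x_n) with x_n increasing to b, so that only endpoints
    inside (0, b) have to be controlled. The bound [0 <= M] serves the empty intervals. *)
Lemma ge0_integral_oitv_le (b M : \bar R) (u : R -> \bar R) : 0 <= b ->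
  measurable_fun (oitv 0 b : set T) u -> (forall x, oitv 0 b x -> 0 <= u x) ->
  (forall x : R, oitv 0 b x -> \int[leb]_(t in oitv 0 x%:E) u t <= M) -> 0 <= M ->
  \int[leb]_(t in oitv 0 b) u t <= M.
Proof.
move=> b0 mu u0 uM M0.
have [x_ [xb xnd xU]] : exists x_ : nat -> R, [/\ forall n, (x_ n)%:E < b \/ (x_ n <= 0)%R,
    {homo x_ : n m / (n <= m)%N >-> (n <= m)%R} &
    oitv 0 b = \bigcup_n oitv 0 (x_ n)%:E].
  case: b b0 {mu u0 uM} => [r| |]//; rewrite ?lee_fin => r0.
  - exists (fun n => r - n.+1%:R^-1)%R; split.
    + by move=> n; left; rewrite lte_fin gtrBl.
    + by move=> n m nm; rewrite lerD2l lerN2 lef_pV2 ?posrE// ler_nat.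
    + apply/seteqP; split => x.
        move=> [x0 xr]; have e0 : (0 < r - x)%R by rewrite subr_gt0 -lte_fin.
        exists (Num.truncn (r - x)^-1) => //; split => //.
        rewrite lte_fin ltrBrDl -ltrBrDr -[ltRHS]invrK ltf_pV2 ?posrE// ?invr_gt0//.
        exact: truncnS_gt.
      by move=> [n _ [x0 xn]]; split => //; rewrite (lt_trans xn)// lte_fin gtrBl.
  - exists (fun n => n%:R)%R; split.
    + by move=> n; left; rewrite ltry.
    + by move=> n m nm; rewrite ler_nat.
    + apply/seteqP; split => x.
        move=> [x0 _]; exists (Num.truncn x).+1 => //; split => //.
        by rewrite lte_fin truncnS_gt.
      by move=> [n _ [x0 xn]]; split => //; rewrite ltry.
rewrite xU in mu u0 *.
have mF n : measurable (oitv 0 (x_ n)%:E : set T) by exact: measurable_oitv.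
have cvF := @ge0_nondecreasing_set_cvg_integral _ T R
  (fun n => oitv 0 (x_ n)%:E : set T) u leb.
have {}cvF := cvF _ mF _ _.
have ndF : nondecreasing_seq (fun n => oitv 0 (x_ n)%:E : set T).
  move=> m n mn; apply/subsetPset => x [x0 xm]; split => //.
  by rewrite (lt_le_trans xm)// lee_fin xnd.
have muF n : measurable_fun (oitv 0 (x_ n)%:E : set T) u.
  by apply: measurable_funS mu; [exact: bigcupT_measurable|move=> x xn; exists n].
have uF n x : oitv 0 (x_ n)%:E x -> 0 <= u x by move=> xn; apply: u0; exists n.
have {}cvF := cvF ndF muF uF.
rewrite -(cvg_lim _ cvF)//; apply: lime_le; first by apply/cvg_ex; eexists; exact: cvF.
apply: nearW => n; have [x0|x0] := ltP 0%R (x_ n); last first.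
  rewrite (_ : oitv _ _ = set0) ?integral_set0//.
  by rewrite -subset0 => x [/= x0' /(lt_trans x0')]; rewrite lte_fin ltNge x0.
by apply: uM; split => //; case: (xb n) => //; rewrite leNgt x0.
Qed.

(** The layers of the nonincreasing h are initial segments up to an endpoint, and over an initial
    segment the hypothesis compares u with v. *)
Lemma hardy (u v h : R -> \bar R) :
  measurable_fun (oitv 0 a : set T) u -> measurable_fun (oitv 0 a : set T) v ->
  measurable_fun (oitv 0 a : set T) h ->
  (forall x, oitv 0 a x -> 0 <= u x) -> (forall x, oitv 0 a x -> 0 <= v x) ->
  (forall x, oitv 0 a x -> 0 <= h x) ->
  (forall x y, oitv 0 a x -> oitv 0 a y -> (x <= y)%R -> h y <= h x) ->
  (forall x : R, oitv 0 a x ->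
    \int[leb]_(t in oitv 0 x%:E) u t <= \int[leb]_(t in oitv 0 x%:E) v t) ->
  \int[leb]_(t in oitv 0 a) (u t * h t) <= \int[leb]_(t in oitv 0 a) (v t * h t).
Proof.
move=> mu mv mh u0 v0 h0 hdec uv.
apply: (le_integral_layers mI mu mh u0 h0 mI mv mh v0 h0) => c c0.
set S : set T := _ `&` _.
have mS : measurable S by exact: emeasurable_fun_o_infty.
have Sa : S `<=` oitv 0 a by exact: subIsetl.
have [b [b0 ba bS Sb]] : exists b, [/\ 0 <= b, b <= a, oitv 0 b `<=` S & forall x, S x -> x%:E <= b].
  apply: down_closed_oitv => // x y [[y0 ya] /= cy] /andP[x0 xy].
  have xI : oitv 0 a x by split; [rewrite lte_fin|rewrite (le_lt_trans _ ya)].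
  by split => //=; rewrite (lt_le_trans cy)// hdec.
rewrite (ge0_integral_down_closed b0 Sa bS Sb mS (measurable_funS mI Sa mu) (fun x Sx => u0 x (Sa x Sx))).
rewrite (ge0_integral_down_closed b0 Sa bS Sb mS (measurable_funS mI Sa mv) (fun x Sx => v0 x (Sa x Sx))).
have bI : oitv 0 b `<=` oitv 0 a by exact: oitv_subr.
apply: ge0_integral_oitv_le => //.
- exact: measurable_funS mu.
- by move=> x bx; exact/u0/bI.
- move=> x bx; apply: (le_trans (uv _ (bI _ bx))).
  have [_ xb] := bx.
  apply: ge0_subset_integral; do ?exact: measurable_oitv.
  + exact: measurable_funS mv.
  + by move=> y by_; exact/v0/bI.
  + by apply: oitv_subr; exact: ltW.
- by apply: integral_ge0 => x bx; exact/v0/bI.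
Qed.

Lemma measurable_decreasing (v : R -> R) : decreasing_on a v -> L0 a v.
Proof.
move=> vdec; apply/measurable_EFinP; apply: measurable_fun_leb.
  exact: borel_oitv.
apply: nonincreasing_emeasurable; first exact: is_interval_oitv.
by move=> x y; rewrite !inE => xa ya xy; rewrite lee_fin vdec.
Qed.

(** The rearrangement lies below v, and at t it is at least v s for every s > t. Hence the gaps
    between the rearrangement and v at different points are disjoint intervals, and
    [interlaced_negligible] applies. *)
Lemma rearrangement_decreasing (v : R -> R) : decreasing_on a v ->
  (forall x, oitv 0 a x -> (0 <= v x)%R) ->
  ae_eq leb (oitv 0 a) (rearrangement a v) (EFin \o v).
Proof.
move=> vdec v0; have mv := measurable_decreasing vdec.
have le1 t : oitv 0 a t -> rearrangement a v t <= (v t)%:E.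
  move=> ta; apply: rearrangement_le; first exact: v0.
  have [t0 _] := ta; rewrite -[leRHS]leb_oitv0 ?(ltW t0)//.
  apply: le_measure; rewrite ?inE; [exact: measurable_level|exact: measurable_oitv|].
  move=> x [xa /=]; rewrite ger0_norm ?v0// => vtx; have [x0 _] := xa.
  by split => //; rewrite lte_fin ltNge; apply/negP => /(vdec _ _ ta xa); rewrite leNgt vtx.
have le2 t s : oitv 0 a t -> oitv 0 a s -> (t < s)%R -> (v s)%:E <= rearrangement a v t.
  move=> ta sa ts; apply: le_ereal_inf_tmp => _ [l [l0 vl] <-].
  rewrite lee_fin leNgt; apply/negP => ls; have [s0 _] := sa.
  have : s%:E <= distribution_fun a v l.
    rewrite -[leLHS]leb_oitv0 ?(ltW s0)//.
    apply: le_measure; rewrite ?inE; [exact: measurable_oitv|exact: measurable_level|].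
    move=> x [x0 xs]; have xa : oitv 0 a x by split => //; rewrite (lt_trans xs)//; case: sa.
    split => //=; rewrite ger0_norm ?v0//; apply: (lt_le_trans ls).
    by apply: vdec => //; rewrite -lee_fin ltW.
  by move=> /le_trans /(_ vl); rewrite leNgt lte_fin ts.
have := @interlaced_negligible R (oitv 0 a) (rearrangement a v) (EFin \o v).
move=> /(_ (fun t s ta sa ts => le2 t s ta sa ts)); apply: negligibleS.
move=> t /= H; apply: contrapT => nH; apply: H => ta.
apply/eqP; rewrite eq_le le1//= leNgt; apply/negP => tt.
by apply: nH; split.
Qed.

Lemma integral_rearrangement_decreasing (v : R -> R) (x : R) : decreasing_on a v ->
  (forall x, oitv 0 a x -> (0 <= v x)%R) -> oitv 0 a x ->
  \int[leb]_(t in oitv 0 x%:E) rearrangement a v t =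
  \int[leb]_(t in oitv 0 x%:E) (v t)%:E.
Proof.
move=> vdec v0 [x0 xa]; have sub : oitv 0 x%:E `<=` oitv 0 a by apply: oitv_subr; exact: ltW.
have mx := @measurable_oitv R 0 x%:E.
apply: (ge0_ae_eq_integral mx (measurable_rearrangement a v mx)).
- by apply/measurable_EFinP/(measurable_funS mI sub)/measurable_decreasing.
- by move=> t _; exact: rearrangement_ge0.
- by move=> t /sub ta; rewrite lee_fin v0.
- by have := rearrangement_decreasing vdec v0; apply: filterS => t H /sub; exact: H.
Qed.

End decreasing_functions.

(** * Sets over which |f| attains the integral of its rearrangement *)

Section measure_levels.
Context {R : realType}.
Local Notation T := (caratheodory_type (@wlength R idfun)^*%mu).
Variable a : \bar R.
Hypothesis a_gt0 : (0 < a)%E.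
Variable f : R -> R.
Hypothesis mf : L0 a f.
Hypothesis f_fin : forall l : R, 0 < l -> (distribution_fun a f l < +oo)%E.
Local Open Scope ereal_scope.

Let mI := @measurable_oitv R 0 a.

(** Continuity from above on the sets where |f| > n + 1: they decrease to the empty set and have
    finite measure, so one of them is shorter than t. *)
Lemma rearrangement_fin (t : R) : (0 < t)%R -> rearrangement a f t < +oo.
Proof.
move=> t0.
pose F n := oitv 0 a `&` [set x : R | (n.+1%:R < `|f x|)%R] : set T.
have mF n : measurable (F n) by exact: measurable_level.
have F0 : \bigcap_n F n = set0.
  rewrite -subset0 => x /(_ (Num.truncn `|f x|) I)[_ /=].
  by rewrite ltNge (ltW (truncnS_gt _)).
have cv : (leb \o F) n @[n --> \oo] --> leb (\bigcap_n F n).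
  apply: nonincreasing_cvg_mu => //.
  - exact: f_fin.
  - exact: bigcapT_measurable.
  - move=> m n mn; apply/subsetPset => x [Ix /= nx]; split => //=.
    by rewrite (le_lt_trans _ nx)// ler_nat.
rewrite F0 measure0 in cv.
have /cv[n _ /(_ n (leqnn n))/= ntF] : nbhs (0 : \bar R) [set x | x < t%:E].
  by apply: open_ereal_lt'; rewrite lte_fin.
by apply: (le_lt_trans (rearrangement_le (ler0n _ n.+1) (ltW ntF))); rewrite ltry.
Qed.

Lemma level_ge_length (t c : R) : oitv 0 a t -> (0 <= c)%R ->
  c%:E <= rearrangement a f t ->
  t%:E <= leb (oitv 0 a `&` [set x : R | (c <= `|f x|)%R]).
Proof.
move=> [t0 ta] c0 ct.
have [->|cn0] := eqVneq c 0%R.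
  rewrite (_ : _ `&` _ = oitv 0 a) ?leb_oitv0 ?ltW//.
  by apply/seteqP; split => [x []|x xa]//; split => //=; exact: normr_ge0.
have {}c0 : (0 < c)%R by rewrite lt_neqAle eq_sym cn0.
(* The levels c - c/(n+2) increase to c and remain positive, so that [f_fin] makes continuity from
   above available. *)
pose F n := oitv 0 a `&` [set x : R | (c - c / n.+2%:R < `|f x|)%R] : set T.
have mF n : measurable (F n) by exact: measurable_level.
have cn n : (0 < c - c / n.+2%:R)%R.
  by rewrite subr_gt0 ltr_pdivrMr ?ltr0n// ltr_pMr// ltr1n.
have FE : \bigcap_n F n = oitv 0 a `&` [set x : R | (c <= `|f x|)%R].
  apply/seteqP; split => x.
    move=> Fx; have [xa _] := Fx 0%N I; split => //=; rewrite leNgt; apply/negP => xc.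
    have e0 : (0 < c - `|f x|)%R by rewrite subr_gt0.
    have [_ /=] := Fx (Num.truncn (c / (c - `|f x|))) I; apply/negP; rewrite -leNgt.
    rewrite lerBrDl -lerBrDr ler_pdivrMr ?ltr0n// mulrC -ler_pdivrMr//.
    by rewrite ltW// (lt_trans (truncnS_gt _))// ltr_nat.
  move=> [xa /= cx] n _; split => //=; apply: lt_le_trans cx.
  by rewrite gtrBl divr_gt0// ltr0n.
have cv : (leb \o F) n @[n --> \oo] --> leb (\bigcap_n F n).
  apply: nonincreasing_cvg_mu => //.
  - exact: f_fin.
  - exact: bigcapT_measurable.
  - move=> m n mn; apply/subsetPset => x [Ix /= nx]; split => //=.
    apply: le_lt_trans nx; rewrite lerD2l lerN2 ler_pM2l//.
    by rewrite lef_pV2 ?posrE ?ltr0n// ler_nat.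
rewrite -FE -(cvg_lim _ cv)//; apply: lime_ge.
  by apply/cvg_ex; eexists; exact: cv.
apply: nearW => n; apply: ltW; rewrite /= -/(distribution_fun a f _).
rewrite -rearrangement_gtE ?(ltW a_gt0)// ?(ltW (cn n))// (lt_le_trans _ ct)// lte_fin.
by rewrite gtrBl divr_gt0// ltr0n.
Qed.

(* The measure of B `|` (A `&` (0, x)) is 1-Lipschitz in x. *)
Lemma intermediate_measure (A B : set T) (t : R) : measurable A -> measurable B ->
  B `<=` A -> A `<=` oitv 0 a -> leb B <= t%:E -> t%:E <= leb A ->
  exists E : set T, [/\ measurable E, B `<=` E, E `<=` A & leb E = t%:E].
Proof.
move=> mA mB BA Aa Bt; rewrite le_eqVlt => /predU1P[tA|tA]; first by exists A; split => //; rewrite tA.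
have t0 : (0 <= t)%R by rewrite -lee_fin (le_trans _ Bt).
pose E x : set T := B `|` (A `&` oitv 0 x%:E).
have mE x : measurable (E x).
  by apply: measurableU => //; apply: measurableI => //; exact: measurable_oitv.
have BE x : B `<=` E x by exact: subsetUl.
have EA x : E x `<=` A by move=> z [/BA|[]].
have Emono x y : (x <= y)%R -> E x `<=` E y.
  move=> xy; apply: setUS; apply: setIS => z [z0 zx].
  by split => //; rewrite (lt_le_trans zx).
have E0 x : (x <= 0)%R -> E x = B.
  move=> x0; rewrite /E (_ : oitv 0 x%:E = set0) ?setI0 ?setU0//.
  rewrite -subset0 => z [/= z0 /(lt_trans z0)].
  by rewrite lte_fin ltNge x0.
have Elip x y : (x <= y)%R -> leb (E y) <= leb (E x) + (y - x)%:E.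
  move=> xy; apply: (@le_trans _ _ (leb (E x `|` (oitv (x - 0) y%:E `|` [set x])))).
    apply: le_measure; rewrite ?inE//.
      do 2 apply: measurableU => //; first exact: measurable_oitv.
      exact: measurable_leb.
    move=> z [Bz|[Az [z0 zy]]]; first by left; left.
    have [zx|xz|zx] := ltgtP z x.
    - by left; right; split => //; split.
    - by right; left; split; rewrite ?subr0.
    - by right; right.
  rewrite subr0 setUA; set D := oitv x y%:E.
  have mD : measurable (D : set T) by exact: measurable_oitv.
  have mx : measurable ([set x] : set T) by exact: measurable_leb.
  have h1 : leb ((E x `|` D) `|` [set x]) <= leb (E x `|` D) + leb [set x].
    by apply: measureU2 => //; exact: measurableU.
  have h2 : leb (E x `|` D) <= leb (E x) + leb D by exact: measureU2.
  apply: (le_trans h1); rewrite leb_set1 adde0; apply: (le_trans h2).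
  by rewrite leeD2l// /D leb_oitv.
have Efin x : leb (E x) \is a fin_num.
  rewrite ge0_fin_numE ?measure_ge0//.
  have [/E0 ->|/ltW x0] := leP x 0%R; first exact: le_lt_trans Bt (ltry _).
  apply: (le_lt_trans (Elip _ _ x0)); rewrite E0// -[X in _ + X]/((x - 0)%:E).
  by rewrite lte_add_pinfty ?ltry// (le_lt_trans Bt)// ltry.
pose phi x := fine (leb (E x)).
have phiE x : leb (E x) = (phi x)%:E by rewrite fineK.
have phi_lip x y : (`|phi x - phi y| <= `|x - y|)%R.
  wlog xy : x y / (x <= y)%R.
    move=> H; have [/H//|/ltW/H] := leP x y.
    by rewrite distrC [leRHS]distrC.
  have h1 : (phi x <= phi y)%R.
    by rewrite -lee_fin -!phiE; apply: le_measure; rewrite ?inE//; exact: Emono.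
  have h2 : (phi y <= phi x + (y - x))%R by rewrite -lee_fin EFinD -!phiE Elip.
  rewrite ler0_norm ?subr_le0// ler0_norm ?subr_le0//; lra.
have phi_cont : continuous phi.
  move=> x; apply/cvgrPdist_le => e e0; have := @nbhsx_ballx R R x e e0.
  by apply: filterS => y xy; apply: (le_trans (phi_lip _ _)); exact: ltW.
have [n tn] : exists n : nat, (t < phi n%:R)%R.
  have AE : \bigcup_n E n%:R = A.
    apply/seteqP; split => [z [n _]|z Az]; first exact: EA.
    exists (Num.truncn z).+1 => //; right; split => //; have [z0 _] := Aa _ Az.
    by split => //; rewrite lte_fin truncnS_gt.
  move: tA; rewrite -AE measure_bigcup_sup//; last first.
    by move=> m n mn; apply/subsetPset/Emono; rewrite ler_nat.
  by move=> /ereal_sup_gt[_ [n _ <-]]; rewrite /= phiE lte_fin; exists n.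
have phi0 : (phi 0 <= t)%R by rewrite -lee_fin -phiE E0.
have [x _ xt] : exists2 x, x \in `[0%R, n%:R] & phi x = t.
  apply: IVT; first exact: ler0n.
    exact: continuous_subspaceT.
  by rewrite ge_min phi0/= le_max (ltW tn) orbT.
by exists (E x); split => //; rewrite phiE xt.
Qed.

(** With c the value of the rearrangement at t, the set where |f| > c has measure at most t and the
    set where |f| >= c has measure at least t. A set E of measure exactly t is inserted between
    them; it contains the largest values of |f|. *)
Lemma ex_level_set (t : R) : oitv 0 a t ->
  exists E : set T, [/\ measurable E, E `<=` oitv 0 a, leb E = t%:E &
    \int[leb]_(s in oitv 0 t%:E) rearrangement a f s <=
    \int[leb]_(x in E) `|f x|%:E].
Proof.
move=> ta; have [t0 ta'] := ta.
pose c := fine (rearrangement a f t).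
have cE : rearrangement a f t = c%:E.
  by rewrite fineK// ge0_fin_numE ?rearrangement_ge0// rearrangement_fin// -lte_fin.
have c0 : (0 <= c)%R by rewrite -lee_fin -cE rearrangement_ge0.
have a0 := ltW a_gt0.
pose B := oitv 0 a `&` [set x : R | (c < `|f x|)%R] : set T.
pose A := oitv 0 a `&` [set x : R | (c <= `|f x|)%R] : set T.
have mabs : measurable_fun (oitv 0 a : set T) (fun x => `|f x|%:E).
  by apply/measurable_EFinP/measurableT_comp.
have mA : measurable A.
  have := @emeasurable_fun_c_infty _ T R _ _ mI mabs c%:E.
  by congr measurable; apply/seteqP; split => x [Ix /=]; rewrite lee_fin.
have mB : measurable B by exact: measurable_level.
have [||||E [mE BE EA Et]] := @intermediate_measure A B t mA mB.
- by move=> x [xa /= cx]; split => //=; exact: ltW.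
- exact: subIsetl.
- by rewrite leNgt -/(distribution_fun a f c) -rearrangement_gtE// cE ltxx.
- by apply: level_ge_length => //; rewrite cE.
have Ea : E `<=` oitv 0 a by move=> x /EA[].
exists E; split => //.
have mt := @measurable_oitv R 0 t%:E.
under eq_integral do rewrite -[rearrangement _ _ _]mul1e.
under [leRHS]eq_integral do rewrite -[_%:E]mul1e.
apply: (le_integral_layers mt (measurable_cst 1) (measurable_rearrangement a f mt) _ _
   mE (measurable_cst 1) (measurable_funS mI Ea mabs)).
- by move=> x _; exact: lee01.
- by move=> x _; exact: rearrangement_ge0.
- by move=> x _; exact: lee01.
- by move=> x _; rewrite lee_fin.
move=> l l0; have mEl : measurable (E `&` [set x | l%:E < `|f x|%:E]).
  exact: (emeasurable_fun_o_infty mE (measurable_funS mI Ea mabs)).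
have mtl : measurable (oitv 0 t%:E `&` [set x : R | l%:E < rearrangement a f x] : set T).
  by apply: emeasurable_fun_o_infty => //; exact: measurable_rearrangement.
(* Below c the layer of |f| on E is all of E, of measure t. From c upwards E contains the whole
   level set, whose measure bounds the layer of the rearrangement. *)
rewrite !integral_cst// !mul1e; have [lc|cl] := ltP l c.
  apply: (@le_trans _ _ t%:E).
    rewrite -[leRHS]leb_oitv0 ?(ltW t0)//; apply: le_measure; rewrite ?inE//.
  rewrite -Et; apply: le_measure; rewrite ?inE// => x Ex; split => //=.
  by rewrite lte_fin; have [_ /=] := EA _ Ex; exact: lt_le_trans.
apply: (@le_trans _ _ (distribution_fun a f l)).
  rewrite -[leRHS]leb_oitv0 ?distribution_fun_ge0// -rearrangement_level ?(ltW l0)//.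
  apply: le_measure; rewrite ?inE//.
    by apply: emeasurable_fun_o_infty => //; exact: measurable_rearrangement.
  by move=> x [xt /= lx]; split => //; apply: oitv_subr xt; exact: ltW.
apply: le_measure; rewrite ?inE//; first exact: measurable_level.
move=> x [xa /= lx]; split; last by rewrite /= lte_fin.
by apply: BE; split => //=; rewrite (le_lt_trans cl).
Qed.

End measure_levels.

(** * Primitives and least concave majorants *)

(** The endpoint 0 and a finite endpoint a are included because F - l W may attain its maximum
    there. *)
Definition closed_domain {R : realType} (a : \bar R) : set R :=
  [set t : R | 0 <= t /\ (t%:E <= a)%E].

Section domain.
Context {R : realType}.
Variable a : \bar R.
Hypothesis a_gt0 : (0 < a)%E.
Local Notation K := (closed_domain a).
Local Notation I := (oitv 0 a).

Lemma closed_domain0 : K 0. Proof. by split => //=; exact: ltW. Qed.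

Lemma oitvK t : I t -> K t.
Proof. by move=> [t0 ta]; split; [rewrite -lee_fin ltW|exact: ltW]. Qed.

Lemma closed_domain_between s t x : K s -> K t -> s <= x <= t -> K x.
Proof.
move=> [s0 _] [_ ta] /andP[sx xt]; split; first exact: le_trans sx.
by apply: le_trans ta; rewrite lee_fin.
Qed.

Lemma oitv_between s t x : K s -> K t -> s < x < t -> I x.
Proof.
move=> [s0 _] [_ ta] /andP[sx xt]; split; first by rewrite lte_fin (le_lt_trans s0).
by apply: lt_le_trans ta; rewrite lte_fin.
Qed.

End domain.

Definition primitive {R : realType} (u : R -> R) (t : R) : R :=
  fine (\int[leb]_(x in oitv 0 t%:E) (u x)%:E)%E.

Section primitives.
Context {R : realType}.
Local Notation T := (caratheodory_type (@wlength R idfun)^*%mu).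
Variables (a : \bar R) (u : R -> R).
Hypothesis a_gt0 : (0 < a)%E.
Local Notation K := (closed_domain a).
Local Notation I := (oitv 0 a).
Local Notation P := (primitive u).
Hypothesis u_decr : decreasing_on a u.
Hypothesis u_ge0 : forall x, I x -> 0 <= u x.
Hypothesis u_fin : forall t, K t -> (\int[leb]_(x in oitv 0 t%:E) (u x)%:E < +oo)%E.

Lemma oitv_closed_domain s t : 0 <= s -> K t -> oitv s t%:E `<=` I.
Proof.
move=> s0 [_ ta] x /(oitv_sub0 s0) x0t; exact: oitv_subr x0t.
Qed.

Lemma measurable_decreasing_itv s t : 0 <= s -> K t ->
  measurable_fun (oitv s t%:E : set T) (fun x => (u x)%:E).
Proof.
move=> s0 tK; apply: (measurable_funS (@measurable_oitv R 0 a) (oitv_closed_domain s0 tK)).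
exact/measurable_EFinP/measurable_decreasing.
Qed.

Lemma primitiveE t : K t ->
  (\int[leb]_(x in oitv 0 t%:E) (u x)%:E = (P t)%:E)%E.
Proof.
move=> tK; rewrite fineK// ge0_fin_numE ?u_fin//; apply: integral_ge0 => x xt.
by rewrite lee_fin u_ge0//; exact: oitv_closed_domain xt.
Qed.

Lemma primitive0 : P 0 = 0.
Proof.
rewrite /primitive (_ : oitv 0 0%:E = set0) ?integral_set0//.
by rewrite -subset0 => x [/= x0 /(lt_trans x0)]; rewrite ltxx.
Qed.

Lemma primitive_itv s t : 0 <= s <= t -> K t ->
  (\int[leb]_(x in oitv s t%:E) (u x)%:E = (P t - P s)%:E)%E.
Proof.
move=> /andP[s0 st] tK; have sK : K s.
  by have [_ ta] := tK; split => //; rewrite (le_trans _ ta)// lee_fin.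
have := @ge0_integral_oitv_split R (EFin \o u) 0 s t.
rewrite s0 st => /(_ isT (measurable_decreasing_itv (lexx 0) tK)).
move=> /(_ (fun x xt => u_ge0 (oitv_closed_domain (lexx 0) tK xt))).
rewrite /= !primitiveE// EFinB => ->.
by rewrite [X in (X - _)%E]addeC addeK.
Qed.

Lemma primitive_mono s t : K s -> K t -> s <= t -> P s <= P t.
Proof.
move=> [s0 _] tK st; rewrite -subr_ge0 -lee_fin -primitive_itv ?s0//.
apply: integral_ge0 => x xt; rewrite lee_fin u_ge0//.
exact: oitv_closed_domain xt.
Qed.

Lemma primitive_ge s t : 0 <= s <= t -> I t -> u t * (t - s) <= P t - P s.
Proof.
move=> /andP[s0 st] tI; have tK := oitvK tI.
rewrite -lee_fin -primitive_itv ?s0// EFinM.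
have m : measurable (oitv s t%:E : set T) by exact: measurable_oitv.
rewrite EFinB -leb_oitv ?lee_fin// -[leLHS](integral_cst leb m (u t)%:E).
apply: (ge0_le_integral leb m _ (measurable_cst _) (measurable_decreasing_itv s0 tK)).
- by move=> x _; rewrite lee_fin u_ge0.
- move=> x [sx xt]; rewrite lee_fin; apply: u_decr => //; last by rewrite -lee_fin ltW.
  by apply: (oitv_closed_domain s0 tK); split.
Qed.

Lemma primitive_le s t : I s -> s <= t -> K t -> P t - P s <= u s * (t - s).
Proof.
move=> sI st tK; have s0 : 0 <= s by case: sI => /ltW.
rewrite -lee_fin -primitive_itv ?s0// EFinM.
have m : measurable (oitv s t%:E : set T) by exact: measurable_oitv.
rewrite EFinB -leb_oitv ?lee_fin// -[leRHS](integral_cst leb m (u s)%:E).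
apply: (ge0_le_integral leb m _ (measurable_decreasing_itv s0 tK) (measurable_cst _)).
- by move=> x xt; rewrite lee_fin u_ge0//; exact: oitv_closed_domain xt.
- move=> x [sx xt]; rewrite lee_fin; apply: u_decr => //; last by rewrite -lee_fin ltW.
  by apply: (oitv_closed_domain s0 tK); split.
Qed.

Lemma primitive_lt s t : (forall x, I x -> 0 < u x) -> K s -> K t -> s < t -> P s < P t.
Proof.
move=> u_gt0 sK tK st; have s0 : 0 <= s by case: sK.
pose m := (s + t) / 2; have sm : s < m by rewrite /m; lra.
have mt : m < t by rewrite /m; lra.
have mI : I m by apply: (oitv_between sK tK); rewrite sm.
have mK := oitvK mI.
apply: (@lt_le_trans _ _ (P m)); last by apply: primitive_mono => //; exact: ltW.
rewrite -subr_gt0; apply: lt_le_trans (primitive_ge _ mI); last by rewrite s0 ltW.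
by rewrite mulr_gt0 ?u_gt0// subr_gt0.
Qed.

Lemma ge0_integral_oitv_le_left (t : R) (M : \bar R) (v : R -> \bar R) :
  measurable_fun (oitv 0 t%:E : set T) v -> (forall x, oitv 0 t%:E x -> (0 <= v x)%E) ->
  (forall s : R, 0 < s < t -> (\int[leb]_(x in oitv s t%:E) v x <= M)%E) -> (0 <= M)%E ->
  (\int[leb]_(x in oitv 0 t%:E) v x <= M)%E.
Proof.
move=> mv v0 vM M0; have [t0|t0] := leP t 0.
  rewrite (_ : oitv _ _ = set0) ?integral_set0//.
  by rewrite -subset0 => x [/= x0 /(lt_trans x0)]; rewrite lte_fin ltNge t0.
pose s_ n := t / n.+2%:R.
have s0 n : 0 < s_ n by rewrite divr_gt0.
have st n : s_ n < t by rewrite ltr_pdivrMr// ltr_pMr// ltr1n.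
have tU : oitv 0 t%:E = \bigcup_n oitv (s_ n) t%:E.
  apply/seteqP; split => x.
    move=> [x0 xt]; rewrite lte_fin in x0; exists (Num.truncn (t / x)) => //; split => //.
    rewrite lte_fin ltr_pdivrMr// mulrC -ltr_pdivrMr//.
    by rewrite (lt_trans (truncnS_gt _))// ltr_nat.
  by move=> [n _ [xn xt]]; split => //; rewrite (lt_trans _ xn)// lte_fin.
rewrite tU in mv v0 *.
have mF n : measurable (oitv (s_ n) t%:E : set T) by exact: measurable_oitv.
have ndF : nondecreasing_seq (fun n => oitv (s_ n) t%:E : set T).
  move=> m n mn; apply/subsetPset => x [xm xt]; split => //.
  apply: le_lt_trans xm; rewrite lee_fin ler_pM2l//.
  by rewrite lef_pV2 ?posrE// ler_nat.
have mvF n : measurable_fun (oitv (s_ n) t%:E : set T) v.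
  by apply: measurable_funS mv; [exact: bigcupT_measurable|move=> x xn; exists n].
have vF n x : oitv (s_ n) t%:E x -> (0 <= v x)%E by move=> xn; apply: v0; exists n.
have cvF := @ge0_nondecreasing_set_cvg_integral _ T R
  (fun n => oitv (s_ n) t%:E : set T) v leb ndF mF mvF vF.
rewrite -(cvg_lim _ cvF)//; apply: lime_le; first by apply/cvg_ex; eexists; exact: cvF.
by apply: nearW => n; apply: vM; rewrite s0 st.
Qed.

(** Continuity of P at 0, near which u may be unbounded. If P exceeded e on all of I, the integrals
    over (s, t) would stay below P t - e, and so would their limit P t. *)
Lemma primitive_small e : 0 < e -> exists2 t, I t & P t <= e.
Proof.
move=> e0; have [r /andP[r0 ra]] := rat_between a_gt0.
pose t : R := ratr r; have tI : I t by split.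
have tK := oitvK tI; apply: contrapT => H.
have Pe s : I s -> e < P s.
  by move=> sI; rewrite ltNge; apply/negP => se; apply: H; exists s.
have : (\int[leb]_(x in oitv 0 t%:E) (u x)%:E <= (P t - e)%:E)%E.
  apply: ge0_integral_oitv_le_left.
  - exact: measurable_decreasing_itv.
  - by move=> x xt; rewrite lee_fin u_ge0//; exact: oitv_closed_domain xt.
  - move=> s /andP[s0 st]; rewrite primitive_itv ?(ltW s0) ?(ltW st)//.
    rewrite lee_fin lerD2l lerN2 ltW// Pe//.
    by apply: (oitv_between (closed_domain0 a_gt0) tK); rewrite s0.
  - by rewrite lee_fin subr_ge0 ltW// Pe.
by rewrite primitiveE// lee_fin; lra.
Qed.

Lemma primitive_continuous : {within K, continuous P}.
Proof.
apply/subspace_continuousP => t tK; apply/cvgrPdist_le => e e0.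
rewrite near_withinE; have [t0|t0] := ltP 0 t; last first.
  have -> : t = 0 by apply/eqP; rewrite eq_le t0; case: tK.
  have [d dI Pd] := primitive_small e0.
  have d0 : 0 < d by case: dI.
  exists d => //= s /=; rewrite sub0r normrN => sd sK; have s0 : 0 <= s by case: sK.
  have Ps : P s <= P d.
    by apply: primitive_mono => //; [exact: oitvK|rewrite (le_trans _ (ltW sd))// ler_norm].
  have Ps0 : 0 <= P s by rewrite -primitive0 primitive_mono//; exact: closed_domain0.
  rewrite -[X in X <= _]/`|P 0 - P s|.
  by rewrite primitive0 sub0r normrN ger0_norm// (le_trans Ps).
(* Away from 0 the primitive is Lipschitz: beyond r = t/2 the density is at most [u r]. *)
pose r := t / 2; have r0 : 0 < r by rewrite divr_gt0.
have rt : r < t by rewrite /r; lra.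
have rI : I r by apply: (oitv_between (closed_domain0 a_gt0) tK); rewrite r0.
have lip x y : r <= x -> x <= y -> K y -> P y - P x <= u r * (y - x).
  move=> rx; rewrite le_eqVlt => /predU1P[->|xy] yK; first by rewrite !subrr mulr0.
  have xI : I x by apply: (oitv_between (closed_domain0 a_gt0) yK); rewrite (lt_le_trans r0).
  apply: (le_trans (primitive_le xI (ltW xy) yK)).
  by rewrite ler_wpM2r ?subr_ge0 ?(ltW xy)// u_decr.
have ur := u_ge0 rI.
have u1 : 0 < u r + 1 by rewrite ltr_wpDl.
exists (Num.min r (e / (u r + 1))) => /=; first by rewrite lt_min r0 divr_gt0.
move=> s /=; rewrite lt_min => /andP[sr se] sK.
have h : u r * `|t - s| <= e.
  rewrite (@le_trans _ _ (u r * (e / (u r + 1))))//; first by rewrite ler_wpM2l// ltW.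
  rewrite mulrCA -[leRHS]mulr1 ler_pM2l// ler_pdivrMr//; lra.
have [ts|st] := leP t s.
  have h1 := lip _ _ (ltW rt) ts sK; have h2 := primitive_mono tK sK ts.
  move: h; rewrite !ler0_norm ?subr_le0// !opprB; exact: le_trans.
have rs : r <= s by move: sr; rewrite ltr_norml /r; lra.
have h1 := lip _ _ rs (ltW st) tK; have h2 := primitive_mono sK tK (ltW st).
move: h; rewrite !ger0_norm ?subr_ge0// ?(ltW st)//; exact: le_trans.
Qed.

End primitives.

(* Along a partition into N steps of equal psi-increment the variation of G is at
   most (phi s - phi t) (psi t - psi s) / N. *)
Lemma product_increment_const {R : realType} (G phi psi : R -> R) (s t : R) :
  s <= t -> {within `[s, t], continuous psi} ->
  (forall x y, s <= x -> x <= y -> y <= t ->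
    `|G y - G x| <= (phi x - phi y) * (psi y - psi x)) ->
  (forall x y, s <= x -> x <= y -> y <= t -> phi y <= phi x) ->
  (forall x y, s <= x -> x <= y -> y <= t -> psi x <= psi y) ->
  G t = G s.
Proof.
move=> st psic GH phin psin.
have phist := phin _ _ (lexx s) st (lexx t).
have psist := psin _ _ (lexx s) st (lexx t).
have bound N : `|G t - G s| <= (phi s - phi t) * (psi t - psi s) / N.+1%:R.
  pose d := (psi t - psi s) / N.+1%:R.
  have d0 : 0 <= d by rewrite divr_ge0// subr_ge0.
  have dN : d * N.+1%:R = psi t - psi s by rewrite divfK.
  (* After i steps psi has grown by i d; the drops of phi telescope, so the variation of G is
     bounded by the total drop times d. Continuity of psi gives the next point. *)
  have step i : (i <= N.+1)%N -> exists x, [/\ s <= x, x <= t, psi x = psi s + i%:R * d &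
      `|G x - G s| <= (phi s - phi x) * d].
    elim: i => [_|i IH iN].
      by exists s; rewrite mulr0n !subrr !mul0r addr0 normr0.
    have [x [sx xt px Gx]] := IH (ltnW iN).
    have iN' : i.+1%:R * d <= psi t - psi s.
      by rewrite -dN mulrC ler_wpM2l// ler_nat.
    have [y] : exists2 y, y \in `[x, t] & psi y = psi s + i.+1%:R * d.
      apply: IVT => //.
        apply: continuous_subspaceW psic => z /=; rewrite !in_itv/= => /andP[xz ->].
        by rewrite (le_trans sx).
      have pxt := psin _ _ sx xt (lexx t).
      rewrite (min_idPl pxt) (max_idPr pxt) px lerD2l ler_wpM2r ?ler_nat//=.
      by rewrite -lerBrDl.
    rewrite in_itv/= => /andP[xy yt] py.
    exists y; split => //; first exact: le_trans xy.
    have := GH _ _ sx xy yt; rewrite py px.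
    have -> : psi s + i.+1%:R * d - (psi s + i%:R * d) = d by rewrite -natr1; ring.
    have -> : G y - G s = (G y - G x) + (G x - G s) by ring.
    move=> Gy; apply: (le_trans (ler_normD _ _)); move: Gx Gy; lra.
  (* After N + 1 steps psi has reached its value at t, although x may still be left of t. Since psi
     does not grow on [x, t], neither does G change there. *)
  have [x [sx xt px Gx]] := step _ (leqnn _).
  have := GH _ _ sx xt (lexx t).
  have -> : psi t - psi x = 0 by rewrite px mulrC dN; ring.
  rewrite mulr0 normr_le0 subr_eq0 => /eqP Gt.
  rewrite Gt (le_trans Gx)// -mulrA -/d ler_wpM2r// lerD2l lerN2.
  exact: phin.
apply/eqP; rewrite -subr_eq0 -normr_le0; apply/ler_addgt0Pr => e e0.
rewrite add0r; set c := (phi s - phi t) * (psi t - psi s) in bound.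
have c0 : 0 <= c by rewrite mulr_ge0// subr_ge0.
apply: (le_trans (bound (Num.truncn (c / e)))).
rewrite ler_pdivrMr// mulrC -ler_pdivrMr//; apply: ltW; exact: truncnS_gt.
Qed.

(* t maximises F - l W, i.e. the line of slope l through (W t, F t) supports
   the graph {(W s, F s)} from above. *)
Definition contact {R : realType} (a : \bar R) (F W : R -> R) (l t : R) : Prop :=
  closed_domain a t /\
  forall s, closed_domain a s -> F s - l * W s <= F t - l * W t.

(* The right-continuous slope of the least concave majorant of F as a function
   of W. *)
Definition slope {R : realType} (a : \bar R) (F W : R -> R) (t : R) : R :=
  sup [set l : R | l = 0 \/ (0 < l /\ exists2 s, contact a F W l s & t < s)].

(** * Contact points, slope and majorant, given a contact point at every positive level *)

Section contact_points.
Context {R : realType}.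
Local Notation T := (caratheodory_type (@wlength R idfun)^*%mu).
Variables (a : \bar R) (phi w : R -> R).
Hypothesis a_gt0 : (0 < a)%E.
Local Notation K := (closed_domain a).
Local Notation I := (oitv 0 a).
Local Notation F := (primitive phi).
Local Notation W := (primitive w).
Local Notation contact := (contact a F W).
Local Notation slope := (slope a F W).
Hypothesis phi_decr : decreasing_on a phi.
Hypothesis phi_ge0 : forall x, I x -> 0 <= phi x.
Hypothesis phi_fin :
  forall t, K t -> (\int[leb]_(x in oitv 0 t%:E) (phi x)%:E < +oo)%E.
Hypothesis w_decr : decreasing_on a w.
Hypothesis w_gt0 : positive_on a w.
Hypothesis w_fin :
  forall t, K t -> (\int[leb]_(x in oitv 0 t%:E) (w x)%:E < +oo)%E.
Hypothesis contact_ex : forall l, 0 < l -> exists s, contact l s.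

Let K0 := closed_domain0 a_gt0.
Let w_ge0 x (xI : I x) : 0 <= w x := ltW (w_gt0 xI).
Let F0 : F 0 = 0 := primitive0 phi.
Let W0 : W 0 = 0 := primitive0 w.
Let Fmono := primitive_mono phi_decr phi_ge0 phi_fin.
Let Wmono s t := primitive_lt w_decr w_ge0 w_fin w_gt0 (s := s) (t := t).
Let Fcont := primitive_continuous a_gt0 phi_decr phi_ge0 phi_fin.
Let Wcont := primitive_continuous a_gt0 w_decr w_ge0 w_fin.

Lemma weight_primitive_le s t : K s -> K t -> s <= t -> W s <= W t.
Proof.
by move=> sK tK; rewrite le_eqVlt => /predU1P[->//|st]; apply/ltW/Wmono.
Qed.

Lemma weight_primitive_ge0 t : K t -> 0 <= W t.
Proof. by move=> tK; rewrite -W0; apply: weight_primitive_le => //; case: tK. Qed.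

Lemma weight_primitive_gt0 t : K t -> 0 < t -> 0 < W t.
Proof. by move=> tK t0; rewrite -W0; apply: Wmono => //; exact: K0. Qed.

(** Adding the two maximality inequalities gives (m - l)(W t - W s) <= 0, and W is strictly
    increasing. *)
Lemma contact_mono l m s t : l < m -> contact l s -> contact m t -> t <= s.
Proof.
move=> lm [sK sc] [tK tc]; rewrite leNgt; apply/negP => st.
have h1 := sc _ tK; have h2 := tc _ sK; have h3 := Wmono sK tK st.
by nra.
Qed.

Let Sl t := [set l : R | l = 0 \/ (0 < l /\ exists2 s, contact l s & t < s)].

(** A level l > 1 with a contact point s > t has s left of the contact point s1 of level 1.
    Comparison with the origin gives l W t <= l W s <= F s <= F s1, which explains the bound 1 + F
    s1 / W t. *)
Lemma slope_set_ub t : I t -> has_ubound (Sl t).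
Proof.
move=> tI; have tK := oitvK tI; have t0 : 0 < t by case: tI.
have [s1 c1] := contact_ex ltr01.
have Wt := weight_primitive_gt0 tK t0.
exists (1 + F s1 / W t) => l [->|[l0 [s [sK sc] ts]]].
  rewrite addr_ge0// divr_ge0// ?(ltW Wt)// -F0; apply: Fmono; first exact: K0.
    by case: c1.
  by case: c1 => -[].
have [l1|l1] := leP l 1.
  rewrite (le_trans l1)// lerDl divr_ge0 ?(ltW Wt)// -F0.
  by apply: Fmono; [exact: K0|case: c1|case: c1 => -[]].
have ss1 : s <= s1 by apply: contact_mono l1 c1 _; split.
have := sc _ K0; rewrite F0 W0 mulr0 subr0 => h.
have h2 : F s <= F s1 by apply: Fmono => //; case: c1.
have h3 := Wmono tK sK ts.
rewrite -lerBlDl ler_pdivlMr//; nra.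
Qed.

Let Sl0 t : Sl t !=set0. Proof. by exists 0; left. Qed.

Lemma slope_ge0 t : I t -> 0 <= slope t.
Proof. by move=> tI; apply: ub_le_sup; [exact: slope_set_ub|left]. Qed.

(** Together with [lt_slope_contact] this makes [slope t] the threshold level: contact points of
    higher levels do not lie beyond t, those of lower levels do. *)
Lemma slope_lt_contact t m s : I t -> slope t < m -> contact m s -> s <= t.
Proof.
move=> tI tm mc; rewrite leNgt; apply/negP => ts.
have m0 : 0 < m by exact: le_lt_trans (slope_ge0 tI) tm.
move: tm; apply/negP; rewrite -leNgt; apply: ub_le_sup.
  exact: slope_set_ub.
by right; split => //; exists s.
Qed.

Lemma lt_slope_contact t m s : I t -> 0 <= m -> m < slope t -> contact m s -> t < s.
Proof.
move=> tI m0 mt mc; have [l [l0|[l0 [s' c' ts']]] ml] := sup_gt (Sl0 t) mt.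
  by move: ml; rewrite l0 ltNge m0.
by apply: (lt_le_trans ts'); exact: contact_mono ml mc c'.
Qed.

Lemma slope_nonincr s t : I s -> I t -> s <= t -> slope t <= slope s.
Proof.
move=> sI tI st; apply: ge_sup; [exact: Sl0|move=> l Sl_l; apply: ub_le_sup].
  exact: slope_set_ub.
case: Sl_l => [->|[l0 [x xc tx]]]; first by left.
by right; split => //; exists x => //; exact: le_lt_trans tx.
Qed.

Let D l t := F t - l * W t.

Let Dcont l s t : K s -> K t -> {within `[s, t], continuous (D l)}.
Proof.
move=> sK tK; have sub : `[s, t]%classic `<=` K.
  by move=> x /=; rewrite in_itv/=; exact: closed_domain_between.
have Fc := continuous_subspaceW sub Fcont.
have Wc := continuous_subspaceW sub Wcont.
move=> x; apply: cvgB; first exact: Fc.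
by apply: cvgM; [exact: cvg_cst|exact: Wc].
Qed.

(** A maximiser of F - l W over [0, t], for l = slope t, is a global one. Levels l + d have a
    contact point in [0, t], which controls F s - (l + d) W s for every s, and d tends to 0. *)
Lemma ex_contact_left t : I t -> exists2 x, contact (slope t) x & x <= t.
Proof.
move=> tI; have tK := oitvK tI; have t0 : 0 <= t by case: tK.
have [x] := EVT_max t0 (@Dcont (slope t) _ _ K0 tK).
rewrite in_itv/= => /andP[x0 xt] xmax.
have xK : K x by apply: (closed_domain_between K0 tK); rewrite x0.
exists x => //; split => // s sK; apply/ler_addgt0Pr => e e0.
have Ws0 := weight_primitive_ge0 sK.
pose d := e / (W s + 1).
have d0 : 0 < d by rewrite divr_gt0// ltr_wpDl.
have m0 : 0 < slope t + d by rewrite ltr_wpDl// slope_ge0.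
have [y yc] := contact_ex m0.
have yt : y <= t by apply: slope_lt_contact yc => //; rewrite ltrDl.
have [yK ymax] := yc; have y0 : 0 <= y by case: yK.
have h1 := ymax _ sK.
have := xmax y; rewrite in_itv/= y0 yt => /(_ isT); rewrite /D => h2.
have Wy := weight_primitive_ge0 yK.
have de : d * W s <= e.
  rewrite /d mulrAC ler_pdivrMr ?ltr_wpDl//; nra.
have : 0 <= d * W y by rewrite mulr_ge0// ltW.
by move: h1 h2 de; rewrite !mulrDl; lra.
Qed.

Lemma ex_contact_right t : I t -> 0 < slope t ->
  exists2 x, contact (slope t) x & t <= x.
Proof.
move=> tI l0; have tK := oitvK tI.
have hl0 : 0 < slope t / 2 by rewrite divr_gt0.
have hl : slope t / 2 < slope t by rewrite ltr_pdivrMr// ltr_pMr// ltr1n.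
have [s0 s0c] := contact_ex hl0; have [s0K _] := s0c.
have ts0 := lt_slope_contact tI (ltW hl0) hl s0c.
have [x] := EVT_max (ltW ts0) (@Dcont (slope t) _ _ tK s0K).
rewrite in_itv/= => /andP[tx xs0] xmax.
have xK : K x by apply: (closed_domain_between tK s0K); rewrite tx.
exists x => //; split => // s sK; apply/ler_addgt0Pr => e e0.
have Ws0 := weight_primitive_ge0 s0K.
(* Here the level is approached from below. The first bound makes the error d W s0 at most e; the
   second keeps the level above half the slope, so that its contact point stays left of s0 and the
   maximum is taken on a compact interval. *)
pose d := Num.min (e / (W s0 + 1)) (slope t / 4).
have d0 : 0 < d by rewrite lt_min !divr_gt0// ltr_wpDl.
have de' : d <= e / (W s0 + 1) by rewrite ge_min lexx.
have dl : d <= slope t / 4 by rewrite ge_min lexx orbT.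
have m0 : slope t / 2 < slope t - d by lra.
have [y yc] := contact_ex (lt_trans hl0 m0).
have yt : t < y by apply: lt_slope_contact yc => //; lra.
have ys0 : y <= s0 by exact: contact_mono m0 s0c yc.
have [yK ymax] := yc.
have h1 := ymax _ sK.
have := xmax y; rewrite in_itv/= ys0 (ltW yt) => /(_ isT); rewrite /D => h2.
have Wy : W y <= W s0 by exact: weight_primitive_le.
have Ws := weight_primitive_ge0 sK.
have de : d * W s0 <= e.
  by apply: le_trans (ler_wpM2r Ws0 de') _; rewrite mulrAC ler_pdivrMr ?ltr_wpDl//; nra.
have : d * W y <= d * W s0 by rewrite ler_wpM2l// ltW.
have : 0 <= d * W s by rewrite mulr_ge0// ltW.
by move: h1 h2 de; rewrite !mulrBl; lra.
Qed.

Lemma contact_closed l t : K t ->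
  (forall e, 0 < e -> exists2 s, contact l s & `|t - s| < e) -> contact l t.
Proof.
move=> tK H; split => // s sK; apply/ler_addgt0Pr => e e0.
have /subspace_continuousP/(_ t tK)Fc := Fcont.
have /subspace_continuousP/(_ t tK)Wc := Wcont.
have Dc : D l x @[x --> within K (nbhs t)] --> D l t.
  by apply: cvgB => //; apply: cvgM => //; exact: cvg_cst.
move/cvgrPdist_lt : Dc => /(_ _ e0); rewrite near_withinE => -[d /= d0 dH].
have [x [xK xc] tx] := H _ d0.
have := dH x tx xK; have := xc _ sK; rewrite -/(D l s) -/(D l x) -/(D l t).
by rewrite ltr_norml => h1 /andP[h2 h3]; lra.
Qed.

(** The contact set of a level is closed, and it is bounded by any contact point of level l/2; its
    extreme points will be the ends of a maximal level interval. *)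
Lemma ex_contact_minmax l : 0 < l -> exists m M,
  [/\ contact l m, contact l M & forall s, contact l s -> m <= s <= M].
Proof.
move=> l0; have [s1 c1] := contact_ex l0.
have hl0 : 0 < l / 2 by rewrite divr_gt0.
have hl : l / 2 < l by rewrite ltr_pdivrMr// ltr_pMr// ltr1n.
have [s0 c0] := contact_ex hl0.
pose A := [set s | contact l s].
have A0 : A !=set0 by exists s1.
have Aub : ubound A s0 by move=> s; exact: contact_mono hl c0.
have Alb : lbound A 0 by move=> s [[]].
have infA : has_inf A by split => //; exists 0.
have supA : has_sup A by split => //; exists s0.
have i0 : 0 <= inf A by exact: lb_le_inf.
have i1 s : A s -> inf A <= s by move=> As; apply: ge_inf => //; exists 0.
have j1 s : A s -> s <= sup A by move=> As; apply: ub_le_sup => //; exists s0.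
have c1K : K s1 by case: c1. have c0K : K s0 by case: c0.
have iK : K (inf A) by apply: (closed_domain_between K0 c1K); rewrite i0 i1.
have jK : K (sup A) by apply: (closed_domain_between c1K c0K); rewrite j1//= ge_sup.
exists (inf A), (sup A); split.
- apply: contact_closed => // e e0; have [s As se] := inf_adherent e0 infA.
  by exists s => //; rewrite ler0_norm ?subr_le0 ?i1// opprB ltrBlDl.
- apply: contact_closed => // e e0; have [s As se] := sup_adherent e0 supA.
  by exists s => //; rewrite ger0_norm ?subr_ge0 ?j1// ltrBlDl -ltrBlDr.
- by move=> s As; rewrite i1 ?j1.
Qed.

(** If the slope at x differed from l, the contact points of an intermediate level would have to lie
    on one side of x by the threshold property, and on the other side by monotonicity against s or
    t. *)
Lemma slope_const l s t x : 0 <= l -> contact l s -> contact l t -> s < x < t ->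
  slope x = l.
Proof.
move=> l0 sc tc sxt; have /andP[sx xt] := sxt.
have xI : I x by apply: oitv_between sxt; [case: sc|case: tc].
apply/eqP; rewrite eq_le !leNgt; apply/andP; split; apply/negP => H.
  pose m := (l + slope x) / 2; have lm : l < m by rewrite /m; lra.
  have mx : m < slope x by rewrite /m; lra.
  have m0 : 0 < m by exact: le_lt_trans lm.
  have [y yc] := contact_ex m0.
  have := lt_slope_contact xI (ltW m0) mx yc; rewrite ltNge.
  by rewrite (le_trans (contact_mono lm sc yc))// ltW.
pose m := (l + slope x) / 2; have lm : m < l by rewrite /m; lra.
have mx : slope x < m by rewrite /m; lra.
have m0 : 0 < m by apply: le_lt_trans mx; exact: slope_ge0.
have [y yc] := contact_ex m0.
have := slope_lt_contact xI mx yc; rewrite leNgt.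
by rewrite (lt_le_trans xt)// (contact_mono lm yc tc).
Qed.

(* The least concave majorant of F as a function of W, evaluated at W t. *)
Definition majorant (t : R) : R :=
  sup [set F s - slope t * W s | s in K] + slope t * W t.

Lemma majorantE t x : contact (slope t) x ->
  majorant t = F x + slope t * (W t - W x).
Proof.
move=> [xK xmax]; rewrite /majorant.
suff -> : sup [set F s - slope t * W s | s in K] = F x - slope t * W x by ring.
have ub : ubound [set F s - slope t * W s | s in K] (F x - slope t * W x).
  by move=> _ [s sK <-]; exact: xmax.
apply/eqP; rewrite eq_le; apply/andP; split.
  by apply: ge_sup => //; exists (F x - slope t * W x); exists x.
by apply: ub_le_sup; [exists (F x - slope t * W x)|exists x].
Qed.

Lemma majorant_le_line m x t : 0 <= m -> contact m x -> I t ->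
  majorant t <= F x + m * (W t - W x).
Proof.
move=> m0 [xK xmax] tI; have tK := oitvK tI; have [sm|ms] := leP (slope t) m.
  have [y yc yt] := ex_contact_left tI; rewrite (majorantE yc).
  have yK : K y by case: yc.
  have h1 := xmax _ yK; have h2 := weight_primitive_le yK tK yt; nra.
have [y yc ty] := ex_contact_right tI (le_lt_trans m0 ms); rewrite (majorantE yc).
have yK : K y by case: yc.
have h1 := xmax _ yK; have h2 := weight_primitive_le tK yK ty; nra.
Qed.

(** [slope s] is a supergradient of the majorant in the variable W. No order between s and t is
    required, so exchanging them bounds an increment from both sides. *)
Lemma majorant_step s t : I s -> I t ->
  majorant t <= majorant s + slope s * (W t - W s).
Proof.
move=> sI tI; have [x xc _] := ex_contact_left sI.
have := majorant_le_line (slope_ge0 sI) xc tI; rewrite (majorantE xc); lra.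
Qed.

Lemma le_majorant t : I t -> F t <= majorant t.
Proof.
move=> tI; have [x xc _] := ex_contact_left tI; rewrite (majorantE xc).
have [_ /(_ t (oitvK tI))] := xc; lra.
Qed.

Lemma majorant_ge0 t : I t -> 0 <= majorant t.
Proof.
move=> tI; apply: le_trans (le_majorant tI); rewrite -F0.
by apply: Fmono; [exact: K0|exact: oitvK|case: tI => /ltW].
Qed.

Lemma majorant_small e : 0 < e -> exists2 t, I t &
  forall s, I s -> s <= t -> majorant s <= e.
Proof.
move=> e0; have e20 : 0 < e / 2 by rewrite divr_gt0.
have [t1 t1I Ft1] := primitive_small a_gt0 phi_decr phi_ge0 phi_fin e20.
(* A level above the slope at t1 has its contact point x left of t1, where F is at most e/2. The
   line of slope m through that point rises by at most another e/2 up to t2. *)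
pose m := slope t1 + 1; have m0 : 0 < m by rewrite ltr_wpDl// slope_ge0.
have [x xc] := contact_ex m0; have [xK _] := xc.
have xt1 : x <= t1 by apply: slope_lt_contact xc => //; rewrite ltrDl.
have em0 : 0 < e / 2 / m by rewrite divr_gt0.
have [t2 t2I Wt2] := primitive_small a_gt0 w_decr w_ge0 w_fin em0.
exists t2 => // s sI st2; apply: (le_trans (majorant_le_line (ltW m0) xc sI)).
have h1 := Fmono xK (oitvK t1I) xt1; have h2 := weight_primitive_le (oitvK sI) (oitvK t2I) st2.
have h3 := weight_primitive_ge0 xK; move: Wt2; rewrite ler_pdivlMr//; nra.
Qed.

Let psi t := slope t * w t.

Lemma psi_ge0 t : I t -> 0 <= psi t.
Proof. by move=> tI; rewrite mulr_ge0 ?slope_ge0 ?w_ge0. Qed.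

Lemma psi_decr : decreasing_on a psi.
Proof.
by move=> s t sI tI st; rewrite ler_pM ?slope_ge0 ?w_ge0 ?slope_nonincr ?w_decr.
Qed.

Local Open Scope ereal_scope.

Lemma psi_bounds s t : I s -> I t -> (s <= t)%R ->
  (slope t * (W t - W s))%:E <= \int[leb]_(x in oitv s t%:E) (psi x)%:E <=
  (slope s * (W t - W s))%:E.
Proof.
move=> sI tI st; have s0 : (0 <= s)%R by case: sI => /ltW.
have tK := oitvK tI; have sub := oitv_closed_domain s0 tK.
have mD : measurable (oitv s t%:E : set T) by exact: measurable_oitv.
have Wst : \int[leb]_(x in oitv s t%:E) (w x)%:E = (W t - W s)%:E.
  by rewrite (primitive_itv w_decr) ?s0.
have mw := measurable_decreasing_itv w_decr s0 tK.
have wint c : (0 <= c)%R -> (c * (W t - W s))%:E =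
    \int[leb]_(x in oitv s t%:E) (c%:E * (w x)%:E).
  move=> c0; rewrite (ge0_integralZl_EFin leb mD _ mw c0) ?Wst//.
  by move=> x /sub xI; rewrite lee_fin w_ge0.
have mcw c : measurable_fun (oitv s t%:E : set T) (fun x => c%:E * (w x)%:E).
  exact: measurable_funeM.
have mpsi := measurable_decreasing_itv psi_decr s0 tK.
rewrite !wint ?slope_ge0//; apply/andP; split.
- apply: (ge0_le_integral leb mD _ (mcw _) mpsi).
  + by move=> x /sub xI; rewrite -EFinM lee_fin mulr_ge0 ?slope_ge0 ?w_ge0.
  + move=> x xst; have xI := sub _ xst; have [_ xt] := xst.
    by rewrite -EFinM lee_fin ler_wpM2r ?w_ge0// slope_nonincr// -lee_fin ltW.
- apply: (ge0_le_integral leb mD _ mpsi (mcw _)).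
  + by move=> x /sub xI; rewrite lee_fin psi_ge0.
  + move=> x xst; have xI := sub _ xst; have [sx _] := xst.
    by rewrite -EFinM lee_fin ler_wpM2r ?w_ge0// slope_nonincr// -lee_fin ltW.
Qed.

(** On [x, y] both the integral of psi and the increment of the majorant lie between slope y and
    slope x times the increment of W. Their difference G therefore satisfies the hypothesis of
    [product_increment_const], with no continuity of the slope. *)
Lemma integral_psi_itv s t : I s -> I t -> (s <= t)%R ->
  \int[leb]_(x in oitv s t%:E) (psi x)%:E = (majorant t - majorant s)%:E.
Proof.
move=> sI tI st; have s0 : (0 <= s)%R by case: sI => /ltW.
have inI x : (s <= x)%R -> (x <= t)%R -> I x.
  move=> sx xt; have [s0' _] := sI; have [_ ta] := tI.
  by split; [rewrite (lt_le_trans s0')|rewrite (le_lt_trans _ ta)].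
pose J x y := \int[leb]_(z in oitv x y%:E) (psi z)%:E.
have Jb x y : (s <= x)%R -> (x <= y)%R -> (y <= t)%R ->
    (slope y * (W y - W x))%:E <= J x y <= (slope x * (W y - W x))%:E.
  by move=> sx xy yt; apply: psi_bounds => //; apply: inI => //; [exact: le_trans yt|exact: le_trans xy].
have Jfin x y : (s <= x)%R -> (x <= y)%R -> (y <= t)%R -> J x y = (fine (J x y))%:E.
  move=> sx xy yt; have /andP[h1 h2] := Jb _ _ sx xy yt.
  by rewrite fineK// fin_numE -ltNye -ltey (lt_le_trans _ h1) ?ltNyr// (le_lt_trans h2) ?ltry.
have Jadd x y : (s <= x)%R -> (x <= y)%R -> (y <= t)%R ->
    fine (J s y) = (fine (J s x) + fine (J x y))%R.
  move=> sx xy yt; apply: EFin_inj.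
  have sy := le_trans sx xy; have yK : K y by apply: oitvK; exact: inI.
  rewrite EFinD -!Jfin ?(le_trans xy yt)//.
  have sub := oitv_closed_domain s0 yK.
  apply: ge0_integral_oitv_split; first by rewrite sx.
    exact: (measurable_decreasing_itv psi_decr).
  by move=> z /sub zI; rewrite lee_fin psi_ge0.
pose G x := (majorant x - fine (J s x))%R.
have GE : G t = G s.
  apply: (@product_increment_const R G slope W) => //.
  - apply: continuous_subspaceW Wcont => z /=; rewrite in_itv/= => /andP[sz zt].
    by apply: oitvK; exact: inI.
  - move=> x y sx xy yt; have /andP[h1 h2] := Jb _ _ sx xy yt.
    move: h1 h2; rewrite (Jfin x y)// !lee_fin /G (Jadd x y)// => h1 h2.
    have xI : I x by apply: inI => //; exact: le_trans yt.
    have yI : I y by apply: inI => //; exact: le_trans xy.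
    have h3 := majorant_step xI yI; have h4 := majorant_step yI xI.
    by rewrite ler_norml; apply/andP; split; lra.
  - move=> x y sx xy yt; apply: slope_nonincr => //; apply: inI => //; [exact: le_trans yt|exact: le_trans xy].
  - move=> x y sx xy yt; apply: weight_primitive_le => //; apply: oitvK; apply: inI => //; [exact: le_trans yt|exact: le_trans xy].
have Jss : fine (J s s) = 0%R.
  rewrite /J (_ : oitv s s%:E = set0) ?integral_set0//.
  by rewrite -subset0 => x [/= x0 /(lt_trans x0)]; rewrite ltxx.
rewrite -/(J s t) Jfin//; congr (_%:E); move: GE; rewrite /G Jss; lra.
Qed.

(** Passage to s = 0 in [integral_psi_itv]; the majorant has limit 0 there by [majorant_small]. *)
Lemma integral_psi t : I t ->
  \int[leb]_(x in oitv 0 t%:E) (psi x)%:E = (majorant t)%:E.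
Proof.
move=> tI; have tK := oitvK tI; have sub := oitv_closed_domain (lexx 0%R) tK.
have mpsi : measurable_fun (oitv 0 t%:E : set T) (EFin \o psi).
  exact: (measurable_decreasing_itv psi_decr).
have p0 x : oitv 0 t%:E x -> 0 <= (psi x)%:E.
  by move=> /sub xI; rewrite lee_fin psi_ge0.
have sI s : (0 < s)%R -> (s <= t)%R -> I s.
  by move=> s0 st; have [_ ta] := tI; split; rewrite ?lte_fin// (le_lt_trans _ ta).
apply/eqP; rewrite eq_le; apply/andP; split.
  apply: ge0_integral_oitv_le_left => //.
    move=> s /andP[s0 st]; rewrite integral_psi_itv ?(ltW st)//; last first.
      by apply: sI => //; exact: ltW.
    by rewrite lee_fin gerBl majorant_ge0//; apply: sI => //; exact: ltW.
  by rewrite lee_fin majorant_ge0.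
apply/lee_addgt0Pr => e e0; have [r rI re] := majorant_small e0.
have r0 : (0 < r)%R by case: rI.
have t0 : (0 < t)%R by case: tI.
pose s := Num.min r t; have s0 : (0 < s)%R by rewrite lt_min r0.
have st : (s <= t)%R by rewrite ge_min lexx orbT.
have sr : (s <= r)%R by rewrite ge_min lexx.
have se := re _ (sI _ s0 st) sr.
apply: (@le_trans _ _ ((majorant t - majorant s)%:E + e%:E)).
  by rewrite -EFinD lee_fin; lra.
rewrite leeD2r// -integral_psi_itv//; last exact: sI.
apply: ge0_subset_integral; do ?exact: measurable_oitv; do ?by [].
by move=> x [sx xt]; split => //; rewrite (lt_trans _ sx)// lte_fin.
Qed.

Local Open Scope ring_scope.

(** Up to a contact point y, F grows at least l times as much as W. On (s, y) the growth of F is at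
    most phi s, and that of W at least w y, per unit length. [contact_ub] is the mirror image to the
    right of a contact point. *)
Lemma contact_lb l y s : I y -> contact l y -> I s -> s < y -> 0 <= l ->
  l * w y <= phi s.
Proof.
move=> yI [yK yc] sI sy l0; have sK := oitvK sI.
have h1 := yc _ sK; have h2 := primitive_le phi_decr phi_ge0 phi_fin sI (ltW sy) yK.
have s0 : 0 <= s <= y by case: sK => -> _; exact: ltW.
have h3 := primitive_ge w_decr w_ge0 w_fin s0 yI.
have d0 : 0 < y - s by rewrite subr_gt0.
rewrite -(ler_pM2r d0) -mulrA; apply: le_trans h2.
apply: (le_trans (ler_wpM2l l0 h3)); move: h1; lra.
Qed.

Lemma contact_ub l x s : I x -> contact l x -> I s -> x < s -> 0 <= l ->
  phi s <= l * w x.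
Proof.
move=> xI [xK xc] sI xs l0; have sK := oitvK sI.
have x0 : 0 <= x <= s by case: xK => -> _; exact: ltW.
have h1 := xc _ sK; have h2 := primitive_ge phi_decr phi_ge0 phi_fin x0 sI.
have h3 := primitive_le w_decr w_ge0 w_fin xI (ltW xs) sK.
have d0 : 0 < s - x by rewrite subr_gt0.
rewrite -(ler_pM2r d0) -mulrA; apply: (le_trans h2).
apply: le_trans (ler_wpM2l l0 h3); move: h1; lra.
Qed.

Lemma phi_gt0_contact l y t : 0 < l -> contact l y -> I t -> t < y -> 0 < phi t.
Proof.
move=> l0 [yK yc] tI ty; have tK := oitvK tI.
have h1 := yc _ tK; have h2 := primitive_le phi_decr phi_ge0 phi_fin tI (ltW ty) yK.
have h3 : 0 < l * (W y - W t) by rewrite mulr_gt0// subr_gt0 Wmono.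
have d0 : 0 < y - t by rewrite subr_gt0.
rewrite -(pmulr_lgt0 _ d0); apply: lt_le_trans h2; move: h1 h3; lra.
Qed.

Hypothesis phi_right : forall t x, I t -> 0 <= x ->
  (forall s, I s -> t < s -> phi s <= x) -> phi t <= x.

(** This makes the slope a monotone function of phi, which the test function requires. For levels m2
    < m strictly between the two slopes, with contact points x of m and y of m2, one has s < x <= y
    <= t and phi t <= m2 w y <= m2 w x < m w x <= phi s. Right-continuity of phi covers the case y =
    t. *)
Lemma slope_lt_phi t s : I t -> I s -> slope t < slope s -> phi t < phi s.
Proof.
move=> tI sI ts; have t0 := slope_ge0 tI.
pose m2 := (2 * slope t + slope s) / 3; pose m := (slope t + 2 * slope s) / 3.
have [tm2 [m2m ms]] : slope t < m2 /\ m2 < m /\ m < slope s.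
  by rewrite /m2 /m; split; [|split]; move: ts; lra.
have m20 : 0 < m2 by exact: le_lt_trans tm2.
have m0 : 0 < m by exact: lt_trans m2m.
have [x xc] := contact_ex m0; have [y yc] := contact_ex m20.
have sx := lt_slope_contact sI (ltW m0) ms xc.
have yt := slope_lt_contact tI tm2 yc.
have xy := contact_mono m2m yc xc.
have bI z : s < z -> z <= t -> I z.
  move=> sz zt; have [s0 _] := sI; have [_ ta] := tI.
  by split; [rewrite (lt_trans s0)|rewrite (le_lt_trans _ ta)].
have xI : I x by apply: bI => //; exact: le_trans yt.
have yI : I y by apply: bI => //; exact: lt_le_trans xy.
apply: (@le_lt_trans _ _ (m2 * w y)).
  apply: phi_right => //; first by rewrite mulr_ge0 ?(ltW m20) ?w_ge0.
  by move=> z zI tz; apply: contact_ub => //; [exact: le_lt_trans tz|exact: ltW].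
apply: lt_le_trans (contact_lb xI xc sI sx (ltW m0)).
apply: (@le_lt_trans _ _ (m2 * w x)); last by rewrite ltr_pM2r ?w_gt0.
by rewrite ler_wpM2l ?(ltW m20)// w_decr.
Qed.

Let mI := @measurable_oitv R 0 a.
Let mphi : measurable_fun (I : set T) (EFin \o phi).
Proof. exact/measurable_EFinP/measurable_decreasing. Qed.
Let mpsi : measurable_fun (I : set T) (EFin \o psi).
Proof. exact/measurable_EFinP/(measurable_decreasing psi_decr). Qed.
Let phi0 x : I x -> (0 <= (EFin \o phi) x)%E.
Proof. by move=> xI; rewrite lee_fin phi_ge0. Qed.
Let psi0 x : I x -> (0 <= (EFin \o psi) x)%E.
Proof. by move=> xI; rewrite lee_fin psi_ge0. Qed.

Lemma integral_phi_le_psi x : I x ->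
  (\int[leb]_(t in oitv 0 x%:E) (phi t)%:E <= \int[leb]_(t in oitv 0 x%:E) (psi t)%:E)%E.
Proof.
move=> xI; rewrite integral_psi// (primitiveE phi_ge0 phi_fin) ?lee_fin ?le_majorant//.
exact: oitvK.
Qed.

(* {h > c} is an initial segment (0, b) such that each of its points lies below a
   contact point in (0, b], where F and its majorant agree. *)
Lemma integral_psi_le_phi (h : R -> \bar R) :
  measurable_fun (I : set T) h -> (forall x, I x -> 0 <= h x)%E ->
  (forall s t, I s -> I t -> slope s <= slope t -> (h s <= h t)%E) ->
  (forall t, I t -> (0 < h t)%E -> 0 < slope t) ->
  (\int[leb]_(t in I) ((psi t)%:E * h t) <= \int[leb]_(t in I) ((phi t)%:E * h t))%E.
Proof.
move=> mh h0 hs hpos.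
apply: (le_integral_layers mI mpsi mh psi0 h0 mI mphi mh phi0 h0) => c c0.
set S : set T := _ `&` _.
have mS : measurable S by exact: emeasurable_fun_o_infty.
have SI : S `<=` I by exact: subIsetl.
have [b [b0 ba bS Sb]] : exists b, [/\ (0 <= b)%E, (b <= a)%E, oitv 0 b `<=` S & forall x, S x -> (x%:E <= b)%E].
  apply: down_closed_oitv => // x y [[y0 ya] /= cy] /andP[x0 xy].
  have xI : I x by split; [rewrite lte_fin|rewrite (le_lt_trans _ ya)].
  by split => //=; rewrite (lt_le_trans cy)// hs// slope_nonincr.
rewrite (ge0_integral_down_closed b0 SI bS Sb mS (measurable_funS mI SI mpsi) (fun x Sx => psi0 (SI x Sx))).
rewrite (ge0_integral_down_closed b0 SI bS Sb mS (measurable_funS mI SI mphi) (fun x Sx => phi0 (SI x Sx))).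
have bI : oitv 0 b `<=` I by exact: oitv_subr.
apply: ge0_integral_oitv_le => //.
- exact: (measurable_funS mI bI mpsi).
- by move=> x /bI; exact: psi0.
- move=> x bx; have xI := bI _ bx; have [_ /= ch] := bS _ bx.
  have sx : 0 < slope x by apply: hpos => //; apply: lt_trans ch; rewrite lte_fin.
  have [y yc xy] := ex_contact_right xI sx; have [z zc zx] := ex_contact_left xI.
  have [yK _] := yc.
  (* The slope is constant between the contact points z and y, so a point u of (b, y) would have h u
     >= h x > c, against the choice of b. *)
  have yb : (y%:E <= b)%E.
    have [r|r] := leP y%:E b => //; exfalso.
    have [_ xb] := bx.
    have [u /andP[bu uy]] := rat_between r.
    have xu : x < ratr u by rewrite -lte_fin (lt_trans xb).
    have uI : I (ratr u) by apply: (oitv_between (oitvK xI) yK); rewrite xu.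
    have su : slope (ratr u) = slope x.
      by apply: (slope_const (slope_ge0 xI) zc yc); rewrite (le_lt_trans zx).
    have Su : S (ratr u).
      by split => //=; rewrite (lt_le_trans ch)// hs// su.
    by move: (Sb _ Su); rewrite leNgt bu.
  rewrite integral_psi// (majorantE yc).
  apply: (@le_trans _ _ (F y)%:E).
    have := weight_primitive_le (oitvK xI) yK xy; have := slope_ge0 xI; rewrite lee_fin; nra.
  rewrite -(primitiveE phi_ge0 phi_fin yK).
  apply: ge0_subset_integral; do ?exact: measurable_oitv.
  + exact: (measurable_funS mI bI mphi).
  + by move=> u /bI; exact: phi0.
  + exact: oitv_subr.
- by apply: integral_ge0 => x /bI; exact: phi0.
Qed.

(** * Level intervals and the optimal dual weight *)

Definition in_level_interval (t : R) : Prop :=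
  0 < slope t /\ exists x y, [/\ contact (slope t) x, contact (slope t) y & x < t < y].

Lemma not_in_level_interval t : I t -> ~ in_level_interval t ->
  contact (slope t) t \/ phi t = 0 /\ slope t = 0.
Proof.
move=> tI nt; have [x xc xt] := ex_contact_left tI.
move: xt; rewrite le_eqVlt => /predU1P[xE|xt]; first by left; move: xc; rewrite xE.
have := slope_ge0 tI; rewrite le_eqVlt => /predU1P[s0|s0].
  right; split => //; apply/eqP; rewrite eq_le phi_ge0// andbT.
  have [xK xmax] := xc; have x0 : 0 <= x <= t by case: xK => -> _; exact: ltW.
  have h1 := primitive_ge phi_decr phi_ge0 phi_fin x0 tI.
  have := xmax _ (oitvK tI); rewrite -s0 !mul0r !subr0 => h2.
  have d0 : 0 < t - x by rewrite subr_gt0.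
  by rewrite -(pmulr_lle0 _ d0) (le_trans h1)// subr_le0.
have [y yc ty] := ex_contact_right tI s0.
move: ty; rewrite le_eqVlt => /predU1P[yE|ty]; first by left; move: yc; rewrite -yE.
by case: nt; split => //; exists x, y; rewrite xt ty.
Qed.

(** At a contact point [contact_ub] and right-continuity give phi t <= psi t, while [contact_lb]
    gives psi t' <= phi t for contact points t < t'. The gaps from phi to psi are thus disjoint
    intervals. *)
Lemma phi_eq_psi_ae :
  leb.-negligible [set t : R | [/\ I t, ~ in_level_interval t & phi t <> psi t]].
Proof.
pose E := [set t | I t /\ contact (slope t) t].
have := @interlaced_negligible R E (EFin \o phi) (EFin \o psi).
have H t t' : E t -> E t' -> t < t' -> ((EFin \o psi) t' <= (EFin \o phi) t)%E.
  move=> [tI tc] [t'I t'c] tt'; rewrite lee_fin; apply: contact_lb => //.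
  exact: slope_ge0.
move=> /(_ H); apply: negligibleS => t [tI nt /eqP pt].
have [tc|[p0 s0]] := not_in_level_interval tI nt; last first.
  by move: pt; rewrite p0 /psi s0 mul0r eqxx.
split => //=; rewrite lte_fin lt_neqAle pt/=.
apply: phi_right => //; first exact: psi_ge0.
by move=> s sI ts; apply: contact_ub => //; exact: slope_ge0.
Qed.

Definition level_weight (t : R) : R :=
  if `[< in_level_interval t >] then phi t / slope t else w t.

Lemma level_weight_gt0 : positive_on a level_weight.
Proof.
move=> t tI; rewrite /level_weight; case: asboolP => [[s0 [x [y [xc yc /andP[xt ty]]]]]|_].
  by rewrite divr_gt0//; exact: phi_gt0_contact yc _ ty.
exact: w_gt0.
Qed.

(** At the ends x < y of a level interval [contact_ub] and [contact_lb] place phi / slope between w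
    y and w x, so changes between the two formulas, or from one level to another, respect the
    order. *)
Lemma level_weight_decr : decreasing_on a level_weight.
Proof.
move=> t t' tI t'I; rewrite le_eqVlt => /predU1P[->//|tt'].
have bI z : t <= z -> z <= t' -> I z.
  move=> tz zt; have [t0 _] := tI; have [_ ta] := t'I.
  by split; [rewrite (lt_le_trans t0)|rewrite (le_lt_trans _ ta)].
rewrite /level_weight; case: asboolP => [it'|nt']; case: asboolP => [it|nt].
- have [s0 [x [y [xc yc /andP[xt ty]]]]] := it.
  have [s0' [x' [y' [xc' yc' /andP[xt' ty']]]]] := it'.
  have := slope_nonincr tI t'I (ltW tt'); rewrite le_eqVlt => /predU1P[->|ss'].
    by rewrite ler_pM2r ?invr_gt0// phi_decr// ltW.
  have yx' := contact_mono ss' xc' yc.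
  have yI : I y by apply: bI; [exact: ltW|exact: (ltW (le_lt_trans yx' xt'))].
  have x'I : I x' by apply: bI; [exact: (ltW (lt_le_trans ty yx'))|exact: ltW].
  apply: (@le_trans _ _ (w x')).
    by rewrite ler_pdivrMr// mulrC; apply: contact_ub => //; exact: ltW.
  apply: (@le_trans _ _ (w y)); first exact: w_decr.
  by rewrite ler_pdivlMr// mulrC; apply: contact_lb => //; exact: ltW.
- have [s0' [x' [y' [xc' yc' /andP[xt' ty']]]]] := it'.
  have tx' : t <= x'.
    rewrite leNgt; apply/negP => x't; apply: nt.
    have tE : slope t = slope t'.
      by apply: (slope_const (ltW s0') xc' yc'); rewrite x't (lt_trans tt').
    by rewrite /in_level_interval tE; split => //; exists x', y'; rewrite x't (lt_trans tt').
  have x'I : I x' by apply: bI => //; exact: ltW.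
  apply: (@le_trans _ _ (w x')); last exact: w_decr.
  by rewrite ler_pdivrMr// mulrC; apply: contact_ub => //; exact: ltW.
- have [s0 [x [y [xc yc /andP[xt ty]]]]] := it.
  have yt' : y <= t'.
    rewrite leNgt; apply/negP => t'y; apply: nt'.
    have tE : slope t' = slope t.
      by apply: (slope_const (ltW s0) xc yc); rewrite t'y (lt_trans xt).
    by rewrite /in_level_interval tE; split => //; exists x, y; rewrite t'y (lt_trans xt).
  have yI : I y by apply: bI => //; exact: ltW.
  apply: (@le_trans _ _ (w y)); first exact: w_decr.
  by rewrite ler_pdivlMr// mulrC; apply: contact_lb => //; exact: ltW.
- by apply: w_decr => //; exact: ltW.
Qed.

Let slope_decr : decreasing_on a slope.
Proof. by move=> s t sI tI; exact: slope_nonincr. Qed.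

(** Where the slope is positive, the weight is a.e. phi / slope, whereas w is psi / slope. The
    factor 1 / slope is nondecreasing, so Hardy's inequality does not apply; its layers are
    complements of initial segments, over which phi and psi have to be compared in the opposite
    direction. *)
Lemma integral_level_weight x : I x ->
  (\int[leb]_(t in oitv 0 x%:E) (level_weight t)%:E <=
   \int[leb]_(t in oitv 0 x%:E) (w t)%:E)%E.
Proof.
move=> xI; have xK := oitvK xI; have xsub := oitv_closed_domain (lexx 0) xK.
have mx : measurable (oitv 0 x%:E : set T) by exact: measurable_oitv.
have mslope := measurable_decreasing slope_decr.
pose Q : set T := I `&` [set t | (0%:E < (slope t)%:E)%E].
have mslopeE : measurable_fun (I : set T) (EFin \o slope) by exact/measurable_EFinP.
have mQ : measurable Q by exact: (emeasurable_fun_o_infty mI mslopeE).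
have mv := measurable_decreasing_itv level_weight_decr (lexx 0) xK.
have mw := measurable_decreasing_itv w_decr (lexx 0) xK.
have v0 t : I t -> 0 <= level_weight t by move=> /level_weight_gt0/ltW.
rewrite (ge0_integral_setID mx mQ mv); last by move=> t /xsub /v0; rewrite lee_fin.
rewrite (ge0_integral_setID mx mQ mw); last by move=> t /xsub /w_ge0; rewrite lee_fin.
pose A : set T := oitv 0 x%:E `&` Q; rewrite -/A.
have AI : A `<=` I by move=> t [/xsub].
have Ax : A `<=` oitv 0 x%:E by exact: subIsetl.
have Aslope t : A t -> 0 < slope t by case=> _ [_ /=]; rewrite lte_fin.
have mA : measurable A by exact: measurableI.
apply: leeD; last first.
  rewrite le_eqVlt; apply/orP; left; apply/eqP; apply: eq_integral => t.
  rewrite inE => -[tx nQ]; rewrite /level_weight; case: asboolP => // -[s0 _].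
  by case: nQ; split; [exact: xsub|rewrite /= lte_fin].
have mh : measurable_fun A (fun t : R => ((slope t)^-1)%:E).
  apply/measurable_EFinP.
  have m1 : measurable_fun A (fun t : R => slope t `^ (-1)).
    exact: (measurableT_comp (measurable_powR (-1)) (measurable_funS mI AI mslope)).
  apply: eq_measurable_fun m1.
  by move=> t; rewrite inE => /Aslope /ltW s0; rewrite powR_inv1.
have h0 t : A t -> (0 <= ((slope t)^-1)%:E)%E.
  by move=> /Aslope s0; rewrite lee_fin invr_ge0 ltW.
have mphiA := measurable_funS mI AI mphi.
have mpsiA := measurable_funS mI AI mpsi.
have phiA0 t (tA : A t) := phi0 (AI t tA).
have psiA0 t (tA : A t) := psi0 (AI t tA).
have -> : (\int[leb]_(t in A) (level_weight t)%:E =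
    \int[leb]_(t in A) ((phi t)%:E * ((slope t)^-1)%:E))%E.
  apply: (ge0_ae_eq_integral mA (measurable_funS mx Ax mv)).
  - exact: emeasurable_funM.
  - by move=> t /AI /v0; rewrite lee_fin.
  - by move=> t tA; apply: mule_ge0; [exact: phiA0|exact: h0].
  - apply: negligibleS phi_eq_psi_ae => t /= H; apply: contrapT => nH; apply: H => tA.
    have s0 := Aslope _ tA; rewrite -EFinM /level_weight; case: asboolP => // nt.
    have pE : phi t = psi t.
      by apply: contrapT => pE; apply: nH; split => //; exact: AI.
    by rewrite pE /psi mulrC mulKf// gt_eqF.
have -> : (\int[leb]_(t in A) (w t)%:E =
    \int[leb]_(t in A) ((psi t)%:E * ((slope t)^-1)%:E))%E.
  apply: eq_integral => t; rewrite inE => /Aslope s0.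
  by rewrite -EFinM /psi mulrC mulKf// gt_eqF.
apply: (le_integral_layers mA mphiA mh phiA0 h0 mA mpsiA mh psiA0 h0) => c c0.
(* If slope x >= 1/c, the slope is at least 1/c on all of (0, x) and the layer is empty. *)
have [xc|xc] := leP c^-1 (slope x).
  have -> : A `&` [set t : R | (c%:E < ((slope t)^-1)%:E)%E] = set0.
    rewrite -subset0 => t [tA /=]; rewrite lte_fin ltNge; apply/negP; rewrite negbK.
    have s0 := Aslope _ tA; rewrite -[leRHS]invrK lef_pV2 ?posrE ?invr_gt0//.
    apply: (le_trans xc); apply: slope_nonincr => //; first exact: AI.
    by case: tA => -[_ /ltW].
  by rewrite !integral_set0.
(* Otherwise the layer is A without the initial segment B. Over A the integral of phi is at most
   that of psi, over B it is at least that of psi; the difference can be formed since the integral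
   of phi over B is finite. *)
pose B : set T := I `&` [set t | (c^-1%:E <= (slope t)%:E)%E].
have mB : measurable B by exact: (emeasurable_fun_c_infty mI mslopeE).
have BI : B `<=` I by exact: subIsetl.
have ic0 : 0 < c^-1 by rewrite invr_gt0.
have BA : B `<=` A.
  move=> t [tI /=]; rewrite lee_fin => tc; split; last first.
    by split => //=; rewrite lte_fin (lt_le_trans ic0).
  have [t0 _] := tI; split => //; rewrite lte_fin ltNge; apply/negP => /(slope_nonincr xI tI).
  by move=> /(le_trans tc); rewrite leNgt xc.
have -> : A `&` [set t : R | (c%:E < ((slope t)^-1)%:E)%E] = A `&` ~` B.
  apply/seteqP; split => t [tA] /= H; split => //; have s0 := Aslope _ tA.
    move=> [_ /=]; rewrite lee_fin leNgt; apply/negP; rewrite negbK.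
    by move: H; rewrite lte_fin -[ltLHS]invrK ltf_pV2 ?posrE.
  rewrite lte_fin -[ltLHS]invrK ltf_pV2 ?posrE// ltNge; apply/negP => tc.
  by apply: H; split; [exact: AI|rewrite /= lee_fin].
have AB : A `&` B = B by apply/setIidPr.
have hA : (\int[leb]_(t in A) (phi t)%:E <= \int[leb]_(t in A) (psi t)%:E)%E.
  rewrite -!(integral_indic_mul _ mI mA AI).
  apply: (hardy a_gt0 mphi mpsi _ phi0 psi0).
  - by apply/measurable_EFinP; exact: measurable_indic.
  - by move=> t _; rewrite lee_fin.
  - move=> t s tI sI ts; rewrite lee_fin !indicE ler_nat.
    case: (boolP (s \in A)) => // sA; rewrite inE in sA; rewrite mem_set//.
    have [[_ sx] _] := sA; have [t0 _] := tI; split.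
      by split => //; rewrite (le_lt_trans _ sx)// lee_fin.
    by split => //=; rewrite lte_fin (lt_le_trans (Aslope _ sA))// slope_nonincr.
  - exact: integral_phi_le_psi.
have hB : (\int[leb]_(t in B) (psi t)%:E <= \int[leb]_(t in B) (phi t)%:E)%E.
  rewrite -!(integral_indic_mul _ mI mB BI).
  apply: integral_psi_le_phi.
  - by apply/measurable_EFinP; exact: measurable_indic.
  - by move=> t _; rewrite lee_fin.
  - move=> t s tI sI ts; rewrite lee_fin !indicE ler_nat.
    case: (boolP (t \in B)) => // tB; rewrite inE in tB; rewrite mem_set//.
    have [_ /=] := tB; rewrite lee_fin => tc; split => //=.
    by rewrite lee_fin (le_trans tc).
  - move=> t tI; rewrite lte_fin indicE ltr0n lt0b inE => -[_ /=].
    by rewrite lee_fin; exact: lt_le_trans.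
move: hA; rewrite !(ge0_integral_setID mA mB)// AB => hA.
have Bfin : (\int[leb]_(t in B) (phi t)%:E)%E \is a fin_num.
  rewrite ge0_fin_numE; last by apply: integral_ge0 => t /BI; exact: phi0.
  apply: le_lt_trans (phi_fin xK).
  apply: (@ge0_subset_integral _ T R leb B (oitv 0 x%:E) mB mx (EFin \o phi)).
  - exact: (measurable_decreasing_itv phi_decr).
  - by move=> t /xsub; exact: phi0.
  - by move=> t /BA [].
rewrite -(leeD2lE _ _ Bfin); apply: (le_trans hA).
by rewrite leeD2r.
Qed.

Lemma powR_level (q s v : R) : 1 < q -> 0 <= s -> 0 < v ->
  (s * v) `^ q * v `^ (1 - q) = s * v * s `^ (q - 1).
Proof.
move=> q1 s0 v0; rewrite powRM ?(ltW v0)// -mulrA -powRD; last first.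
  by apply/implyP => _; rewrite gt_eqF.
rewrite addrC subrK powRr1 ?(ltW v0)//.
have [->|sn0] := eqVneq s 0; first by rewrite powR0 ?mul0r// gt_eqF// (lt_trans ltr01).
have -> : s `^ q = s `^ (q - 1) * s; last by ring.
by rewrite -[X in _ = _ * X]powRr1// -powRD ?subrK// sn0 implybT.
Qed.

(** The quotients of phi by [level_weight] and of psi by w are both the slope, a.e. By [powR_level]
    the integrands become phi and psi times slope^(q-1), a nonincreasing factor, and Hardy's
    inequality concludes. *)
Lemma level_weight_norm (q : R) : 1 < q ->
  (\int[leb]_(t in I) (phi t `^ q * level_weight t `^ (1 - q))%:E <=
   \int[leb]_(t in I) (psi t `^ q * w t `^ (1 - q))%:E)%E.
Proof.
move=> q1; pose h t := (slope t `^ (q - 1))%:E.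
have q0 : 0 <= q - 1 by rewrite subr_ge0 ltW.
have hdecr : decreasing_on a (fun t => slope t `^ (q - 1)).
  move=> s t sI tI st; apply: ge0_ler_powR => //; rewrite ?nnegrE ?slope_ge0//.
  exact: slope_nonincr.
have mh : measurable_fun (I : set T) h.
  by apply/measurable_EFinP; exact: measurable_decreasing.
have -> : (\int[leb]_(t in I) (phi t `^ q * level_weight t `^ (1 - q))%:E =
    \int[leb]_(t in I) ((phi t)%:E * h t))%E.
  apply: (ge0_ae_eq_integral mI).
  - apply/measurable_EFinP; apply: measurable_funM.
      apply: (measurableT_comp (measurable_powR _)); exact/measurable_EFinP.
    apply: (measurableT_comp (measurable_powR _)).
    exact/measurable_decreasing/level_weight_decr.
  - exact: emeasurable_funM.
  - by move=> t _; rewrite lee_fin mulr_ge0// powR_ge0.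
  - by move=> t tI; apply: mule_ge0; [exact: phi0|rewrite lee_fin powR_ge0].
  - apply: negligibleS phi_eq_psi_ae => t /= H; apply: contrapT => nH; apply: H => tI.
    rewrite -EFinM; congr (_%:E); have s0 := slope_ge0 tI.
    have v0 := level_weight_gt0 tI.
    have pE : phi t = slope t * level_weight t.
      rewrite /level_weight; case: asboolP => [[sp _]|nt]; first by rewrite mulrC divfK// gt_eqF.
      by apply: contrapT => pE; apply: nH.
    by rewrite [in LHS]pE powR_level// -pE.
have -> : (\int[leb]_(t in I) (psi t `^ q * w t `^ (1 - q))%:E =
    \int[leb]_(t in I) ((psi t)%:E * h t))%E.
  apply: eq_integral => t; rewrite inE => tI.
  by rewrite -EFinM /psi powR_level ?slope_ge0 ?w_gt0.
apply: (hardy a_gt0 mphi mpsi mh phi0 psi0).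
- by move=> t _; rewrite lee_fin powR_ge0.
- by move=> s t sI tI st; rewrite lee_fin; exact: hdecr.
- exact: integral_phi_le_psi.
Qed.

End contact_points.

(** * The level function *)

Lemma oitv_inj {R : realType} (s t x y : R) : s < t -> x < y -> oitv s t%:E = oitv x y%:E -> s = x /\ t = y.
Proof.
have sub (s1 t1 x1 y1 : R) : s1 < t1 -> oitv s1 t1%:E `<=` oitv x1 y1%:E -> x1 <= s1 /\ t1 <= y1.
  move=> st1 sub; split; rewrite leNgt; apply/negP => H.
    pose z := Num.min ((s1 + x1) / 2) ((s1 + t1) / 2).
    have [z1 z2] : z <= (s1 + x1) / 2 /\ z <= (s1 + t1) / 2 by rewrite !ge_min !lexx orbT.
    have sz : s1 < z by rewrite lt_min; apply/andP; split; lra.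
    have [] : oitv x1 y1%:E z by apply: sub; split; rewrite lte_fin; lra.
    by rewrite lte_fin => ? _; lra.
  pose z := Num.max ((t1 + y1) / 2) ((s1 + t1) / 2).
  have [z1 z2] : (t1 + y1) / 2 <= z /\ (s1 + t1) / 2 <= z by rewrite !le_max !lexx orbT.
  have zt : z < t1 by rewrite gt_max; apply/andP; split; lra.
  have [] : oitv x1 y1%:E z by apply: sub; split; rewrite lte_fin; lra.
  by move=> _; rewrite lte_fin => ?; lra.
move=> st xy E.
have [h1 h2] : x <= s /\ t <= y by apply: sub => //; rewrite E; exact: subset_refl.
have [h3 h4] : s <= x /\ y <= t by apply: sub => //; rewrite -E; exact: subset_refl.
by split; apply/eqP; rewrite eq_le ?h1 ?h2 ?h3 ?h4.
Qed.

(** In coordinates (W, F) the middle point lies on or below the chord of slope r, and a line of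
    slope m through it lies above both ends. This forces m = r and puts all three points on one
    line, so a support at the middle supports at the ends. *)
Lemma chord_slope {R : realFieldType} (fs fz ft ws wz wt m r : R) :
  0 < wz - ws -> 0 < wt - wz -> ft - fs = r * (wt - ws) ->
  fz - fs <= r * (wz - ws) -> fs - m * ws <= fz - m * wz ->
  ft - m * wt <= fz - m * wz ->
  fz - m * wz <= fs - m * ws /\ fz - m * wz <= ft - m * wt.
Proof.
move=> d1 d2 rE h3 h1 h2.
have mr : m <= r by rewrite -(ler_pM2r d1); lra.
have rm : r <= m by rewrite -(ler_pM2r d2); lra.
have mE : m = r by apply/eqP; rewrite eq_le mr.
by rewrite mE; split; move: h3 rE; rewrite !mulrBr; lra.
Qed.

Section finite_primitives.
Context {R : realType}.
Local Notation T := (caratheodory_type (@wlength R idfun)^*%mu).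
Variables (a : \bar R).
Hypothesis a_gt0 : (0 < a)%E.
Local Notation K := (closed_domain a).
Local Notation I := (oitv 0 a).
Local Open Scope ereal_scope.

(** Only t = a is new: on (t/2, t) the density is bounded by its value at t/2, which lies in I. *)
Lemma integral_closed_domain (u : R -> R) : decreasing_on a u ->
  (forall x, I x -> (0 <= u x)%R) ->
  (forall t, I t -> \int[leb]_(x in oitv 0 t%:E) (u x)%:E < +oo) ->
  forall t, K t -> \int[leb]_(x in oitv 0 t%:E) (u x)%:E < +oo.
Proof.
move=> ud u0 ufin t tK; have [t0 ta] := tK.
have [t00|t00] := leP t 0%R.
  rewrite (_ : oitv _ _ = set0) ?integral_set0 ?ltry//.
  by rewrite -subset0 => x [/= x0 /(lt_trans x0)]; rewrite lte_fin ltNge t00.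
pose s := (t / 2)%R; have s0 : (0 < s)%R by rewrite divr_gt0.
have st : (s < t)%R by rewrite /s ltr_pdivrMr// ltr_pMr// ltr1n.
have sI : I s by apply: (oitv_between (closed_domain0 a_gt0) tK); rewrite s0.
have mt := measurable_decreasing_itv ud (lexx 0%R) tK.
have sub := oitv_closed_domain (lexx 0%R) tK.
have subs := oitv_closed_domain (ltW s0) tK.
rewrite (@ge0_integral_oitv_split R (EFin \o u) 0 s t); last 3 first.
- by rewrite (ltW s0) ltW.
- exact: mt.
- by move=> x /sub xI; rewrite lee_fin u0.
rewrite lte_add_pinfty ?ufin//.
have ms : measurable (oitv s t%:E : set T) by exact: measurable_oitv.
apply: (@le_lt_trans _ _ (\int[leb]_(x in oitv s t%:E) (cst (u s)%:E x))).
  apply: (ge0_le_integral leb ms).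
  - by move=> x /subs xI; rewrite lee_fin u0.
  - exact: (measurable_decreasing_itv ud (ltW s0) tK).
  - exact: measurable_cst.
  - move=> x xst; rewrite lee_fin; apply: ud => //; first exact: subs.
    by case: xst => /ltW.
rewrite integral_cst// [X in _ * X](_ : _ = (t - s)%:E) -?EFinM ?ltry//.
by rewrite [LHS]leb_oitv ?EFinB// lee_fin ltW.
Qed.

End finite_primitives.

(** * Contact points for the rearrangement and Halperin's level intervals *)

Section rearrangement_contact.
Context {R : realType}.
Local Notation T := (caratheodory_type (@wlength R idfun)^*%mu).
Variables (a : \bar R) (f w : R -> R).
Hypothesis a_gt0 : (0 < a)%E.
Local Notation K := (closed_domain a).
Local Notation I := (oitv 0 a).
Hypothesis mf : L0 a f.
Hypothesis f_int :
  forall t, I t -> (\int[leb]_(x in oitv 0 t%:E) rearrangement a f x < +oo)%E.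
Hypothesis w_gt0 : positive_on a w.
Hypothesis w_decr : decreasing_on a w.
Hypothesis w_int :
  forall t : R, I t -> (\int[leb]_(x in oitv 0 t%:E) (w x)%:E < +oo)%E.

Definition real_rearrangement (t : R) : R := fine (rearrangement a f t).
Local Notation phi := real_rearrangement.

Lemma real_rearrangementE t : I t -> rearrangement a f t = (phi t)%:E.
Proof.
move=> tI; have [t0 ta] := tI.
rewrite fineK// ge0_fin_numE ?rearrangement_ge0// ltNge leye_eq; apply/eqP => fy.
have mt : measurable (oitv 0 t%:E : set T) by exact: measurable_oitv.
have := f_int tI; apply/negP; rewrite -leNgt.
apply: (@le_trans _ _ (\int[leb]_(x in oitv 0 t%:E) cst +oo%E x)%E).
  rewrite integral_cst// [X in (_ * X)%E](_ : _ = t%:E).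
    by rewrite gt0_mulye.
  by rewrite [LHS]leb_oitv0// ltW.
apply: (ge0_le_integral leb mt).
- by move=> x _; rewrite /= leey.
- exact: measurable_cst.
- exact: measurable_rearrangement.
- by move=> x [_ xt]; rewrite /= -fy; apply: rearrangement_nonincr; rewrite -lee_fin ltW.
Qed.

Lemma real_rearrangement_ge0 t : I t -> 0 <= phi t.
Proof. by move=> tI; rewrite -lee_fin -real_rearrangementE// rearrangement_ge0. Qed.

Lemma real_rearrangement_decr : decreasing_on a phi.
Proof.
move=> s t sI tI st; rewrite -lee_fin -!real_rearrangementE//.
exact: rearrangement_nonincr.
Qed.

Lemma real_rearrangement_right t x : I t -> 0 <= x ->
  (forall s, I s -> t < s -> phi s <= x) -> phi t <= x.
Proof.
move=> tI x0 H; rewrite -lee_fin -real_rearrangementE//.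
apply: (rearrangement_le_right (ltW a_gt0) mf); first by rewrite lee_fin.
move=> s ts sa; have sI : I s.
  by split => //; rewrite lte_fin; apply: lt_trans ts; case: tI.
by rewrite real_rearrangementE// lee_fin H.
Qed.

Lemma integral_real_rearrangement t : K t ->
  (\int[leb]_(x in oitv 0 t%:E) (phi x)%:E =
   \int[leb]_(x in oitv 0 t%:E) rearrangement a f x)%E.
Proof.
move=> tK; apply: eq_integral => x; rewrite inE => xt.
by rewrite real_rearrangementE//; exact: oitv_closed_domain xt.
Qed.

Lemma real_rearrangement_int t : K t ->
  (\int[leb]_(x in oitv 0 t%:E) (phi x)%:E < +oo)%E.
Proof.
apply: integral_closed_domain => //.
- exact: real_rearrangement_decr.
- exact: real_rearrangement_ge0.
- by move=> s sI; rewrite integral_real_rearrangement ?f_int//; exact: oitvK.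
Qed.

Lemma weight_int t : K t -> (\int[leb]_(x in oitv 0 t%:E) (w x)%:E < +oo)%E.
Proof. by apply: integral_closed_domain => // x /w_gt0/ltW. Qed.

Local Notation F := (primitive phi).
Local Notation W := (primitive w).

Let w_ge0 x (xI : I x) : 0 <= w x := ltW (w_gt0 xI).
Let phi_decr := real_rearrangement_decr.
Let phi_ge0 := real_rearrangement_ge0.
Let phi_fin := real_rearrangement_int.
Let w_fin := weight_int.

(** The maximum of F - l W over the compact interval [0, b] is global: beyond b the values are
    dominated by the one at b or by 0, the value at the origin. *)
Lemma ex_contact l (b : R) : 0 < l -> K b ->
  (forall t, K t -> b <= t -> F t - l * W t <= F b - l * W b \/ F t - l * W t <= 0) ->
  exists s, contact a F W l s.
Proof.
move=> l0 bK Hb; have b0 : 0 <= b by case: bK.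
have K00 := closed_domain0 a_gt0.
have cD : {within `[0, b], continuous (fun t => F t - l * W t)}.
  have sub : `[0, b]%classic `<=` K.
    by move=> x /=; rewrite in_itv/=; exact: closed_domain_between.
  have Fc := continuous_subspaceW sub (primitive_continuous a_gt0 phi_decr phi_ge0 phi_fin).
  have Wc := continuous_subspaceW sub (primitive_continuous a_gt0 w_decr w_ge0 w_fin).
  move=> x; apply: cvgB; first exact: Fc.
  by apply: cvgM; [exact: cvg_cst|exact: Wc].
have [x] := EVT_max b0 cD; rewrite in_itv/= => /andP[x0 xb] xmax.
exists x; split; first by apply: (closed_domain_between K00 bK); rewrite x0.
have Hb0 : F b - l * W b <= F x - l * W x by apply: xmax; rewrite in_itv/= b0 lexx.
have H0 : 0 <= F x - l * W x.
  have := xmax 0; rewrite in_itv/= lexx b0 !primitive0 mulr0 subr0; exact.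
move=> s sK; have [sb|bs] := leP s b.
  by apply: xmax; rewrite in_itv/= sb andbT; case: sK.
by have [h|h] := Hb _ sK (ltW bs); apply: (le_trans h).
Qed.

Hypothesis contact_ex : forall l, 0 < l -> exists s, contact a F W l s.
Hypothesis W_infty : a = +oo%E -> forall M, exists2 t, 0 < t & M <= W t.

Local Notation slope := (slope a F W).
Local Notation contact := (contact a F W).
Let in_level := in_level_interval a phi w.

Lemma mean_ratio_finE s t : 0 <= s -> s < t -> K t ->
  mean_ratio_fin a w f s t = ((F t - F s) / (W t - W s))%:E.
Proof.
move=> s0 st tK; have sst : 0 <= s <= t by rewrite s0 ltW.
have sK : K s by have [_ ta] := tK; split => //; rewrite (le_trans _ ta)// lee_fin ltW.
rewrite /mean_ratio_fin (primitive_itv w_decr w_ge0 w_fin sst tK).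
have -> : (\int[leb]_(x in oitv s t%:E) rearrangement a f x =
   \int[leb]_(x in oitv s t%:E) (phi x)%:E)%E.
  apply: eq_integral => x; rewrite inE => xt.
  by rewrite real_rearrangementE//; exact: oitv_closed_domain xt.
rewrite (primitive_itv phi_decr phi_ge0 phi_fin sst tK).
have Wst : 0 < W t - W s.
  by rewrite subr_gt0; exact: (primitive_lt w_decr w_ge0 w_fin w_gt0 sK tK st).
by rewrite inver gt_eqF// -EFinM.
Qed.

(** A contact point x of level e/2 gives F t <= F x + (e/2) W t, so the mean ratios are eventually
    at most e because W is unbounded. *)
Lemma mean_ratio_infty s : a = +oo%E -> 0 <= s -> (mean_ratio a w f s +oo <= 0)%E.
Proof.
move=> ay s0; apply/lee_addgt0Pr => e e0; rewrite add0e.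
have KE x : 0 <= x -> K x by move=> x0; split => //; rewrite ay leey.
have e20 : 0 < e / 2 by rewrite divr_gt0.
have [x [xK xmax]] := contact_ex e20.
(* Chosen so that F x + e W s <= (e/2) W t for t beyond b; the term e W s compensates for W t - W s
   in the denominator. *)
have [b b0 Wb] := W_infty ay (2 / e * (F x + e * W s)).
have Fx0 : 0 <= F x.
  rewrite -(primitive0 phi); apply: (primitive_mono phi_decr phi_ge0 phi_fin) => //; last by case: xK.
  exact: KE.
have Wx0 : 0 <= W x.
  rewrite -(primitive0 w); apply: (primitive_mono w_decr w_ge0 w_fin) => //; last by case: xK.
  exact: KE.
have Fs0 : 0 <= F s.
  by rewrite -(primitive0 phi); apply: (primitive_mono phi_decr phi_ge0 phi_fin) => //; exact: KE.
apply: (@le_trans _ _ (ereal_sup (mean_ratio_fin a w f s @` [set t | Num.max s b < t]))).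
  apply: ereal_inf_lbound; exists [set t | Num.max s b < t] => //.
  by exists (Num.max s b); split => //; exact: num_real.
apply: ge_ereal_sup => _ [t /= sbt <-]; move: sbt; rewrite gt_max => /andP[st bt].
have t0 : 0 <= t by rewrite (le_trans s0)// ltW.
have tK := KE _ t0.
rewrite mean_ratio_finE// lee_fin.
have Wst := primitive_lt w_decr w_ge0 w_fin w_gt0 (KE _ s0) tK st.
rewrite ler_pdivrMr ?subr_gt0//.
have h1 := xmax _ tK.
have h2 : 2 / e * (F x + e * W s) <= W t.
  apply: (le_trans Wb); apply: (primitive_mono w_decr w_ge0 w_fin) => //; last exact: ltW.
  exact/KE/ltW.
have h3 : F x + e * W s <= e / 2 * W t.
  move: h2; rewrite -(ler_pM2l e20) mulrA (_ : e / 2 * (2 / e) = 1) ?mul1r//.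
  by field; rewrite gt_eqF.
have h4 : 0 <= e / 2 * W x by rewrite mulr_ge0// ltW.
move: h1 h3 h4 Fs0; rewrite mulrBr; lra.
Qed.

(** An infinite right end forces a = +oo, where the limiting mean ratio is not positive. *)
Lemma level_interval_real s b : level_interval a w f s b ->
  exists t : R, [/\ b = t%:E, 0 <= s, s < t & K t].
Proof.
move=> [[s0 sb] sub r0 _]; case: b sb sub r0 => [t| |]// sb sub r0.
  have t0 : 0 <= t by rewrite (le_trans s0)// ltW.
  exists t; split => //; split => //; rewrite leNgt; apply/negP => at_.
  have [r /andP[ar rt]] := rat_between (x := maxe s%:E a) (y := t%:E) ltac:(by rewrite gt_max sb at_).
  move: ar; rewrite gt_max => /andP[sr ar].
  have [_] : I (ratr r) by apply: sub; split.
  by rewrite ltNge (ltW ar).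
have ay : a = +oo%E.
  apply/eqP; rewrite -leye_eq leNgt; apply/negP => ay.
  have [r /andP[ar _]] := rat_between (x := maxe s%:E a) (y := +oo%E) ltac:(by rewrite gt_max sb ay).
  move: ar; rewrite gt_max => /andP[sr ar].
  have [_] : I (ratr r) by apply: sub; split => //; rewrite ltry.
  by rewrite ltNge (ltW ar).
by move: r0; rewrite ltNge mean_ratio_infty.
Qed.

(* A point of the interval supporting the graph with slope l > 0 forces l to be
   the mean ratio; in the absence of such points the bracketing contact points
   lie outside. *)
Lemma level_interval_contact s t : level_interval a w f s t%:E -> 0 <= s -> s < t -> K t ->
  exists l x y, [/\ 0 < l, contact l x, contact l y, x <= s & t <= y].
Proof.
move=> [_ _ r0 rmax] s0 st tK.
have sK : K s by have [_ ta] := tK; split => //; rewrite (le_trans _ ta)// lee_fin ltW.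
have Wst x y (xK : K x) (yK : K y) (xy : x < y) : 0 < W y - W x.
  by rewrite subr_gt0; exact: (primitive_lt w_decr w_ge0 w_fin w_gt0 xK yK xy).
have Wst0 := Wst _ _ sK tK st.
pose r := (F t - F s) / (W t - W s).
have rE : F t - F s = r * (W t - W s) by rewrite divfK// gt_eqF.
move: r0 rmax; rewrite /mean_ratio mean_ratio_finE// lte_fin -/r => r0 rmax.
have rle z : s < z -> z < t -> F z - F s <= r * (W z - W s).
  move=> sz zt; have zK : K z by apply: (closed_domain_between sK tK); rewrite !ltW.
  have := rmax z; rewrite mean_ratio_finE// lee_fin ler_pdivrMr; last exact: Wst.
  by apply; split.
have case1 m z : 0 < m -> contact m z -> s < z -> z < t ->
    exists l x y, [/\ 0 < l, contact l x, contact l y, x <= s & t <= y].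
  move=> m0 zc sz zt; have [zK zmax] := zc.
  have h1 := zmax _ sK; have h2 := zmax _ tK; have h3 := rle _ sz zt.
  have d1 := Wst _ _ sK zK sz; have d2 := Wst _ _ zK tK zt.
  have [g1 g2] := chord_slope d1 d2 rE h3 h1 h2.
  exists m, s, t; split; [exact: m0|split; first exact: sK|split; first exact: tK|exact: lexx|exact: lexx] => u uK.
    exact: le_trans (zmax _ uK) g1.
  exact: le_trans (zmax _ uK) g2.
pose z := (s + t) / 2; have sz : s < z by rewrite /z; lra.
have zt : z < t by rewrite /z; lra.
have zI : I z by apply: (oitv_between sK tK); rewrite sz.
have [x xc xz] := ex_contact_left a_gt0 phi_decr phi_ge0 phi_fin w_decr w_gt0 w_fin contact_ex zI.
have := slope_ge0 a_gt0 phi_decr phi_ge0 phi_fin w_decr w_gt0 w_fin contact_ex zI.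
rewrite le_eqVlt => /predU1P[l0|l0].
  exfalso; have [xK xmax] := xc.
  have := xmax _ tK; rewrite -l0 !mul0r !subr0 => Ftx.
  have [xs|sx] := leP x s.
    have := primitive_mono phi_decr phi_ge0 phi_fin xK sK xs.
    have := mulr_gt0 r0 Wst0; lra.
  have h := rle _ sx (le_lt_trans xz zt).
  have := mulr_gt0 r0 (Wst _ _ xK tK (le_lt_trans xz zt)); lra.
have [y yc zy] := ex_contact_right a_gt0 phi_decr phi_ge0 phi_fin w_decr w_gt0 w_fin contact_ex zI l0.
have [xs|sx] := leP x s; last exact: case1 l0 xc sx (le_lt_trans xz zt).
have [ty|yt] := leP t y; last exact: case1 l0 yc (lt_le_trans sz zy) yt.
by exists (slope z), x, y.
Qed.

Let psi t := slope t * w t.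

Let minmax l (l0 : 0 < l) := ex_contact_minmax a_gt0 phi_decr phi_ge0 phi_fin w_decr w_gt0 w_fin contact_ex l0.

(** A level interval containing (x, y) lies between contact points of some level m. The slope on (x,
    y) equals both l and m, so these are contact points of level l and cannot lie outside [x, y]. *)
Lemma minmax_level_interval l x y : 0 < l -> contact l x -> contact l y -> x < y ->
  (forall s, contact l s -> x <= s <= y) ->
  maximal_level_interval a w f x y%:E /\ mean_ratio a w f x y%:E = l%:E.
Proof.
move=> l0 xc yc xy xymax; have [xK xm] := xc; have [yK ym] := yc.
have x0 : 0 <= x by case: xK.
have Wst s t (sK : K s) (tK : K t) (st : s < t) : 0 < W t - W s.
  by rewrite subr_gt0; exact: (primitive_lt w_decr w_ge0 w_fin w_gt0 sK tK st).
have rE : mean_ratio a w f x y%:E = l%:E.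
  rewrite /mean_ratio mean_ratio_finE//; congr (_%:E).
  have Wxy := Wst _ _ xK yK xy.
  apply: (mulIf (x := W y - W x)); first by rewrite gt_eqF.
  rewrite divfK ?gt_eqF//; have := xm _ yK; have := ym _ xK; rewrite mulrBr; lra.
have lev : level_interval a w f x y%:E.
  split; [by split|exact: oitv_closed_domain|by rewrite rE lte_fin|].
  move=> t [xt ty]; rewrite rE /mean_ratio.
  have tK : K t by apply: (closed_domain_between xK yK); rewrite !ltW.
  rewrite mean_ratio_finE// lee_fin ler_pdivrMr; last exact: Wst.
  by have := xm _ tK; lra.
split => //; split => // s' b' lev' sub.
have [t' [bE s0' st' tK']] := level_interval_real lev'; rewrite {}bE in lev' sub *.
have [m [u [v [m0 uc vc us tv]]]] := level_interval_contact lev' s0' st' tK'.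
pose z := (x + y) / 2; have xz : x < z by rewrite /z; lra.
have zy : z < y by rewrite /z; lra.
have [sz zt] : oitv s' t'%:E z by apply: sub; split; rewrite lte_fin.
have zl : slope z = l.
  by apply: (slope_const a_gt0 phi_decr phi_ge0 phi_fin w_decr w_gt0 w_fin contact_ex (ltW l0) xc yc); rewrite xz.
have zm : slope z = m.
  apply: (slope_const a_gt0 phi_decr phi_ge0 phi_fin w_decr w_gt0 w_fin contact_ex (ltW m0) uc vc).
  by rewrite (le_lt_trans us)//= (lt_le_trans _ tv).
have {zm}ml : m = l by rewrite -zm.
rewrite {}ml in uc vc; have /andP[xu _] := xymax _ uc; have /andP[_ vy] := xymax _ vc.
apply/seteqP; split => // r [sr rt]; split.
  by rewrite (le_lt_trans _ sr)// lee_fin (le_trans xu).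
by rewrite (lt_le_trans rt)// lee_fin (le_trans _ vy).
Qed.

(** The excluded points are those of the null set in [phi_eq_psi_ae]; everywhere else the equality
    is pointwise. *)
Lemma level_fun_eq t : I t -> ~ (~ in_level t /\ phi t <> psi t) ->
  level_fun a w f t = (psi t)%:E.
Proof.
move=> tI tn; rewrite /level_fun; case: pselect => [ex|nex].
  case: (cid ex) => -[s b]/= [[lev maxl] stb].
  have [t' [bE s0 st tK]] := level_interval_real lev; rewrite {}bE in lev maxl stb *.
  have [l [u [v [l0 uc vc us tv]]]] := level_interval_contact lev s0 st tK.
  have [x [y [xc yc xymax]]] := minmax l0.
  have /andP[xu _] := xymax _ uc; have /andP[_ vy] := xymax _ vc.
  have xs := le_trans xu us; have ty := le_trans tv vy.
  have xy : x < y by apply: (le_lt_trans xs); exact: lt_le_trans ty.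
  have [[lev' maxl'] rE] := minmax_level_interval l0 xc yc xy xymax.
  (* The chosen interval lies between the extreme contact points of its level, which bound a level
     interval themselves; maximality makes the two equal, so the choice does not matter. *)
  have sub : oitv s t'%:E `<=` oitv x y%:E.
    by move=> z [sz zt]; split; [rewrite (le_lt_trans _ sz)|rewrite (lt_le_trans zt)].
  have [sx ty'] := oitv_inj xy st (maxl _ _ lev' sub).
  rewrite -sx -ty' rE -EFinM; congr (_%:E); rewrite /psi; congr (_ * _).
  apply/esym; apply: (slope_const a_gt0 phi_decr phi_ge0 phi_fin w_decr w_gt0 w_fin contact_ex (ltW l0) xc yc).
  by have [xt ty2] := sub _ stb; rewrite -!lte_fin xt.
rewrite real_rearrangementE//; congr (_%:E); apply: contrapT => pE; apply: tn; split => //.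
move=> [s0 [u [v [uc vc /andP[ut tv]]]]]; apply: nex.
have [x [y [xc yc xymax]]] := minmax s0.
have /andP[xu _] := xymax _ uc; have /andP[_ vy] := xymax _ vc.
have xt := le_lt_trans xu ut; have ty := lt_le_trans tv vy.
have [ml _] := minmax_level_interval s0 xc yc (lt_trans xt ty) xymax.
by exists (x, y%:E); split => //; split; rewrite lte_fin.
Qed.

Lemma level_fun_ae : ae_eq leb I (level_fun a w f) (EFin \o psi).
Proof.
have := phi_eq_psi_ae a_gt0 phi_decr phi_ge0 phi_fin w_decr w_gt0 w_fin contact_ex real_rearrangement_right.
apply: negligibleS => t /= H; apply: contrapT => nH; apply: H => tI.
by apply: level_fun_eq => // -[ni pE]; apply: nH.
Qed.

End rearrangement_contact.

(** * The Koethe dual *)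

Section upper_bounds.
Context {R : realType}.
Local Notation T := (caratheodory_type (@wlength R idfun)^*%mu).
Variables (p q : R) (a : \bar R).
Hypothesis p_gt1 : 1 < p.
Hypothesis pq : p^-1 + q^-1 = 1.
Hypothesis a_gt0 : (0 < a)%E.
Local Notation I := (oitv 0 a).

Let mI := @measurable_oitv R 0 a.
Let p_gt0 : 0 < p := lt_trans ltr01 p_gt1.

Lemma conjugate_gt1 : 1 < q.
Proof.
have qE : q^-1 = 1 - p^-1 by rewrite -pq addrC addKr.
have p1 : p^-1 < 1 by rewrite invf_lt1.
have qi0 : 0 < q^-1 by rewrite qE subr_gt0.
have q0 : 0 < q by rewrite -invr_gt0.
by rewrite -invf_lt1// qE gtrBl invr_gt0.
Qed.

Let q_gt1 := conjugate_gt1.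
Let q_gt0 : 0 < q := lt_trans ltr01 q_gt1.

Lemma conjugate_mulB1 : (q - 1) * p = q.
Proof.
have pn0 : p != 0 by rewrite gt_eqF. have qn0 : q != 0 by rewrite gt_eqF.
have : (p^-1 + q^-1) * (p * q) = p * q by rewrite pq mul1r.
have -> : (p^-1 + q^-1) * (p * q) = q + p by field; rewrite ?pn0 ?qn0.
lra.
Qed.

(** Hoelder for G v^(-1/p) and H v^(1/p); since q/p = q - 1, the q-th power of the first factor
    carries the weight v^(1-q). *)
Lemma hoelder_weight (v G H : R -> R) : positive_on a v -> L0 a v -> L0 a G -> L0 a H ->
  (forall t, I t -> 0 <= G t) -> (forall t, I t -> 0 <= H t) ->
  (\int[leb]_(t in I) (G t * H t)%:E <=
   (\int[leb]_(t in I) (G t `^ q * v t `^ (1 - q))%:E) `^ q^-1 *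
   (\int[leb]_(t in I) (H t `^ p * v t)%:E) `^ p^-1)%E.
Proof.
move=> v_gt0 mv mG mH G0 H0.
pose f1 := (fun t : R => G t * v t `^ (- p^-1)) \_ I.
pose f2 := (fun t : R => H t * v t `^ p^-1) \_ I.
have mf1 : measurable_fun (setT : set T) f1.
  apply/(measurable_restrictT _ mI); apply: (measurable_funM mG).
  exact: (measurableT_comp (measurable_powR _) mv).
have mf2 : measurable_fun (setT : set T) f2.
  apply/(measurable_restrictT _ mI); apply: (measurable_funM mH).
  exact: (measurableT_comp (measurable_powR _) mv).
have qp1 : q^-1 + p^-1 = 1 by rewrite addrC.
have := @hoelder _ T R leb f1 f2 q p mf1 mf2 q_gt0 p_gt0 qp1.
rewrite Lnorm1.
have qn0 : q != 0 by rewrite gt_eqF.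
have pn0 : p != 0 by rewrite gt_eqF.
have -> : (\int[leb]_t `|((EFin \o (f1 \* f2)%R) : T -> \bar R) t| =
    \int[leb]_(t in I) (G t * H t)%:E)%E.
  rewrite [RHS]integral_mkcond; apply: eq_integral => t _.
  rewrite /f1 /f2/= !patchE; case: ifPn => [|_]; last by rewrite mul0r normr0.
  rewrite inE => tI; rewrite mulrACA -powRD; last by apply/implyP => _; rewrite gt_eqF// v_gt0.
  by rewrite addNr powRr0 mulr1 ger0_norm// mulr_ge0 ?G0 ?H0.
rewrite unlock /Lnorm.
have -> : (\int[leb]_t `|((EFin \o f1) : T -> \bar R) t| `^ q =
    \int[leb]_(t in I) (G t `^ q * v t `^ (1 - q))%:E)%E.
  rewrite [RHS]integral_mkcond; apply: eq_integral => t _.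
  rewrite /f1/= !patchE; case: ifPn => [|_]; last by rewrite normr0 powR0.
  rewrite inE => tI; rewrite ger0_norm ?mulr_ge0 ?G0 ?powR_ge0//.
  rewrite powRM ?G0 ?powR_ge0// -powRrM; congr (_ * _ `^ _)%:E.
  have -> : p^-1 = 1 - q^-1 by rewrite -pq addrK.
  by rewrite mulNr mulrBl mul1r mulVf//; ring.
have -> : (\int[leb]_t `|((EFin \o f2) : T -> \bar R) t| `^ p =
    \int[leb]_(t in I) (H t `^ p * v t)%:E)%E.
  rewrite [RHS]integral_mkcond; apply: eq_integral => t _.
  rewrite /f2/= !patchE; case: ifPn => [|_]; last by rewrite normr0 powR0.
  rewrite inE => tI; have v0 := ltW (v_gt0 _ tI).
  rewrite ger0_norm ?mulr_ge0 ?H0 ?powR_ge0// powRM ?H0 ?powR_ge0//.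
  by rewrite -powRrM mulVf// powRr1.
by [].
Qed.

Lemma decreasing_fin_of_integral (u : R -> \bar R) (om : R -> R) (r : R) : 0 < r ->
  (forall s t, s <= t -> (u t <= u s)%E) -> (forall t, (0 <= u t)%E) ->
  measurable_fun (I : set T) u -> positive_on a om -> L0 a om ->
  (\int[leb]_(t in I) (u t `^ r * (om t)%:E) < +oo)%E ->
  forall t, I t -> (u t < +oo)%E.
Proof.
move=> r0 udec u0 mu om0 mom ufin t tI; have [t0 ta] := tI.
rewrite ltNge leye_eq; apply/eqP => uy; move: ufin; apply/negP; rewrite -leNgt.
have sub : oitv 0 t%:E `<=` I by apply: oitv_subr; exact: ltW.
have mt : measurable (oitv 0 t%:E : set T) by exact: measurable_oitv.
have mf : measurable_fun (I : set T) (fun t => (u t `^ r * (om t)%:E)%E).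
  apply: emeasurable_funM; last exact/measurable_EFinP.
  exact: (measurableT_comp (measurable_poweR _) mu).
have f0 x : I x -> (0 <= u x `^ r * (om x)%:E)%E.
  by move=> xI; rewrite mule_ge0 ?poweR_ge0// lee_fin ltW// om0.
apply: (@le_trans _ _ (\int[leb]_(x in oitv 0 t%:E) (u x `^ r * (om x)%:E))%E); last first.
  exact: (@ge0_subset_integral _ T R leb _ _ mt mI _ mf f0 sub).
apply: (@le_trans _ _ (\int[leb]_(x in oitv 0 t%:E) cst +oo%E x)%E).
  rewrite integral_cst// [X in (_ * X)%E](_ : _ = t%:E); first by rewrite gt0_mulye.
  by rewrite [LHS]leb_oitv0// ltW.
apply: (ge0_le_integral leb mt).
- by move=> x _; rewrite /= leey.
- exact: measurable_cst.
- exact: (measurable_funS mI sub).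
- move=> x xt; have [_ xt'] := xt; rewrite /=.
  have -> : u x = +oo%E.
    by apply/eqP; rewrite -leye_eq -uy udec// -lee_fin ltW.
  by rewrite poweRyr ?gt_eqF// gt0_mulye// lte_fin om0//; exact: sub.
Qed.

Lemma rearrangement_hoelder (v f g : R -> R) : positive_on a v -> decreasing_on a v ->
  L0 a f -> L0 a g ->
  (\int[leb]_(t in I) (rearrangement a g t `^ p * (v t)%:E) <= 1)%E ->
  (\int[leb]_(t in I) (rearrangement a f t * rearrangement a g t) <=
   inv_weight_norm a q v (rearrangement a f))%E.
Proof.
move=> v_gt0 vd mf mg Ng; have mv := measurable_decreasing vd.
have [|Mf] := leP +oo%E (inv_weight_norm a q v (rearrangement a f)).
  by rewrite leye_eq => /eqP ->; rewrite leey.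
have rdec (h : R -> R) s t : s <= t -> (rearrangement a h t <= rearrangement a h s)%E.
  exact: rearrangement_nonincr.
have mr (h : R -> R) := measurable_rearrangement a h mI.
have gfin t : I t -> (rearrangement a g t < +oo)%E.
  apply: (decreasing_fin_of_integral p_gt0 (rdec g) (rearrangement_ge0 a g) (mr g) v_gt0 mv).
  by rewrite (le_lt_trans Ng)// ltry.
have qi0 : q^-1 != 0 by rewrite gt_eqF// invr_gt0.
have mvq : L0 a (fun t => v t `^ (1 - q)).
  exact: (measurableT_comp (measurable_powR _) mv).
have ffin t : I t -> (rearrangement a f t < +oo)%E.
  have vq0 : positive_on a (fun t => v t `^ (1 - q)).
    by move=> x xI; rewrite powR_gt0// v_gt0.
  apply: (decreasing_fin_of_integral q_gt0 (rdec f) (rearrangement_ge0 a f) (mr f) vq0 mvq).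
  exact: (lty_poweRy qi0).
pose F t := fine (rearrangement a f t); pose G t := fine (rearrangement a g t).
have FE t : I t -> rearrangement a f t = (F t)%:E.
  by move=> tI; rewrite fineK// ge0_fin_numE ?ffin// rearrangement_ge0.
have GE t : I t -> rearrangement a g t = (G t)%:E.
  by move=> tI; rewrite fineK// ge0_fin_numE ?gfin// rearrangement_ge0.
have mF : L0 a F by exact: (measurableT_comp (fine_measurable measurableT) (mr f)).
have mG : L0 a G by exact: (measurableT_comp (fine_measurable measurableT) (mr g)).
have F0 t : I t -> 0 <= F t by move=> tI; rewrite fine_ge0// rearrangement_ge0.
have G0 t : I t -> 0 <= G t by move=> tI; rewrite fine_ge0// rearrangement_ge0.
have -> : (\int[leb]_(t in I) (rearrangement a f t * rearrangement a g t) =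
    \int[leb]_(t in I) (F t * G t)%:E)%E.
  by apply: eq_integral => t; rewrite inE => tI; rewrite FE// GE.
apply: (le_trans (hoelder_weight v_gt0 mv mF mG F0 G0)).
rewrite /inv_weight_norm.
have -> : (\int[leb]_(t in I) (rearrangement a f t `^ q * (v t `^ (1 - q))%:E) =
    \int[leb]_(t in I) (F t `^ q * v t `^ (1 - q))%:E)%E.
  by apply: eq_integral => t; rewrite inE => tI; rewrite FE.
rewrite -[leRHS]mule1 lee_wpmul2l ?poweR_ge0//.
have -> : (\int[leb]_(t in I) (G t `^ p * v t)%:E =
    \int[leb]_(t in I) (rearrangement a g t `^ p * (v t)%:E))%E.
  by apply: eq_integral => t; rewrite inE => tI; rewrite GE.
rewrite -[leRHS](poweR1r p^-1); apply: gt0_ler_poweR => //.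
- by rewrite invr_ge0 ltW.
- rewrite in_itv/= leey andbT; apply: integral_ge0 => t tI.
  by rewrite mule_ge0 ?poweR_ge0// lee_fin ltW// v_gt0.
- by rewrite in_itv/= lee01 leey.
Qed.

(** Both majorants are allowed at once so that v = w yields the bound by the infimum over g, and g =
    f the bound by the infimum over weights. Hardy's inequality is used twice: for f and g against
    the rearrangement of h, and for v and w against its p-th power. *)
Lemma kothe_norm_le (w v f g : R -> R) :
  positive_on a w -> decreasing_on a w -> positive_on a v -> decreasing_on a v ->
  submajorized a v w -> L0 a f -> L0 a g -> submajorized a f g ->
  (kothe_norm a (lorentz a p w) (lorentz_norm a p w) f <=
   inv_weight_norm a q v (rearrangement a g))%E.
Proof.
move=> w_gt0 wd v_gt0 vd vw mf mg fg.
have w0 x : I x -> 0 <= w x by move=> /w_gt0/ltW.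
have v0 x : I x -> 0 <= v x by move=> /v_gt0/ltW.
have mr (h : R -> R) := measurable_rearrangement a h mI.
have r0 (h : R -> R) x : I x -> (0 <= rearrangement a h x)%E.
  by move=> _; exact: rearrangement_ge0.
apply: ge_ereal_sup => _ [h [[mh _] Nh] <-].
apply: (le_trans (hardy_littlewood (ltW a_gt0) mf mh)).
apply: (@le_trans _ _ (\int[leb]_(t in I) (rearrangement a g t * rearrangement a h t))%E).
  apply: (hardy a_gt0 (mr f) (mr g) (mr h) (r0 f) (r0 g) (r0 h)) => //.
  by move=> x y _ _; exact: rearrangement_nonincr.
apply: rearrangement_hoelder => //.
have mh' : measurable_fun (I : set T) (fun t => rearrangement a h t `^ p)%E.
  exact: (measurableT_comp (measurable_poweR _) (mr h)).
under eq_integral do rewrite muleC.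
apply: (@le_trans _ _ (\int[leb]_(t in I) ((w t)%:E * rearrangement a h t `^ p))%E).
  apply: (hardy a_gt0 _ _ mh').
  - exact/measurable_EFinP/measurable_decreasing.
  - exact/measurable_EFinP/measurable_decreasing.
  - by move=> x xI; rewrite lee_fin v0.
  - by move=> x xI; rewrite lee_fin w0.
  - by move=> x _; exact: poweR_ge0.
  - move=> x y _ _ xy; apply: gt0_ler_poweR; rewrite ?(ltW p_gt0)//.
    + by rewrite in_itv/= rearrangement_ge0 leey.
    + by rewrite in_itv/= rearrangement_ge0 leey.
    + exact: rearrangement_nonincr.
  - move=> x xI; rewrite -(integral_rearrangement_decreasing vd v0 xI).
    by rewrite -(integral_rearrangement_decreasing wd w0 xI); exact: vw.
have X0 : (0 <= \int[leb]_(t in I) ((w t)%:E * rearrangement a h t `^ p))%E.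
  by apply: integral_ge0 => t tI; rewrite mule_ge0 ?poweR_ge0// lee_fin w0.
move: Nh; rewrite /lorentz_norm; under eq_integral do rewrite muleC.
set X := (\int[leb]_(t in I) _)%E in X0 * => Nh.
rewrite leNgt; apply/negP => X1; move: Nh; apply/negP; rewrite -ltNge.
have pi0 : 0 < p^-1 by rewrite invr_gt0.
case: (X) X1 => [r| |]//; last by rewrite poweRyr ?gt_eqF// ltry.
rewrite poweR_EFin !lte_fin => r1.
have h1 : 1 = 1 `^ p^-1 :> R by rewrite powR1.
by rewrite [ltLHS]h1; apply: gt0_ltr_powR => //; rewrite nnegrE ?ler01// ltW// (lt_trans ltr01).
Qed.

End upper_bounds.

Section L0_products.
Context {R : realType}.
Local Notation T := (caratheodory_type (@wlength R idfun)^*%mu).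
Variable a : \bar R.

Lemma L0M (f g : R -> R) : L0 a f -> L0 a g -> L0 a (fun x => f x * g x).
Proof. by move=> mf mg; exact: measurable_funM. Qed.

Lemma measurable_L0_norm (f : R -> R) : L0 a f ->
  measurable_fun (oitv 0 a : set T) (fun x => `|f x|%:E).
Proof.
move=> mf; apply/measurable_EFinP.
exact: (measurableT_comp (@normr_measurable R setT) mf).
Qed.

Lemma decreasing_mul (u v : R -> R) : decreasing_on a u -> decreasing_on a v ->
  (forall x, oitv 0 a x -> 0 <= u x) -> (forall x, oitv 0 a x -> 0 <= v x) ->
  decreasing_on a (fun x => u x * v x).
Proof.
move=> ud vd u0 v0 s t sI tI st.
exact: (ler_pM (u0 _ tI) (v0 _ tI) (ud _ _ sI tI st) (vd _ _ sI tI st)).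
Qed.

Lemma decreasing_powR (u : R -> R) (r : R) : 0 <= r -> decreasing_on a u ->
  (forall x, oitv 0 a x -> 0 <= u x) -> decreasing_on a (fun x => u x `^ r).
Proof.
move=> r0 ud u0 s t sI tI st; apply: (ge0_ler_powR r0); rewrite ?nnegrE.
- exact: u0.
- exact: u0.
- exact: ud.
Qed.

End L0_products.

(** * The Lorentz norm and Hoelder's inequality for the Koethe norm *)

Section lorentz_space.
Context {R : realType}.
Local Notation T := (caratheodory_type (@wlength R idfun)^*%mu).
Variables (p : R) (a : \bar R) (w : R -> R).
Hypothesis p_gt1 : 1 < p.
Hypothesis a_gt0 : (0 < a)%E.
Hypothesis w_gt0 : positive_on a w.
Hypothesis w_decr : decreasing_on a w.
Local Notation I := (oitv 0 a).
Local Notation Lam := (lorentz a p w).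
Local Notation N := (lorentz_norm a p w).

Let mI := @measurable_oitv R 0 a.
Let p_gt0 : 0 < p := lt_trans ltr01 p_gt1.
Let pi_gt0 : 0 < p^-1. Proof. by rewrite invr_gt0. Qed.
Let w_ge0 x (xI : I x) : 0 <= w x := ltW (w_gt0 xI).
Local Open Scope ereal_scope.

Let mw : measurable_fun (I : set T) (EFin \o w).
Proof. exact/measurable_EFinP/measurable_decreasing. Qed.

Lemma measurable_lorentz_integrand (h : R -> \bar R) : measurable_fun (I : set T) h ->
  measurable_fun (I : set T) (fun t => h t `^ p * (w t)%:E).
Proof.
move=> mh; apply: (emeasurable_funM _ mw).
exact: (measurableT_comp (measurable_poweR _) mh).
Qed.

Lemma lorentz_integrand_ge0 (h : R -> \bar R) t : I t -> 0 <= h t `^ p * (w t)%:E.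
Proof. by move=> tI; rewrite mule_ge0 ?poweR_ge0// lee_fin w_ge0. Qed.

Lemma lorentz_norm_ge0 g : 0 <= N g.
Proof. exact: poweR_ge0. Qed.

Lemma lorentz_norm_le_of (g : R -> R) (h : R -> \bar R) :
  measurable_fun (I : set T) h ->
  (forall t, I t -> rearrangement a g t <= h t) ->
  N g <= (\int[leb]_(t in I) (h t `^ p * (w t)%:E)) `^ p^-1.
Proof.
move=> mh gh; apply: gt0_ler_poweR; first exact: ltW.
- by rewrite in_itv/= leey andbT; apply: integral_ge0; exact: lorentz_integrand_ge0.
- by rewrite in_itv/= leey andbT; apply: integral_ge0; exact: lorentz_integrand_ge0.
- apply: (ge0_le_integral leb mI).
  + exact: lorentz_integrand_ge0.
  + by apply: measurable_lorentz_integrand; exact: measurable_rearrangement.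
  + exact: measurable_lorentz_integrand.
  + move=> t tI; apply: lee_wpmul2r; first by rewrite lee_fin w_ge0.
    have g0 := rearrangement_ge0 a g t.
    apply: gt0_ler_poweR; first exact: ltW.
    * by rewrite in_itv/= g0 leey.
    * by rewrite in_itv/= leey andbT (le_trans g0)// gh.
    * exact: gh.
Qed.

Lemma lorentz_norm_le g h : L0 a g -> L0 a h ->
  (forall x, I x -> `|g x| <= `|h x|)%R -> N g <= N h.
Proof.
move=> mg mh gh; apply: lorentz_norm_le_of; first exact: measurable_rearrangement.
by move=> t _; exact: le_rearrangement.
Qed.

Lemma lorentzS g h : L0 a g -> Lam h ->
  (forall x, I x -> `|g x| <= `|h x|)%R -> Lam g.
Proof.
move=> mg [mh Nh] gh; split; first exact: mg.
exact: (le_lt_trans (lorentz_norm_le mg mh gh) Nh).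
Qed.

Lemma lorentz_norm_scale g (c : R) : (0 < c)%R -> L0 a g ->
  N (fun x => c * g x)%R <= c%:E * N g.
Proof.
move=> c0 mg; have mr := measurable_rearrangement a g mI.
apply: (@le_trans _ _ ((\int[leb]_(t in I) ((c%:E * rearrangement a g t) `^ p * (w t)%:E)) `^ p^-1)).
  apply: lorentz_norm_le_of; first exact: measurable_funeM.
  by move=> t _; exact: rearrangement_scale.
have -> : \int[leb]_(t in I) ((c%:E * rearrangement a g t) `^ p * (w t)%:E) =
    (c `^ p)%:E * \int[leb]_(t in I) (rearrangement a g t `^ p * (w t)%:E).
  rewrite -(ge0_integralZl_EFin leb mI (@lorentz_integrand_ge0 _) (measurable_lorentz_integrand mr) (powR_ge0 c p)).
  apply: eq_integral => t _; rewrite poweRM ?rearrangement_ge0//; first by rewrite poweR_EFin muleA.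
  by rewrite lee_fin ltW.
rewrite poweRM; [|by rewrite lee_fin powR_ge0|by apply: integral_ge0; exact: lorentz_integrand_ge0].
rewrite poweR_EFin -powRrM divff ?gt_eqF// powRr1//; exact: ltW.
Qed.

Lemma kothe_norm_ge f g : Lam g -> N g <= 1 ->
  \int[leb]_(x in I) `|f x * g x|%:E <= kothe_norm a Lam N f.
Proof. by move=> Lg Ng; apply: ereal_sup_ubound; exists g. Qed.

(** Homogeneity, obtained by rescaling g into the unit ball. The bound n may be 0, so one scales by
    1/(n + e/(k+1)), which costs at most e, and lets e tend to 0. *)
Lemma kothe_hoelder f g (n : R) : L0 a f -> kothe_norm a Lam N f < +oo ->
  Lam g -> (0 <= n)%R -> N g <= n%:E ->
  \int[leb]_(x in I) `|f x * g x|%:E <= kothe_norm a Lam N f * n%:E.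
Proof.
move=> mf Kfin [mg Ng] n0 Nn.
have scale (c : R) : (0 < c)%R -> (c * n <= 1)%R ->
    c%:E * \int[leb]_(x in I) `|f x * g x|%:E <= kothe_norm a Lam N f.
  move=> c0 cn; have mcg : L0 a (fun x => c * g x)%R by exact: measurable_funM.
  have Ncg : N (fun x => c * g x)%R <= 1.
    apply: (le_trans (lorentz_norm_scale c0 mg)).
    apply: (@le_trans _ _ (c%:E * n%:E)); first by rewrite lee_wpmul2l// lee_fin ltW.
    by rewrite -EFinM lee_fin.
  have := @kothe_norm_ge f _ (conj mcg (le_lt_trans Ncg (ltry 1))) Ncg.
  apply: le_trans; rewrite -(ge0_integralZl_EFin leb mI _ _ (ltW c0)).
  - apply: (ge0_le_integral leb mI).
    + by move=> x _; rewrite -EFinM lee_fin mulr_ge0// ltW.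
    + by apply: measurable_funeM; exact: measurable_L0_norm (L0M mf mg).
    + exact: measurable_L0_norm (L0M mf mcg).
    + by move=> x _; rewrite -EFinM lee_fin mulrCA [leRHS]normrM (gtr0_norm c0).
  - by move=> x _; rewrite lee_fin.
  - exact: measurable_L0_norm (L0M mf mg).
have I0 : 0 <= \int[leb]_(x in I) `|f x * g x|%:E by apply: integral_ge0 => x _; rewrite lee_fin.
have K0 : 0 <= kothe_norm a Lam N f.
  pose c := (n + 1)^-1%R; have c0 : (0 < c)%R by rewrite invr_gt0 ltr_wpDl.
  apply: (le_trans _ (scale c c0 _)); first by rewrite mule_ge0// lee_fin ltW.
  by rewrite mulrC ler_pdivrMr ?ltr_wpDl// mul1r lerDl.
have [k Kk] : exists k : R, kothe_norm a Lam N f = k%:E.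
  by exists (fine (kothe_norm a Lam N f)); rewrite fineK// ge0_fin_numE.
rewrite Kk in scale K0 *; rewrite lee_fin in K0.
apply/lee_addgt0Pr => e e0; pose m := (n + e / (k + 1))%R.
have ek0 : (0 < e / (k + 1))%R by rewrite divr_gt0// ltr_wpDl.
have m0 : (0 < m)%R by rewrite ltr_wpDl.
have := scale m^-1%R; rewrite invr_gt0 => /(_ m0).
rewrite mulrC ler_pdivrMr// mul1r lerDl => /(_ (ltW ek0)).
rewrite lee_pdivrMl// => h; apply: (le_trans h); rewrite -!EFinM -EFinD lee_fin.
rewrite /m mulrDl [(n * k)%R]mulrC lerD2l -mulrA ler_piMr ?(ltW e0)//.
by rewrite mulrC ler_pdivrMr ?ltr_wpDl// mul1r lerDl.
Qed.

End lorentz_space.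

(** * Lower bound for the Koethe norm by the norm of psi *)

Section kothe_lower_bound.
Context {R : realType}.
Local Notation T := (caratheodory_type (@wlength R idfun)^*%mu).
Variables (p q : R) (a : \bar R) (w f : R -> R).
Hypothesis p_gt1 : 1 < p.
Hypothesis pq : p^-1 + q^-1 = 1.
Hypothesis a_gt0 : (0 < a)%E.
Hypothesis w_gt0 : positive_on a w.
Hypothesis w_decr : decreasing_on a w.
Local Notation I := (oitv 0 a).
Local Notation K := (closed_domain a).
Local Notation Lam := (lorentz a p w).
Local Notation N := (lorentz_norm a p w).
Local Notation Kf := (kothe_norm a Lam N f).
Hypothesis w_int :
  forall t : R, I t -> (\int[leb]_(x in oitv 0 t%:E) (w x)%:E < +oo)%E.
Hypothesis mf : L0 a f.
Hypothesis Kfin : (Kf < +oo)%E.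
Local Notation W := (primitive w).

Let mI := @measurable_oitv R 0 a.
Let p_gt0 : 0 < p := lt_trans ltr01 p_gt1.
Let pi_gt0 : 0 < p^-1. Proof. by rewrite invr_gt0. Qed.
Let w_ge0 x (xI : I x) : 0 <= w x := ltW (w_gt0 xI).
Let w_fin := weight_int a_gt0 w_gt0 w_decr w_int.

Lemma kothe_norm_integral_le (g : R -> R) (h : R -> R) : L0 a g -> L0 a h ->
  (forall t, I t -> 0 <= h t) ->
  (forall t, I t -> rearrangement a g t <= (h t)%:E)%E ->
  (\int[leb]_(t in I) (h t `^ p * w t)%:E < +oo)%E ->
  (\int[leb]_(x in I) `|f x * g x|%:E <=
   Kf * (\int[leb]_(t in I) (h t `^ p * w t)%:E) `^ p^-1)%E.
Proof.
move=> mg mh h0 gh hfin.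
set X := (\int[leb]_(t in I) (h t `^ p * w t)%:E)%E in hfin *.
have X0 : (0 <= X)%E.
  by apply: integral_ge0 => t tI; rewrite lee_fin mulr_ge0 ?powR_ge0 ?w_ge0.
have Xp : (X `^ p^-1 < +oo)%E by exact: poweR_lty.
have Ng : (N g <= X `^ p^-1)%E.
  have mhE : measurable_fun (I : set T) (EFin \o h) by exact/measurable_EFinP.
  exact: (lorentz_norm_le_of p_gt1 w_gt0 w_decr mhE gh).
have XE : (X `^ p^-1)%E = (fine (X `^ p^-1)%E)%:E.
  by rewrite fineK// ge0_fin_numE ?poweR_ge0.
rewrite XE; apply: (kothe_hoelder p_gt1) => //.
- by split => //; exact: le_lt_trans Xp.
- by rewrite fine_ge0// poweR_ge0.
- by rewrite -XE.
Qed.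

(** f is tested against the indicator of E, whose rearrangement is at most the indicator of (0, t)
    and whose norm is thus at most W(t)^(1/p). *)
Lemma kothe_norm_integral_set (E : set T) (t : R) : measurable E -> E `<=` I ->
  leb E = t%:E -> K t -> (\int[leb]_(x in E) `|f x|%:E <= Kf * (W t `^ p^-1)%:E)%E.
Proof.
move=> mE EI Et tK.
have mt : measurable (oitv 0 t%:E : set T) by exact: measurable_oitv.
have tI : oitv 0 t%:E `<=` I by exact: oitv_closed_domain.
have mg : L0 a (\1_E : R -> R) by exact: measurable_indic.
have mh : L0 a (\1_(oitv 0 t%:E) : R -> R) by exact: measurable_indic.
have hE s : (\1_(oitv 0 t%:E) s `^ p * w s)%:E = ((w s)%:E * (\1_(oitv 0 t%:E) s)%:E)%E.
  rewrite -EFinM indicE; case: (_ \in _); first by rewrite powR1 mul1r mulr1.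
  by rewrite powR0 ?gt_eqF// mul0r mulr0.
have hW : (\int[leb]_(s in I) (\1_(oitv 0 t%:E) s `^ p * w s)%:E = (W t)%:E)%E.
  under eq_integral do rewrite hE.
  by rewrite integral_indic_mul// (primitiveE w_ge0 w_fin).
have := @kothe_norm_integral_le (\1_E) (\1_(oitv 0 t%:E)) mg mh.
rewrite hW ltry poweR_EFin.
have -> : (\int[leb]_(x in I) `|f x * \1_E x|%:E = \int[leb]_(x in E) `|f x|%:E)%E.
  rewrite -(integral_indic_mul _ mI mE EI); apply: eq_integral => x _.
  by rewrite normrM EFinM [X in (_ * X%:E)%E]ger0_norm.
apply => // s [s0 sa]; have [st|ts] := ltP s t.
  rewrite indicE mem_set//; apply: rearrangement_le => //.
  rewrite /distribution_fun (_ : _ `&` _ = set0) ?measure0; first by rewrite lee_fin ltW// -lte_fin.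
  rewrite -subset0 => x [_ /=]; rewrite indicE; case: (_ \in _).
    by rewrite normr1 ltxx.
  by rewrite normr0 ltr10.
rewrite indicE memNset; last by move=> [_]; rewrite lte_fin ltNge ts.
apply: rearrangement_le => //; apply: (@le_trans _ _ t%:E); last by rewrite lee_fin.
rewrite -Et; apply: le_measure; rewrite ?inE//.
  exact: measurable_level.
move=> x [_ /=]; rewrite indicE; case: (boolP (x \in E)) => [|_]; first by rewrite inE.
by rewrite normr0 ltxx.
Qed.

Let k := fine Kf.

Lemma kothe_norm_ge0 : (0 <= Kf)%E.
Proof.
pose z : R -> R := cst 0.
have mz : L0 a z by exact: measurable_cst.
have Nz : N z = 0%E.
  apply/eqP; rewrite eq_le lorentz_norm_ge0 andbT.
  have := @lorentz_norm_le_of _ p a w p_gt1 w_gt0 w_decr z (cst 0%E) (measurable_cst _).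
  have -> : (\int[leb]_(t in I) (cst 0%E t `^ p * (w t)%:E) = 0)%E.
    by apply: integral0_eq => t _; rewrite /= powR0 ?gt_eqF// mul0e.
  rewrite poweR_EFin powR0 ?gt_eqF//; apply=> t tI; apply: rearrangement_le => //.
  rewrite /distribution_fun (_ : _ `&` _ = set0) ?measure0; first by case: tI => /ltW.
  by rewrite -subset0 => x [_ /=]; rewrite /z/= normr0 ltxx.
have := @kothe_norm_ge _ p a w f z; rewrite Nz lee01 => h.
apply: le_trans (h _ isT); first by apply: integral_ge0 => x _; rewrite lee_fin.
by split => //; rewrite Nz ltry.
Qed.

Let KfE : Kf = k%:E.
Proof. by rewrite fineK// ge0_fin_numE// kothe_norm_ge0. Qed.

Let k_ge0 : 0 <= k. Proof. by rewrite fine_ge0// kothe_norm_ge0. Qed.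

(* A level set of infinite measure contains sets of every measure t, on which
   l t <= k W(t)^(1/p), while W grows at most linearly. *)
Lemma kothe_distribution_fin (l : R) : 0 < l -> (distribution_fun a f l < +oo)%E.
Proof.
move=> l0; rewrite ltNge leye_eq; apply/eqP => dy.
have ay : a = +oo%E.
  by apply/eqP; rewrite -leye_eq -dy distribution_fun_le_length// ltW.
have Iall t : 0 < t -> I t by move=> t0; split; rewrite ?lte_fin// ay ltry.
(* For t >= 1, W t <= W 1 + w 1 (t - 1) <= C t. *)
pose C := W 1 + w 1.
have W1 : 0 <= W 1.
  rewrite -(primitive0 w); apply: (primitive_mono w_decr w_ge0 w_fin) => //; last exact: oitvK (Iall _ ltr01).
  exact: closed_domain0.
have w1 : 0 < w 1 by apply: w_gt0; exact: Iall.
have C0 : 0 < C by rewrite ltr_wpDl.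
have bound t : 1 <= t -> (l * t) `^ p <= k `^ p * (C * t).
  move=> t1; have t0 : 0 < t by exact: lt_le_trans t1.
  have tK := oitvK (Iall _ t0).
  have [||||||E [mE _ EA Et]] := @intermediate_measure R a (oitv 0 a `&` [set x : R | l < `|f x|]) set0 t.
  - exact: measurable_level.
  - exact: measurable0.
  - exact: sub0set.
  - exact: subIsetl.
  - by rewrite measure0 lee_fin ltW.
  - by move: dy; rewrite /distribution_fun => ->; rewrite leey.
  have EI : E `<=` I by move=> x /EA[].
  have h1 := kothe_norm_integral_set mE EI Et tK.
  have h2 : ((l * t)%:E <= \int[leb]_(x in E) `|f x|%:E)%E.
    rewrite EFinM -Et -(integral_cst leb mE l%:E); apply: (ge0_le_integral leb mE).
    - by move=> x _; rewrite lee_fin ltW.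
    - exact: measurable_cst.
    - exact: (measurable_funS mI EI (measurable_L0_norm mf)).
    - by move=> x /EA[_ /= /ltW]; rewrite lee_fin.
  have := le_trans h2 h1; rewrite KfE -EFinM lee_fin => h3.
  have Wt : W t <= C * t.
    have := primitive_le w_decr w_ge0 w_fin (Iall _ ltr01) t1 tK.
    rewrite /C; nra.
  have Wt0 : 0 <= W t.
    by rewrite (le_trans W1)// (primitive_mono w_decr w_ge0 w_fin)//; exact: oitvK (Iall _ ltr01).
  apply: (@le_trans _ _ ((k * W t `^ p^-1) `^ p)).
    apply: ge0_ler_powR; rewrite ?nnegrE ?mulr_ge0 ?powR_ge0 ?(ltW p_gt0) ?(ltW l0) ?(ltW t0)//.
  rewrite powRM ?powR_ge0// -powRrM mulVf ?gt_eqF// powRr1//.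
  by rewrite ler_wpM2l ?powR_ge0.
have lp0 : 0 < l `^ p by exact: powR_gt0.
have p10 : 0 < p - 1 by rewrite subr_gt0.
(* [bound] says l^p t^(p-1) <= k^p C. With t^(p-1) = M, larger than k^p C / l^p by one, it fails;
   the added 1 also ensures t >= 1. *)
pose M := k `^ p * C / l `^ p + 1.
have M1 : 1 <= M by rewrite lerDr divr_ge0 ?mulr_ge0 ?powR_ge0 ?(ltW C0).
have M0 : 0 < M by exact: lt_le_trans M1.
pose t := M `^ (p - 1)^-1.
have tp : t `^ (p - 1) = M by rewrite -powRrM mulVf ?gt_eqF// powRr1// ltW.
have t1 : 1 <= t.
  have h1 : 1 = 1 `^ (p - 1)^-1 :> R by rewrite powR1.
  by rewrite h1; apply: ge0_ler_powR; rewrite ?nnegrE ?invr_ge0 ?(ltW p10) ?(ltW M0).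
have t0 : 0 < t by exact: lt_le_trans t1.
have := bound t t1; rewrite powRM ?(ltW l0) ?(ltW t0)//.
have -> : t `^ p = M * t.
  rewrite -tp -[X in _ = _ * X]powRr1 ?(ltW t0)// -powRD ?subrK//.
  by rewrite (gt_eqF t0) implybT.
rewrite !mulrA ler_pM2r// /M mulrDr mulr1 mulrC divfK ?gt_eqF//.
by rewrite gerDl leNgt lp0.
Qed.

Lemma kothe_rearrangement_integral t : I t ->
  (\int[leb]_(s in oitv 0 t%:E) rearrangement a f s <= (k * W t `^ p^-1)%:E)%E.
Proof.
move=> tI; have [E [mE EI Et FE]] := ex_level_set a_gt0 mf kothe_distribution_fin tI.
apply: (le_trans FE); rewrite EFinM -KfE.
exact: kothe_norm_integral_set Et (oitvK tI).
Qed.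

Lemma kothe_rearrangement_int t : I t ->
  (\int[leb]_(s in oitv 0 t%:E) rearrangement a f s < +oo)%E.
Proof. by move=> /kothe_rearrangement_integral h; rewrite (le_lt_trans h) ?ltry. Qed.

Local Notation phi := (real_rearrangement a f).
Local Notation F := (primitive phi).

Let f_int := kothe_rearrangement_int.
Let phi_decr := real_rearrangement_decr f_int.
Let phi_ge0 := real_rearrangement_ge0 f_int.
Let phi_fin := real_rearrangement_int a_gt0 f_int.
Let phiE := real_rearrangementE f_int.

(** For a = +oo, F <= k W^(1/p) is at most l W as soon as W^(1/q) >= k/l. Hence b is taken with W b
    >= (k/l)^q + 1, the 1 keeping W positive, and beyond b the difference F - l W is not
    positive. *)
Lemma kothe_contact_ex :
  (a = +oo%E -> forall M, exists2 t, 0 < t & M <= W t) ->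
  forall l, 0 < l -> exists s, contact a F W l s.
Proof.
move=> Winf l l0; case aE : a => [r| |]; last by move: a_gt0; rewrite aE.
  have rK : K r by move: a_gt0; rewrite /closed_domain/= aE lte_fin => /ltW; split.
  rewrite -aE; apply: (ex_contact a_gt0 f_int w_gt0 w_decr w_int l0 rK) => t [_ tr] rt; left.
  have -> : t = r by apply/eqP; rewrite eq_le rt andbT -lee_fin -aE.
  exact: lexx.
have q0 : 0 < q by rewrite (lt_trans ltr01)//; exact: conjugate_gt1 pq.
have [b b0 Yb] := Winf aE ((k / l) `^ q + 1).
have KE t : 0 <= t -> K t by move=> t0; split => //; rewrite aE leey.
rewrite -aE; apply: (ex_contact a_gt0 f_int w_gt0 w_decr w_int l0 (KE b (ltW b0))) => t tK bt; right.
have t0 : 0 < t by exact: lt_le_trans bt.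
have tI : I t by split; rewrite ?lte_fin// aE ltry.
have Ft : F t <= k * W t `^ p^-1.
  rewrite -lee_fin -(primitiveE phi_ge0 phi_fin tK).
  by rewrite (integral_real_rearrangement f_int tK) kothe_rearrangement_integral.
have Wbt : W b <= W t by apply: (primitive_mono w_decr w_ge0 w_fin) => //; exact/KE/ltW.
have Y0 : 0 <= (k / l) `^ q by exact: powR_ge0.
have YW : (k / l) `^ q <= W t by move: Yb Wbt Y0; lra.
have W0 : 0 < W t by move: Yb Wbt Y0; lra.
have kl : k / l <= W t `^ q^-1.
  have -> : k / l = ((k / l) `^ q) `^ q^-1.
    by rewrite -powRrM divff ?gt_eqF// powRr1// divr_ge0// ltW.
  by apply: ge0_ler_powR; rewrite ?nnegrE ?invr_ge0 ?(ltW q0) ?(ltW W0).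
rewrite ler_pdivrMr// in kl.
have WE : W t = W t `^ q^-1 * W t `^ p^-1.
  by rewrite -powRD ?(gt_eqF W0) ?implybT// addrC pq powRr1// ltW.
rewrite subr_le0 (le_trans Ft)// [in leRHS]WE mulrA ler_wpM2r ?powR_ge0//.
by rewrite mulrC.
Qed.

Hypothesis contact_ex : forall l, 0 < l -> exists s, contact a F W l s.
Local Notation slope := (slope a F W).

Let q_gt1 : 1 < q := conjugate_gt1 p_gt1 pq.
Let q_gt0 : 0 < q := lt_trans ltr01 q_gt1.
Let qB_ge0 : 0 <= q - 1. Proof. by rewrite subr_ge0 ltW. Qed.
Let slope_nonneg t (tI : I t) : 0 <= slope t :=
  slope_ge0 a_gt0 phi_decr phi_ge0 phi_fin w_decr w_gt0 w_fin contact_ex tI.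
Let slope_dec s t (sI : I s) (tI : I t) (st : s <= t) : slope t <= slope s :=
  slope_nonincr a_gt0 phi_decr phi_ge0 phi_fin w_decr w_gt0 w_fin contact_ex sI tI st.

Section truncated_test_function.
Variables (e M : R).
Hypotheses (e0 : 0 < e) (M0 : 0 < M).

(** The cut at M bounds h; the cut at e confines it to (0, x), x a contact point of level e.
    Together they make the integral of h^p w finite. *)
Let h t := if e < slope t then (Num.min (slope t) M) `^ (q - 1) else 0.

Let h_ge0 t : 0 <= h t.
Proof. by rewrite /h; case: ifP => // _; rewrite powR_ge0. Qed.

Let h_le t : I t -> h t <= M `^ (q - 1).
Proof.
move=> tI; rewrite /h; case: ifP => [es|_]; last exact: powR_ge0.
apply: ge0_ler_powR => //; rewrite ?nnegrE ?(ltW M0)//; last by rewrite ge_min lexx orbT.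
by rewrite le_min slope_nonneg// ltW.
Qed.

Let h_slope s t : I s -> I t -> slope s <= slope t -> h s <= h t.
Proof.
move=> sI tI st; rewrite /h; case: ifP => [es|_]; last first.
  by case: ifP => // _; exact: powR_ge0.
rewrite (lt_le_trans es st); apply: ge0_ler_powR => //; rewrite ?nnegrE.
- by rewrite le_min slope_nonneg// ltW.
- by rewrite le_min slope_nonneg// ltW.
- by rewrite le_min !ge_min st lexx/= orbT.
Qed.

Let h_decr : decreasing_on a h.
Proof. by move=> s t sI tI st; apply: h_slope => //; exact: slope_dec. Qed.

(* Chosen so that eta is nondecreasing and eta (phi t) = h t; the test function is
   eta(|f|). *)
Let eta y := sup [set z | z = 0 \/ exists t, [/\ I t, phi t <= y & z = h t]].

Let eta_ub y : has_ubound [set z | z = 0 \/ exists t, [/\ I t, phi t <= y & z = h t]].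
Proof.
exists (M `^ (q - 1)) => z [->|[t [tI _ ->]]]; [exact: powR_ge0|exact: h_le].
Qed.

Let eta_mono y y' : y <= y' -> eta y <= eta y'.
Proof.
move=> yy'; apply: ge_sup; first by exists 0; left.
move=> z [->|[t [tI ty ->]]]; apply: ub_le_sup; rewrite //; first by left.
by right; exists t; split => //; exact: le_trans yy'.
Qed.

Let eta_ge0 y : 0 <= eta y.
Proof. by apply: ub_le_sup => //; left. Qed.

(** A value h s > h t with phi s <= phi t would require slope s > slope t, which [slope_lt_phi]
    forbids. *)
Let eta_phi t : I t -> eta (phi t) = h t.
Proof.
move=> tI; apply/eqP; rewrite eq_le; apply/andP; split; last first.
  by apply: ub_le_sup => //; right; exists t.
apply: ge_sup; first by exists 0; left.
move=> z [->//|[s [sI st ->]]]; rewrite leNgt; apply/negP => ts.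
have slt : slope t < slope s.
  by rewrite ltNge; apply/negP => /(h_slope sI tI); rewrite leNgt ts.
have := slope_lt_phi a_gt0 phi_decr phi_ge0 phi_fin w_decr w_gt0 w_fin contact_ex
  (real_rearrangement_right a_gt0 mf f_int) tI sI slt.
by rewrite ltNge st.
Qed.

Let g x := eta `|f x|.

Let mg : L0 a g.
Proof.
have meta : measurable_fun (setT : set (measurableTypeR R)) eta.
  by apply: nondecreasing_measurable => // x y; exact: eta_mono.
apply: (measurableT_comp meta).
exact: (measurableT_comp (@normr_measurable R setT) mf).
Qed.

(** By monotonicity of eta, g > h t forces |f| > phi t, and this happens on measure at most t. *)
Let g_rearrangement t : I t -> (rearrangement a g t <= (h t)%:E)%E.
Proof.
move=> tI; apply: rearrangement_le => //.
have dt : (distribution_fun a f (phi t) <= t%:E)%E.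
  by rewrite leNgt -rearrangement_gtE ?(ltW a_gt0) ?phi_ge0// phiE// ltxx.
apply: le_trans dt; apply: le_measure; rewrite ?inE; do ?exact: measurable_level.
move=> x [xI /=]; rewrite /g ger0_norm ?eta_ge0// -eta_phi// => hx; split => //=.
by rewrite ltNge; apply/negP => /eta_mono; rewrite leNgt hx.
Qed.

Let mphih : measurable_fun (I : set T) (fun t => (phi t * h t)%:E).
Proof.
apply/measurable_EFinP; apply: measurable_decreasing.
exact: (decreasing_mul phi_decr h_decr phi_ge0 (fun t _ => h_ge0 t)).
Qed.

(** The layer of phi h at c is an initial segment (0, b). For r < b, the set where |f| >= phi r has
    measure at least r, and on it |f| eta(|f|) >= phi r h r > c. *)
Let resonance : (\int[leb]_(t in I) (phi t * h t)%:E <= \int[leb]_(x in I) `|f x * g x|%:E)%E.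
Proof.
under eq_integral do rewrite -[(_ * _)%:E]mul1e.
under [leRHS]eq_integral do rewrite -[_%:E]mul1e.
have mfg := measurable_L0_norm (L0M mf mg).
apply: (le_integral_layers mI (measurable_cst 1%E) mphih _ _ mI (measurable_cst 1%E) mfg).
- by move=> x _; exact: lee01.
- by move=> x xI; rewrite lee_fin mulr_ge0 ?phi_ge0.
- by move=> x _; exact: lee01.
- by move=> x _; rewrite lee_fin.
move=> c c0; set S : set T := I `&` _; set Q : set T := I `&` _.
have mS : measurable S by exact: emeasurable_fun_o_infty.
have mQ : measurable Q by exact: emeasurable_fun_o_infty.
have SI : S `<=` I by exact: subIsetl.
have [b [b0 ba bS Sb]] : exists b, [/\ (0 <= b)%E, (b <= a)%E, oitv 0 b `<=` S & forall x, S x -> (x%:E <= b)%E].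
  apply: (down_closed_oitv a_gt0 SI) => x y [[y0 ya] cy] /andP[x0 xy].
  have xI : I x by split; [rewrite lte_fin|rewrite (le_lt_trans _ ya)].
  have yI : I y by split.
  split; first exact: xI.
  apply: (lt_le_trans cy); rewrite lee_fin.
  exact: (decreasing_mul phi_decr h_decr phi_ge0 (fun t _ => h_ge0 t)).
rewrite (ge0_integral_down_closed b0 SI bS Sb mS (measurable_cst 1%E) (fun x _ => lee01)).
rewrite !integral_cst//; last exact: measurable_oitv.
rewrite !mul1e [leLHS]leb_oitv0// leNgt; apply/negP => Qb.
have [r /andP[Qr rb]] := rat_between Qb.
have br : oitv 0 b (ratr r) by split => //; rewrite (le_lt_trans _ Qr).
have [rI /= cr] := bS _ br.
have := level_ge_length a_gt0 mf kothe_distribution_fin rI (phi_ge0 rI).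
rewrite phiE// => /(_ (lexx _)); rewrite leNgt; apply/negP; rewrite negbK.
apply: le_lt_trans Qr; apply: le_measure; rewrite ?inE//.
  have := @emeasurable_fun_c_infty _ T R _ _ mI (measurable_L0_norm mf) (phi (ratr r))%:E.
  by congr measurable; apply/seteqP; split => x [Ix /=]; rewrite lee_fin.
move=> x [xI /= rx]; split => //=; apply: (lt_le_trans cr).
rewrite lee_fin normrM /g [X in _ <= _ * X]ger0_norm ?eta_ge0//.
by rewrite ler_pM ?phi_ge0// -eta_phi// eta_mono.
Qed.

(** With X the left-hand side, X <= int psi h <= int phi h <= int |f g| <= k X^(1/p); X is finite,
    so X^(1/q) <= k. *)
Lemma truncated_slope_norm_le :
  (\int[leb]_(t in I) (h t `^ p * w t)%:E <= (k `^ q)%:E)%E.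
Proof.
have mh : L0 a h by exact: measurable_decreasing.
have mpsi : L0 a (fun t => slope t * w t).
  apply: measurable_decreasing.
  exact: (decreasing_mul (fun s t sI tI st => slope_dec sI tI st) w_decr slope_nonneg w_ge0).
have mhp : measurable_fun (I : set T) (fun t => (h t `^ p * w t)%:E).
  have hd := decreasing_powR (ltW p_gt0) h_decr (fun t _ => h_ge0 t).
  apply/measurable_EFinP; apply: measurable_decreasing.
  exact: (decreasing_mul hd w_decr (fun t _ => powR_ge0 _ _) w_ge0).
have hp0 t : I t -> (0 <= (h t `^ p * w t)%:E)%E.
  by move=> tI; rewrite lee_fin mulr_ge0 ?powR_ge0 ?w_ge0.
have [x xc] := contact_ex e0; have [xK _] := xc.
have mx : measurable (oitv 0 x%:E : set T) by exact: measurable_oitv.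
have xI : oitv 0 x%:E `<=` I by exact: oitv_closed_domain.
set X := (\int[leb]_(t in I) (h t `^ p * w t)%:E)%E.
have X0 : (0 <= X)%E by exact: integral_ge0.
have Xfin : (X < +oo)%E.
  have mB : measurable_fun (I : set T) (fun t => ((M `^ (q - 1)) `^ p)%:E * ((w t)%:E * (\1_(oitv 0 x%:E) t)%:E))%E.
    apply: measurable_funeM; apply: emeasurable_funM.
      exact/measurable_EFinP/measurable_decreasing.
    by apply/measurable_EFinP; exact: measurable_indic.
  have wi0 t : I t -> (0 <= (w t)%:E * (\1_(oitv 0 x%:E) t)%:E)%E.
    by move=> tI; rewrite mule_ge0// lee_fin w_ge0.
  apply: (@le_lt_trans _ _ (((M `^ (q - 1)) `^ p)%:E * (W x)%:E)%E); last by rewrite -EFinM ltry.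
  rewrite -(primitiveE w_ge0 w_fin xK) -(integral_indic_mul _ mI mx xI).
  rewrite -(ge0_integralZl_EFin leb mI wi0 _ (powR_ge0 _ p)); last first.
    apply: emeasurable_funM; first exact/measurable_EFinP/measurable_decreasing.
    by apply/measurable_EFinP; exact: measurable_indic.
  apply: (ge0_le_integral leb mI hp0 mhp mB) => t tI.
  have [tx|tx] := boolP (t \in oitv 0 x%:E).
    rewrite indicE tx mule1 -EFinM lee_fin ler_wpM2r ?w_ge0//.
    by apply: ge0_ler_powR; rewrite ?nnegrE ?(ltW p_gt0) ?powR_ge0// h_le.
  have -> : h t = 0.
    rewrite /h; case: ifP => // es; case/negP: tx; rewrite inE; have [t0 _] := tI.
    split => //; rewrite lte_fin.
    exact: (lt_slope_contact w_decr w_gt0 w_fin tI (ltW e0) es xc).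
  by rewrite powR0 ?gt_eqF// mul0r mule_ge0 ?wi0// lee_fin powR_ge0.
(* Since (q - 1) p = q, the p-th power of h is min(slope, M)^q, at most slope times min(slope,
   M)^(q-1). *)
have step1 : (X <= \int[leb]_(t in I) ((slope t * w t)%:E * (h t)%:E))%E.
  apply: (ge0_le_integral leb mI hp0 mhp).
    by apply: emeasurable_funM; exact/measurable_EFinP.
  move=> t tI; rewrite -EFinM lee_fin mulrAC ler_wpM2r ?w_ge0//.
  rewrite /h; case: ifP => [es|_]; last by rewrite powR0 ?gt_eqF// mulr0.
  have s0 := slope_nonneg tI; have m0 : 0 < Num.min (slope t) M.
    by rewrite lt_min M0 (lt_trans e0).
  rewrite -powRrM (conjugate_mulB1 p_gt1 pq) -(mulr_powRB1 (ltW m0) q_gt0).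
  by rewrite ler_wpM2r ?powR_ge0// ge_min lexx.
have step2 : (\int[leb]_(t in I) ((slope t * w t)%:E * (h t)%:E) <=
    \int[leb]_(t in I) ((phi t)%:E * (h t)%:E))%E.
  apply: (integral_psi_le_phi a_gt0 phi_decr phi_ge0 phi_fin w_decr w_gt0 w_fin contact_ex).
  - exact/measurable_EFinP.
  - by move=> t _; rewrite lee_fin.
  - by move=> s t sI tI st; rewrite lee_fin h_slope.
  - move=> t tI; rewrite lte_fin /h; case: ifP => [es _|_]; last by rewrite ltxx.
    exact: lt_trans es.
have step3 := kothe_norm_integral_le mg mh (fun t _ => h_ge0 t) g_rearrangement Xfin.
have := le_trans (le_trans step1 step2) (le_trans resonance step3).
rewrite -/X KfE; case: X X0 Xfin {step1 step3} => [r| |]// r0 _.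
rewrite poweR_EFin -EFinM !lee_fin in r0 * => rk.
have := r0; rewrite le_eqVlt => /predU1P[<-|rp]; first exact: powR_ge0.
have rE : r = r `^ q^-1 * r `^ p^-1.
  by rewrite -powRD ?(gt_eqF rp) ?implybT// addrC pq powRr1.
have rq : r `^ q^-1 <= k.
  by rewrite -(ler_pM2r (powR_gt0 p^-1 rp)) -rE.
have -> : r = (r `^ q^-1) `^ q by rewrite -powRrM mulVf ?gt_eqF// powRr1.
by apply: ge0_ler_powR; rewrite ?nnegrE ?powR_ge0 ?(ltW q_gt0).
Qed.

End truncated_test_function.

(** Monotone convergence of the truncations with e = 1/(n+1) and M = n + 1. *)
Lemma kothe_slope_norm_le :
  (\int[leb]_(t in I) ((slope t * w t) `^ q * w t `^ (1 - q))%:E <= (k `^ q)%:E)%E.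
Proof.
pose h n t := if n.+1%:R^-1 < slope t then (Num.min (slope t) n.+1%:R) `^ (q - 1) else 0.
pose u n t := (h n t `^ p * w t)%:E.
have n0 n : 0 < n.+1%:R^-1 :> R by rewrite invr_gt0.
have bound n : (\int[leb]_(t in I) u n t <= (k `^ q)%:E)%E.
  exact: truncated_slope_norm_le.
have h0 n t : 0 <= h n t by rewrite /h; case: ifP => // _; exact: powR_ge0.
have hdec n : decreasing_on a (h n).
  move=> s t sI tI st; rewrite /h; have ss := slope_dec sI tI st.
  case: ifP => [es|_]; last by case: ifP => // _; exact: powR_ge0.
  rewrite (lt_le_trans es ss); apply: ge0_ler_powR => //; rewrite ?nnegrE.
  - by rewrite le_min slope_nonneg/=.
  - by rewrite le_min slope_nonneg/=.
  - by rewrite le_min !ge_min ss lexx/= orbT.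
have mu n : measurable_fun (I : set T) (u n).
  have hd := decreasing_powR (ltW p_gt0) (hdec n) (fun t _ => h0 n t).
  apply/measurable_EFinP; apply: measurable_decreasing.
  exact: (decreasing_mul hd w_decr (fun t _ => powR_ge0 _ _) w_ge0).
have u0 n t : I t -> (0 <= u n t)%E.
  by move=> tI; rewrite lee_fin mulr_ge0 ?powR_ge0 ?w_ge0.
have und t : I t -> {homo u ^~ t : m n / (m <= n)%N >-> (m <= n)%E}.
  move=> tI m n mn; rewrite lee_fin; apply: (ler_wpM2r (w_ge0 tI)).
  apply: (ge0_ler_powR (ltW p_gt0)); rewrite ?nnegrE; [exact: h0|exact: h0|].
  rewrite {1}/h; case: ifP => [es|_]; last exact: h0.
  have mn' : n.+1%:R^-1 <= m.+1%:R^-1 :> R by rewrite lef_pV2 ?posrE// ler_nat.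
  rewrite /h (le_lt_trans mn' es); apply: (ge0_ler_powR qB_ge0); rewrite ?nnegrE.
  - by rewrite le_min slope_nonneg/=.
  - by rewrite le_min slope_nonneg/=.
  - by rewrite le_min !ge_min lexx/= ler_nat ltnS mn orbT.
have cvu := @cvg_monotone_convergence _ T R leb I mI u mu u0 und.
have -> : (\int[leb]_(t in I) ((slope t * w t) `^ q * w t `^ (1 - q))%:E =
    \int[leb]_(t in I) limn (u ^~ t))%E.
  apply: eq_integral => t; rewrite inE => tI; have s0 := slope_nonneg tI.
  rewrite (powR_level q_gt1 s0 (w_gt0 tI)) mulrAC mulr_powRB1//.
  apply/esym/cvg_lim => //; apply: cvg_near_cst.
  have := s0; rewrite le_eqVlt => /predU1P[sE|sp].
    apply: nearW => n; rewrite /u /h -sE ltNge (ltW (n0 n))/= powR0 ?gt_eqF//.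
    by rewrite powR0 ?gt_eqF.
  (* From this index on both cuts are inactive at t, and the sequence is constant. *)
  exists (maxn (Num.truncn (slope t)) (Num.truncn (slope t)^-1)) => // n /=.
  rewrite geq_max => /andP[n1 n2]; rewrite /u /h.
  have -> : n.+1%:R^-1 < slope t.
    rewrite -[ltRHS]invrK ltf_pV2 ?posrE ?invr_gt0//.
    by apply: (lt_le_trans (truncnS_gt _)); rewrite ler_nat ltnS.
  have -> : Num.min (slope t) n.+1%:R = slope t.
    by apply/min_idPl/ltW/(lt_le_trans (truncnS_gt _)); rewrite ler_nat ltnS.
  by rewrite -powRrM (conjugate_mulB1 p_gt1 pq).
rewrite -(cvg_lim _ cvu)//; apply: lime_le; first by apply/cvg_ex; eexists; exact: cvu.
exact: nearW.
Qed.

End kothe_lower_bound.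

Section inverse_weighted_norm.
Context {R : realType}.
Local Notation T := (caratheodory_type (@wlength R idfun)^*%mu).
Variables (a : \bar R) (q : R) (v : R -> R).
Hypothesis q_gt0 : 0 < q.
Hypothesis mv : L0 a v.
Local Notation I := (oitv 0 a).
Local Open Scope ereal_scope.

Let mI := @measurable_oitv R 0 a.

Let mvq : measurable_fun (I : set T) (fun t => (v t `^ (1 - q))%:E).
Proof.
apply/measurable_EFinP.
exact: (measurableT_comp (@measurable_powR R (1 - q)) mv).
Qed.

Lemma measurable_inv_weight (h : R -> \bar R) : measurable_fun (I : set T) h ->
  measurable_fun (I : set T) (fun t => h t `^ q * (v t `^ (1 - q))%:E).
Proof.
move=> mh; apply: (emeasurable_funM _ mvq).
exact: (measurableT_comp (measurable_poweR _) mh).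
Qed.

Lemma inv_weight_ge0 (h : R -> \bar R) t : 0 <= h t `^ q * (v t `^ (1 - q))%:E.
Proof. by rewrite mule_ge0 ?poweR_ge0// lee_fin powR_ge0. Qed.

Lemma inv_weight_norm_ae (h k : R -> \bar R) : measurable_fun (I : set T) h ->
  measurable_fun (I : set T) k -> ae_eq leb I h k ->
  inv_weight_norm a q v h = inv_weight_norm a q v k.
Proof.
move=> mh mk hk; congr (_ `^ _).
apply: (ge0_ae_eq_integral mI (measurable_inv_weight mh) (measurable_inv_weight mk)).
- by move=> x _; exact: inv_weight_ge0.
- by move=> x _; exact: inv_weight_ge0.
- by move: hk; apply: filterS => x hk xI; rewrite hk.
Qed.

Lemma inv_weight_norm_EFin (h : R -> R) : inv_weight_norm a q v (EFin \o h) =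
  (\int[leb]_(t in I) (h t `^ q * v t `^ (1 - q))%:E) `^ q^-1.
Proof. by []. Qed.

Lemma inv_weight_norm_scale (c : R) (h : R -> R) : (0 <= c)%R -> L0 a h ->
  (forall t, I t -> 0 <= h t)%R ->
  inv_weight_norm a q v (EFin \o (fun t => c * h t)%R) =
  c%:E * inv_weight_norm a q v (EFin \o h).
Proof.
move=> c0 mh h0; have mhE : measurable_fun (I : set T) (EFin \o h) by exact/measurable_EFinP.
rewrite !inv_weight_norm_EFin.
have -> : \int[leb]_(t in I) ((c * h t) `^ q * v t `^ (1 - q))%:E =
    (c `^ q)%:E * \int[leb]_(t in I) (h t `^ q * v t `^ (1 - q))%:E.
  rewrite -(ge0_integralZl_EFin leb mI _ (measurable_inv_weight mhE) (powR_ge0 c q)).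
    apply: eq_integral => t; rewrite inE => tI.
    by rewrite -EFinM mulrA -powRM// h0.
  by move=> t _; exact: inv_weight_ge0.
rewrite poweRM; last first.
- by apply: integral_ge0 => t _; rewrite lee_fin mulr_ge0 ?powR_ge0.
- by rewrite lee_fin powR_ge0.
by rewrite poweR_EFin -powRrM divff ?gt_eqF// powRr1.
Qed.

End inverse_weighted_norm.

(** * Equality of the Koethe norm with the norm of M, and the formulas for the latter *)

Section dominating_function.
Context {R : realType}.
Local Notation T := (caratheodory_type (@wlength R idfun)^*%mu).
Variables (p q : R) (a : \bar R) (w : R -> R).
Hypothesis p_gt1 : 1 < p.
Hypothesis pq : p^-1 + q^-1 = 1.
Hypothesis a_gt0 : (0 < a)%E.
Hypothesis w_gt0 : positive_on a w.
Hypothesis w_decr : decreasing_on a w.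
Hypothesis w_int :
  forall t : R, oitv 0 a t -> (\int[leb]_(x in oitv 0 t%:E) (w x)%:E < +oo)%E.
Local Notation I := (oitv 0 a).
Local Notation K := (closed_domain a).
Local Notation Lam := (lorentz a p w).
Local Notation N := (lorentz_norm a p w).
Local Notation W := (primitive w).
Local Notation knorm := (kothe_norm a Lam N).
Local Notation phi := (real_rearrangement a).
Local Notation F f := (primitive (phi f)).
Local Notation psi f := (fun t => slope a (F f) W t * w t).

Let mI := @measurable_oitv R 0 a.
Let q_gt1 : 1 < q := conjugate_gt1 p_gt1 pq.
Let q_gt0 : 0 < q := lt_trans ltr01 q_gt1.
Let w_ge0 x (xI : I x) : 0 <= w x := ltW (w_gt0 xI).
Let w_fin := weight_int a_gt0 w_gt0 w_decr w_int.
Let mw : L0 a w := measurable_decreasing w_decr.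

Section with_contacts.
Variable f : R -> R.
Hypothesis mf : L0 a f.
Hypothesis Kfin : (knorm f < +oo)%E.
Hypothesis contact_ex : forall l, 0 < l -> exists s, contact a (F f) W l s.

Let f_int := kothe_rearrangement_int p_gt1 a_gt0 w_gt0 w_decr w_int mf Kfin.
Let phi_decr := real_rearrangement_decr f_int.
Let phi_ge0 := real_rearrangement_ge0 f_int.
Let phi_fin := real_rearrangement_int a_gt0 f_int.

Lemma kothe_psi_ge0 t : I t -> 0 <= psi f t.
Proof. exact: (psi_ge0 a_gt0 phi_decr phi_ge0 phi_fin w_decr w_gt0 w_fin contact_ex). Qed.

Lemma kothe_psi_decr : decreasing_on a (psi f).
Proof. exact: (psi_decr a_gt0 phi_decr phi_ge0 phi_fin w_decr w_gt0 w_fin contact_ex). Qed.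

Lemma kothe_psi_submajorized : submajorized a f (psi f).
Proof.
move=> x xI; rewrite (integral_rearrangement_decreasing kothe_psi_decr kothe_psi_ge0 xI).
rewrite -(integral_real_rearrangement f_int (oitvK xI)).
exact: (integral_phi_le_psi a_gt0 phi_decr phi_ge0 phi_fin w_decr w_gt0 w_fin contact_ex xI).
Qed.

Lemma kothe_psi_norm_le : (inv_weight_norm a q w (EFin \o psi f) <= knorm f)%E.
Proof.
rewrite inv_weight_norm_EFin.
have K0 : (0 <= knorm f)%E by exact: (kothe_norm_ge0 f p_gt1 w_gt0 w_decr).
have KE : knorm f = (fine (knorm f))%:E by rewrite fineK// ge0_fin_numE.
have k0 : 0 <= fine (knorm f) by rewrite fine_ge0.
have h := kothe_slope_norm_le p_gt1 pq a_gt0 w_gt0 w_decr w_int mf Kfin contact_ex.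
have -> : knorm f = (((fine (knorm f)) `^ q)%:E `^ q^-1)%E.
  by rewrite poweR_EFin -powRrM divff ?gt_eqF// powRr1.
apply: gt0_ler_poweR; last exact: h.
- by rewrite invr_ge0 ltW.
- rewrite in_itv/= leey andbT; apply: integral_ge0 => t _.
  by rewrite lee_fin mulr_ge0 ?powR_ge0.
- by rewrite in_itv/= leey andbT lee_fin powR_ge0.
Qed.

Lemma rearrangement_psi_norm :
  inv_weight_norm a q w (rearrangement a (psi f)) = inv_weight_norm a q w (EFin \o psi f).
Proof.
apply: inv_weight_norm_ae.
- exact: mw.
- exact: (measurable_rearrangement a (psi f) mI).
- exact/measurable_EFinP/measurable_decreasing/kothe_psi_decr.
- exact: (rearrangement_decreasing kothe_psi_decr kothe_psi_ge0).
Qed.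

End with_contacts.

Lemma kothe_norm_abs_le f g : L0 a f -> L0 a g ->
  (forall x, I x -> `|f x| <= `|g x|) -> (knorm f <= knorm g)%E.
Proof.
move=> mf mg fg; apply: ge_ereal_sup => _ [h [[mh Lh] Nh] <-].
apply: (@le_trans _ _ (\int[leb]_(x in I) `|g x * h x|%:E)%E).
  apply: (ge0_le_integral leb mI).
  - by move=> x _; rewrite lee_fin.
  - exact: measurable_L0_norm (L0M mf mh).
  - exact: measurable_L0_norm (L0M mg mh).
  - by move=> x xI; rewrite lee_fin !normrM; apply: (ler_wpM2r (normr_ge0 _) (fg x xI)).
exact: (@kothe_norm_ge _ p a w g h (conj mh Lh) Nh).
Qed.

(* If W is bounded, f^* is integrable, and a truncation of f to a set of finite measure
   has contact points at every level. *)
Lemma ex_contact_truncation f (c : R) : L0 a f -> (knorm f < +oo)%E -> 1 < c ->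
  exists g, [/\ L0 a g, forall x, I x -> `|g x| <= `|f x|,
    forall l, 0 < l -> exists s, contact a (F g) W l s &
    forall x, I x -> (\int[leb]_(t in oitv 0 x%:E) rearrangement a f t <=
                      c%:E * \int[leb]_(t in oitv 0 x%:E) rearrangement a g t)%E].
Proof.
move=> mf Kfin c_gt1; have c0 : 0 < c := lt_trans ltr01 c_gt1.
have f_int := kothe_rearrangement_int p_gt1 a_gt0 w_gt0 w_decr w_int mf Kfin.
have r0 (h : R -> R) (D : set T) : (0 <= \int[leb]_(t in D) rearrangement a h t)%E.
  by apply: integral_ge0 => t _; exact: rearrangement_ge0.
have self x : (\int[leb]_(t in oitv 0 x%:E) rearrangement a f t <=
    c%:E * \int[leb]_(t in oitv 0 x%:E) rearrangement a f t)%E.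
  by rewrite -[leLHS]mul1e lee_wpmul2r// lee_fin ltW.
have [Winf|] := pselect (a = +oo%E -> forall M, exists2 t, 0 < t & M <= W t).
  exists f; split=> //.
  exact: (kothe_contact_ex p_gt1 pq a_gt0 w_gt0 w_decr w_int mf Kfin Winf).
move=> /not_implyP[aE /existsNP[M WM]].
have KE t : 0 <= t -> K t by move=> t0; split => //; rewrite aE leey.
have IE t : 0 < t -> I t by move=> t0; split; rewrite ?lte_fin// aE ltry.
have phi_int : (\int[leb]_(t in I) rearrangement a f t < +oo)%E.
  pose B := (fine (knorm f) * `|M| `^ p^-1)%R.
  have k0 : 0 <= fine (knorm f).
    by apply: fine_ge0; exact: (kothe_norm_ge0 f p_gt1 w_gt0 w_decr).
  have B0 : (0 <= B%:E)%E by rewrite lee_fin mulr_ge0 ?powR_ge0.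
  apply: (le_lt_trans _ (ltry B)).
  apply: (ge0_integral_oitv_le (ltW a_gt0) (measurable_rearrangement a f mI) _ _ B0).
    by move=> x _; exact: rearrangement_ge0.
  move=> x xI; apply: (le_trans (kothe_rearrangement_integral p_gt1 a_gt0 w_gt0 w_decr w_int mf Kfin xI)).
  rewrite lee_fin; apply: (ler_wpM2l k0).
  have Wx0 : 0 <= W x by exact: (weight_primitive_ge0 a_gt0 w_decr w_gt0 w_fin (oitvK xI)).
  apply: ge0_ler_powR; rewrite ?nnegrE ?invr_ge0 ?(ltW (lt_trans ltr01 p_gt1))//.
  apply: le_trans (ler_norm _); rewrite leNgt; apply/negP => MW; apply: WM.
  by exists x; [case: xI; rewrite lte_fin|exact: ltW].
(* An interval (0, t0) carrying the fraction 1/c of the finite total integral Phi. If there were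
   none, then 0 < Phi <= Phi / c, absurd for c > 1. *)
have [t0 t0_gt0 ht0] : exists2 t0, 0 < t0 & (\int[leb]_(t in I) rearrangement a f t <=
    c%:E * \int[leb]_(t in oitv 0 t0%:E) rearrangement a f t)%E.
  apply: contrapT => hno; pose Phi := (\int[leb]_(t in I) rearrangement a f t)%E.
  have hlt t : 0 < t -> (c%:E * \int[leb]_(s in oitv 0 t%:E) rearrangement a f s < Phi)%E.
    by move=> tp; rewrite ltNge; apply/negP => h; apply: hno; exists t.
  have Phi0 : (0 < Phi)%E by apply: (le_lt_trans _ (hlt 1 ltr01)); rewrite mule_ge0 ?r0// lee_fin ltW.
  have PhiE : Phi = (fine Phi)%:E by rewrite fineK// ge0_fin_numE ?ltW.
  have : (Phi <= (c^-1 * fine Phi)%:E)%E.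
    have B0 : (0 <= (c^-1 * fine Phi)%:E)%E by rewrite lee_fin mulr_ge0 ?invr_ge0 ?(ltW c0)// fine_ge0// ltW.
    apply: (ge0_integral_oitv_le (ltW a_gt0) (measurable_rearrangement a f mI) _ _ B0).
      by move=> x _; exact: rearrangement_ge0.
    move=> x [x0 _]; rewrite lte_fin in x0; have := ltW (hlt x x0).
    by rewrite muleC -lee_pdivlMr// {1}PhiE muleC -EFinM.
  apply/negP; rewrite -ltNge {2}PhiE lte_fin ltr_pdivrMl// ltr_pMl//.
  by move: Phi0; rewrite PhiE lte_fin.
(* Half of the value at t0: below that value, so that truncation at l does not lower the
   rearrangement on (0, t0], and positive, unless the value is 0, so that the level set has finite
   measure. A zero value calls for no truncation. *)
pose l := fine (rearrangement a f t0) / 2.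
have fE := real_rearrangementE f_int (IE t0 t0_gt0).
have phi0 : 0 <= phi f t0 by exact: (real_rearrangement_ge0 f_int (IE t0 t0_gt0)).
(* If the rearrangement of g vanishes from b on, its primitive is constant there while W grows, so
   the maximum is found on a compact interval. The point b + 1 belongs to I even when b = 0. *)
have bounded_contact (g : R -> R) (b : R) : L0 a g ->
    (forall t, I t -> \int[leb]_(s in oitv 0 t%:E) rearrangement a g s < +oo)%E -> 0 <= b ->
    (forall t, I t -> b <= t -> rearrangement a g t = 0%E) ->
    forall l, 0 < l -> exists s, contact a (F g) W l s.
  move=> mg g_int b0 gb m m0.
  have gd := real_rearrangement_decr g_int.
  have gp := real_rearrangement_ge0 g_int.
  have gf := real_rearrangement_int a_gt0 g_int.
  have bK : K (b + 1) by apply: KE; rewrite addr_ge0.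
  apply: (ex_contact a_gt0 g_int w_gt0 w_decr w_int m0 bK) => t tK bt; left.
  have b1 : 0 < b + 1 by rewrite ltr_wpDl.
  have bI := IE _ b1.
  have := primitive_le gd gp gf bI bt tK.
  have -> : phi g (b + 1) = 0.
    by rewrite /real_rearrangement (gb _ bI)// lerDl.
  rewrite mul0r => Fb.
  have Wb : W (b + 1) <= W t by exact: (weight_primitive_le w_decr w_gt0 w_fin).
  by apply: lerB; [rewrite -subr_le0|exact: (ler_wpM2l (ltW m0) Wb)].
have := phi0; rewrite le_eqVlt => /predU1P[phi_eq|phi_gt].
  exists f; split=> //; apply: (bounded_contact f t0 mf f_int (ltW t0_gt0)) => t tI tt.
  apply/eqP; rewrite eq_le rearrangement_ge0 andbT.
  by rewrite (le_trans (rearrangement_nonincr a f tt))// fE -phi_eq.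
have l0 : 0 < l by rewrite divr_gt0.
have lphi : l < phi f t0 by rewrite /l -/(phi f t0); lra.
have mL := measurable_level l mf.
pose g x := f x * \1_(I `&` [set x : R | l < `|f x|]) x.
have mg : L0 a g by apply: L0M => //; exact: measurable_indic.
have gf x : I x -> `|g x| <= `|f x|.
  move=> _; rewrite /g normrM ler_piMr// indicE; case: (_ \in _); rewrite ?normr1// normr0//.
have gle := le_rearrangement _ mg mf gf.
have g_int t : I t -> (\int[leb]_(s in oitv 0 t%:E) rearrangement a g s < +oo)%E.
  move=> tI; apply: (le_lt_trans _ (f_int _ tI)); apply: (ge0_le_integral leb).
  - exact: measurable_oitv.
  - by move=> s _; exact: rearrangement_ge0.
  - by apply: measurable_rearrangement; exact: measurable_oitv.
  - by apply: measurable_rearrangement; exact: measurable_oitv.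
  - by move=> s _; exact: gle.
have dfin : (distribution_fun a f l < +oo)%E.
  exact: (kothe_distribution_fin p_gt1 a_gt0 w_gt0 w_decr w_int mf Kfin l0).
have gdist m : 0 <= m -> (distribution_fun a g m <= distribution_fun a f l)%E.
  move=> m0; apply: le_measure; rewrite ?inE//; first exact: measurable_level.
  move=> x [xI /=]; rewrite /g indicE; case: (boolP (x \in _)) => [|_].
    by rewrite inE.
  by rewrite mulr0 normr0 ltNge m0.
have distg m : 0 <= m -> (distribution_fun a f (Num.max m l) <= distribution_fun a g m)%E.
  move=> m0; apply: le_measure; rewrite ?inE; [exact: measurable_level|exact: measurable_level|].
  move=> x [xI /=]; rewrite gt_max => /andP[mx lx]; split => //=.
  by rewrite /g indicE mem_set// mulr1.
exists g; split; [exact: mg|exact: gf| |].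
  have dE : distribution_fun a f l = (fine (distribution_fun a f l))%:E.
    by rewrite fineK// ge0_fin_numE// distribution_fun_ge0.
  apply: (bounded_contact g (fine (distribution_fun a f l)) mg g_int).
    by apply: fine_ge0; exact: distribution_fun_ge0.
  move=> t _ dt; apply/eqP; rewrite eq_le rearrangement_ge0 andbT.
  by apply: rearrangement_le => //; rewrite (le_trans (gdist 0 _))// dE lee_fin.
(* Above the level l, f and g have the same level sets, and f^* exceeds l on (0, t0]. *)
have fg s : 0 < s -> s <= t0 -> (rearrangement a f s <= rearrangement a g s)%E.
  move=> s0 st; rewrite leNgt; apply/negP => gsf.
  have gE := real_rearrangementE g_int (IE s s0).
  have g0 := real_rearrangement_ge0 g_int (IE s s0).
  have ls : (l%:E < rearrangement a f s)%E.
    by apply: lt_le_trans (rearrangement_nonincr a f st); rewrite fE lte_fin.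
  have : ((Num.max (phi g s) l)%:E < rearrangement a f s)%E.
    by rewrite EFin_max gt_max ls andbT -gE.
  rewrite rearrangement_gtE//; last by rewrite le_max g0.
  move=> /lt_le_trans /(_ (distg _ g0)); rewrite -rearrangement_gtE// gE.
  by rewrite ltxx.
have fg_int x : 0 < x -> x <= t0 -> (\int[leb]_(t in oitv 0 x%:E) rearrangement a f t <=
    \int[leb]_(t in oitv 0 x%:E) rearrangement a g t)%E.
  move=> x0 xt; apply: (ge0_le_integral leb).
  - exact: measurable_oitv.
  - by move=> s _; exact: rearrangement_ge0.
  - by apply: measurable_rearrangement; exact: measurable_oitv.
  - by apply: measurable_rearrangement; exact: measurable_oitv.
  - by move=> s [s0 sx]; rewrite !lte_fin in s0 sx; apply: fg => //; exact: (ltW (lt_le_trans sx xt)).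
move=> x xI; have x0 : 0 < x by case: xI; rewrite lte_fin.
have [xt|tx] := leP x t0.
  apply: (le_trans (self x)); apply: lee_wpmul2l; first by rewrite lee_fin ltW.
  exact: fg_int.
have sub_int (h : R -> R) (b : \bar R) (t : R) : (t%:E <= b)%E ->
    (\int[leb]_(s in oitv 0 t%:E) rearrangement a h s <=
     \int[leb]_(s in oitv 0 b) rearrangement a h s)%E.
  move=> tb; apply: (@ge0_subset_integral _ T R leb).
  - exact: measurable_oitv.
  - exact: measurable_oitv.
  - by apply: measurable_rearrangement; exact: measurable_oitv.
  - by move=> s _; exact: rearrangement_ge0.
  - exact: oitv_subr.
apply: (le_trans (sub_int f a x _)); first by case: xI => _ /ltW.
apply: (le_trans ht0); apply: lee_wpmul2l; first by rewrite lee_fin ltW.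
apply: (le_trans (fg_int t0 t0_gt0 (lexx _))).
by apply: sub_int; rewrite lee_fin ltW.
Qed.

(** For each c > 1, c times the psi of the truncation dominates f, with norm at most c times the
    Koethe norm of f. The value c = 2 gives membership, and c tending to 1 the inequality. *)
Lemma Mnorm_le_kothe_norm f : L0 a f -> (knorm f < +oo)%E ->
  Mspace a q w f /\ (Mnorm a q w f <= knorm f)%E.
Proof.
move=> mf Kfin; have K0 : (0 <= knorm f)%E by exact: (kothe_norm_ge0 f p_gt1 w_gt0 w_decr).
have dominating c : 1 < c -> exists g, [/\ L0 a g, submajorized a f g &
    (inv_weight_norm a q w (rearrangement a g) <= c%:E * knorm f)%E].
  move=> c1; have c0 : 0 <= c := ltW (lt_trans ltr01 c1).
  have [g [mg gf gcontact fg]] := ex_contact_truncation mf Kfin c1.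
  have gK := kothe_norm_abs_le mg mf gf.
  have gfin := le_lt_trans gK Kfin.
  have psid := kothe_psi_decr mg gfin gcontact.
  have psi0 := kothe_psi_ge0 mg gfin gcontact.
  have cd : decreasing_on a (fun t => c * psi g t).
    by move=> s t sI tI st; apply: (ler_wpM2l c0); exact: psid.
  have cp t : I t -> 0 <= c * psi g t by move=> tI; rewrite mulr_ge0 ?psi0.
  have mpsi := measurable_decreasing psid.
  exists (fun t => c * psi g t); split.
  - exact: measurable_decreasing.
  - move=> x xI; apply: (le_trans (fg x xI)).
    rewrite (integral_rearrangement_decreasing cd cp xI).
    have xsub : oitv 0 x%:E `<=` I by apply: oitv_subr; case: xI => _ /ltW.
    have mx : measurable (oitv 0 x%:E : set T) := measurable_oitv 0 x%:E.
    have -> : (\int[leb]_(t in oitv 0 x%:E) (c * psi g t)%:E =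
        c%:E * \int[leb]_(t in oitv 0 x%:E) (psi g t)%:E)%E.
      rewrite -(ge0_integralZl_EFin leb mx _ _ c0).
      + by apply: eq_integral => t _; rewrite EFinM.
      + by move=> t /xsub tI; rewrite lee_fin psi0.
      + by apply/measurable_EFinP; exact: (measurable_funS mI xsub mpsi).
    apply: lee_wpmul2l; first by rewrite lee_fin.
    rewrite -(integral_rearrangement_decreasing psid psi0 xI).
    exact: kothe_psi_submajorized.
  - have -> : inv_weight_norm a q w (rearrangement a (fun t => c * psi g t)) =
        inv_weight_norm a q w (EFin \o (fun t => c * psi g t)).
      apply: inv_weight_norm_ae.
      + exact: mw.
      + exact: (measurable_rearrangement a _ mI).
      + exact/measurable_EFinP/measurable_decreasing.
      + exact: rearrangement_decreasing.
    rewrite inv_weight_norm_scale//; apply: lee_wpmul2l; first by rewrite lee_fin.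
    exact: (le_trans (kothe_psi_norm_le mg gfin gcontact) gK).
split.
  split=> //; have [|g [mg fg gn]] := dominating 2; first by rewrite ltr1n.
  exists g; split; [exact: mg|exact: fg|]; rewrite ltNge leye_eq; apply/negP => /eqP gE.
  have := le_lt_trans gn (lte_mul_pinfty _ _ Kfin); rewrite lee_fin => /(_ (ler0n _ _) isT).
  by rewrite /inv_weight_norm gE poweRyr ?invr_eq0 ?gt_eqF.
have M0 : (0 <= Mnorm a q w f)%E.
  by apply: le_ereal_inf_tmp => _ [g _ <-]; exact: poweR_ge0.
apply/(lee_mul01Pr _ M0) => r /andP[r0 r1].
have [|g [mg fg gn]] := dominating r^-1; first by rewrite invf_gt1.
have Mg : (Mnorm a q w f <= inv_weight_norm a q w (rearrangement a g))%E.
  by apply: ereal_inf_lbound; exists g.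
apply: (@le_trans _ _ (r%:E * (r^-1%:E * knorm f))%E).
  by apply: lee_wpmul2l; [rewrite lee_fin ltW|exact: le_trans gn].
by rewrite muleA -EFinM mulfV ?gt_eqF// mul1e.
Qed.

Lemma kothe_norm_le_Mnorm f : L0 a f -> (knorm f <= Mnorm a q w f)%E.
Proof.
move=> mf; apply: le_ereal_inf_tmp => _ [g [mg fg] <-].
apply: (kothe_norm_le p_gt1 pq a_gt0 w_gt0 w_decr w_gt0 w_decr _ mf mg fg).
by move=> x _; exact: lexx.
Qed.

Lemma Mspace_kothe_norm_fin f : Mspace a q w f -> L0 a f /\ (knorm f < +oo)%E.
Proof.
move=> [mf [g [mg fg gfin]]]; split=> //.
apply: (le_lt_trans (kothe_norm_le p_gt1 pq a_gt0 w_gt0 w_decr w_gt0 w_decr _ mf mg fg)).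
  by move=> x _; exact: lexx.
exact: poweR_lty.
Qed.

Lemma kothe_dualE : kothe_dual a Lam N = Mspace a q w.
Proof.
apply/seteqP; split => f.
  by move=> [mf Kfin]; exact: (Mnorm_le_kothe_norm mf Kfin).1.
exact: Mspace_kothe_norm_fin.
Qed.

Lemma kothe_normE f : Mspace a q w f -> knorm f = Mnorm a q w f.
Proof.
move=> /Mspace_kothe_norm_fin[mf Kfin]; apply/eqP.
by rewrite eq_le kothe_norm_le_Mnorm//= (Mnorm_le_kothe_norm mf Kfin).2.
Qed.

Hypothesis W_infty : a = +oo%E -> forall M, exists2 t, 0 < t & M <= W t.

Lemma Mnorm_level_fun f : Mspace a q w f ->
  Mnorm a q w f = inv_weight_norm a q w (level_fun a w f) /\
  Mnorm a q w f = ereal_inf [set inv_weight_norm a q v (rearrangement a f) |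
    v in [set v | [/\ submajorized a v w, positive_on a v & decreasing_on a v]]].
Proof.
move=> Mf; have [mf Kfin] := Mspace_kothe_norm_fin Mf.
have contact_ex := kothe_contact_ex p_gt1 pq a_gt0 w_gt0 w_decr w_int mf Kfin W_infty.
have f_int := kothe_rearrangement_int p_gt1 a_gt0 w_gt0 w_decr w_int mf Kfin.
have phi_decr := real_rearrangement_decr f_int.
have phi_ge0 := real_rearrangement_ge0 f_int.
have phi_fin := real_rearrangement_int a_gt0 f_int.
have psid := kothe_psi_decr mf Kfin contact_ex.
have psi0 := kothe_psi_ge0 mf Kfin contact_ex.
have mpsi : measurable_fun (I : set T) (EFin \o psi f).
  by apply/measurable_EFinP; exact: measurable_decreasing.
have psi_sub := kothe_psi_submajorized mf Kfin contact_ex.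
have ME : Mnorm a q w f = inv_weight_norm a q w (EFin \o psi f).
  apply/eqP; rewrite eq_le -{2}(kothe_normE Mf) (kothe_psi_norm_le mf Kfin contact_ex) andbT.
  rewrite -(rearrangement_psi_norm mf Kfin contact_ex).
  by apply: ereal_inf_lbound; exists (psi f) => //; split=> //; exact: measurable_decreasing.
have lae := level_fun_ae a_gt0 mf f_int w_gt0 w_decr w_int contact_ex W_infty.
split.
  have lae' : ae_eq leb I (EFin \o psi f) (level_fun a w f).
    by move: lae; apply: filterS => x h xI; rewrite h.
  (* Measurability of the level function is not evident from its definition by choice; it agrees
     a.e. with psi, and completeness of Lebesgue measure suffices. *)
  have cmu : measure_is_complete (leb : {measure set T -> \bar R}).
    exact: completed_lebesgue_measure_is_complete.
  have mlev := ae_measurable_fun cmu lae' mpsi.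
  by rewrite ME; exact: (inv_weight_norm_ae q mw mpsi mlev lae').
apply/eqP; rewrite eq_le; apply/andP; split.
  apply: le_ereal_inf_tmp => _ [v [vw v_gt0 v_decr] <-].
  rewrite -(kothe_normE Mf).
  apply: (kothe_norm_le p_gt1 pq a_gt0 w_gt0 w_decr v_gt0 v_decr vw mf mf).
  by move=> x _; exact: lexx.
have phi_right := real_rearrangement_right a_gt0 mf f_int.
(* The competitor that gives the other inequality: it is submajorized by w, and the weighted norm of
   f^* with it is at most that of psi with w. *)
pose v := level_weight a (phi f) w.
have v_gt0 : positive_on a v by exact: (level_weight_gt0 phi_decr phi_ge0 phi_fin w_decr w_gt0 w_fin).
have v_decr : decreasing_on a v.
  exact: (level_weight_decr a_gt0 phi_decr phi_ge0 phi_fin w_decr w_gt0 w_fin contact_ex).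
apply: (@le_trans _ _ (inv_weight_norm a q v (rearrangement a f))).
  apply: ereal_inf_lbound; exists v; [split; [|exact: v_gt0|exact: v_decr]|reflexivity].
  move=> x xI.
  rewrite (integral_rearrangement_decreasing v_decr _ xI); last by move=> y /v_gt0/ltW.
  rewrite (integral_rearrangement_decreasing w_decr w_ge0 xI).
  exact: (integral_level_weight a_gt0 phi_decr phi_ge0 phi_fin w_decr w_gt0 w_fin contact_ex phi_right xI).
rewrite ME inv_weight_norm_EFin.
have -> : inv_weight_norm a q v (rearrangement a f) =
    inv_weight_norm a q v (EFin \o phi f).
  congr (_ `^ _)%E; apply: eq_integral => t; rewrite inE => tI.
  by rewrite (real_rearrangementE f_int tI).
rewrite inv_weight_norm_EFin; apply: gt0_ler_poweR.
- by rewrite invr_ge0 ltW.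
- rewrite in_itv/= leey andbT; apply: integral_ge0 => t _.
  by rewrite lee_fin mulr_ge0 ?powR_ge0.
- rewrite in_itv/= leey andbT; apply: integral_ge0 => t _.
  by rewrite lee_fin mulr_ge0 ?powR_ge0.
- exact: (level_weight_norm a_gt0 phi_decr phi_ge0 phi_fin w_decr w_gt0 w_fin contact_ex phi_right q_gt1).
Qed.

End dominating_function.

(** * The Banach dual *)

Section lorentz_convergence.
Context {R : realType}.
Local Notation T := (caratheodory_type (@wlength R idfun)^*%mu).
Variables (p : R) (a : \bar R) (w : R -> R).
Hypothesis p_gt1 : 1 < p.
Hypothesis a_gt0 : (0 < a)%E.
Hypothesis w_gt0 : positive_on a w.
Hypothesis w_decr : decreasing_on a w.
Hypothesis w_int :
  forall t : R, oitv 0 a t -> (\int[leb]_(x in oitv 0 t%:E) (w x)%:E < +oo)%E.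
Local Notation I := (oitv 0 a).
Local Notation K := (closed_domain a).
Local Notation Lam := (lorentz a p w).
Local Notation N := (lorentz_norm a p w).
Local Notation W := (primitive w).

Let mI := @measurable_oitv R 0 a.
Let p_gt0 : 0 < p := lt_trans ltr01 p_gt1.
Let w_ge0 x (xI : I x) : 0 <= w x := ltW (w_gt0 xI).
Let w_fin := weight_int a_gt0 w_gt0 w_decr w_int.

Lemma lorentz_null g : L0 a g -> distribution_fun a g 0 = 0%E -> N g = 0%E.
Proof.
move=> mg g0; rewrite /lorentz_norm.
have -> : (\int[leb]_(t in I) (rearrangement a g t `^ p * (w t)%:E) = \int[leb]_(t in I) 0)%E.
  apply: eq_integral => t; rewrite inE => -[t0 _].
  have -> : rearrangement a g t = 0%E.
    apply/eqP; rewrite eq_le rearrangement_ge0 andbT.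
    by apply: rearrangement_le; rewrite ?g0 // ltW.
  by rewrite poweR0r ?gt_eqF// mul0e.
by rewrite integral0 poweR0r// invr_eq0 gt_eqF.
Qed.

Lemma lorentz_negligible g (E : set T) : L0 a g -> measurable E -> leb E = 0%E ->
  (forall x, I x -> ~ E x -> g x = 0) -> N g = 0%E.
Proof.
move=> mg mE E0 gE; apply: lorentz_null => //.
apply: (subset_measure0 (measurable_level 0 mg) mE) => //.
move=> x [xI /=]; apply: contraPP => nE.
by rewrite gE// normr0 ltxx.
Qed.

Lemma lorentz_integral_fin g : Lam g ->
  (\int[leb]_(t in I) (rearrangement a g t `^ p * (w t)%:E) < +oo)%E.
Proof.
move=> [_]; rewrite ltNge [X in ~~ X -> _]leNgt; apply: contraTT.
by rewrite -!leNgt !leye_eq => /eqP h; rewrite /lorentz_norm h poweRyr// invr_eq0 gt_eqF.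
Qed.

Lemma lorentz_norm_EFin_le g (e : R) : 0 < e ->
  (\int[leb]_(t in I) (rearrangement a g t `^ p * (w t)%:E) <= (e `^ p)%:E)%E ->
  (N g <= e%:E)%E.
Proof.
move=> e0 h; have -> : e%:E = ((e `^ p)%:E `^ p^-1)%E.
  by rewrite poweR_EFin -powRrM divff ?gt_eqF// powRr1// ltW.
apply: gt0_ler_poweR; last exact: h.
- by rewrite invr_ge0 ltW.
- rewrite in_itv/= leey andbT; apply: integral_ge0 => t tI.
  by rewrite mule_ge0 ?poweR_ge0// lee_fin w_ge0.
- by rewrite in_itv/= leey andbT lee_fin powR_ge0.
Qed.

(* h = 2^(-t/p): w has bounded integral over intervals of length one. *)
Lemma ex_lorentz_weight : exists h, [/\ decreasing_on a h, positive_on a h & Lam h].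
Proof.
have [c cI _] := primitive_small a_gt0 w_decr w_ge0 w_fin ltr01.
have c0 : 0 < c by case: cI; rewrite lte_fin.
(* B bounds the growth of W over any interval of length at most one: left of c the growth is at most
   W c, right of c at most w c. *)
pose B := W c + w c.
have B0 : 0 <= B by rewrite addr_ge0 ?w_ge0//; exact: (weight_primitive_ge0 a_gt0 w_decr w_gt0 w_fin (oitvK cI)).
pose k t : R := 2 `^ (- t).
have k0 t : 0 < k t by rewrite powR_gt0.
have kd s t : s <= t -> k t <= k s.
  by move=> st; apply: ler_powR; [rewrite ler1n|rewrite lerN2].
have kn n : k n%:R = 2^-1 ^+ n by rewrite /k powRN powR_mulrn// exprVn.
have kD : decreasing_on a k by move=> s t _ _; exact: kd.
have kwD := decreasing_mul kD w_decr (fun t _ => ltW (k0 t)) w_ge0.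
have kw0 t : I t -> (0 <= (k t * w t)%:E)%E.
  by move=> tI; rewrite lee_fin mulr_ge0 ?w_ge0// ltW.
have mkw (D : set T) : measurable D -> D `<=` I -> measurable_fun D (fun t => (k t * w t)%:E).
  by move=> mD DI; apply/measurable_EFinP; exact: (measurable_funS mI DI (measurable_decreasing kwD)).
have step s x : 0 <= s -> K x -> s <= x -> x <= s + 1 -> W x - W s <= B.
  move=> s0 xK sx xs1; have wc := w_ge0 cI.
  have sK : K s by apply: (closed_domain_between (closed_domain0 a_gt0) xK); rewrite s0.
  have Wmono := primitive_mono w_decr w_ge0 w_fin.
  have W0 : 0 <= W s by exact: (weight_primitive_ge0 a_gt0 w_decr w_gt0 w_fin sK).
  have [cs|sc] := leP c s.
    have := sx; rewrite le_eqVlt => /predU1P[->|sx']; first by rewrite subrr.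
    have sI : I s.
      split; first by rewrite lte_fin (lt_le_trans c0).
      by case: xK => _; apply: lt_le_trans; rewrite lte_fin.
    have := primitive_le w_decr w_ge0 w_fin sI sx xK.
    move=> /le_trans; apply.
    apply: (@le_trans _ _ (w c * 1)).
      by apply: ler_pM; [exact: w_ge0|rewrite subr_ge0|exact: w_decr|rewrite lerBlDl].
    by rewrite mulr1 lerDr; exact: (weight_primitive_ge0 a_gt0 w_decr w_gt0 w_fin (oitvK cI)).
  have [xc|cx] := leP x c.
    apply: (@le_trans _ _ (W c)); last by rewrite lerDl.
    by rewrite lerBlDr (le_trans (Wmono _ _ xK (oitvK cI) xc))// lerDl.
  have hx := primitive_le w_decr w_ge0 w_fin cI (ltW cx) xK.
  have hc : w c * (x - c) <= w c.
    by rewrite ler_piMr// lerBlDl (le_trans xs1)// lerD2r ltW.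
  by rewrite /B; move: hx hc W0; set u := w c * _; lra.
(* On (n, n+1) the factor k is at most 2^(-n), so the integrals are dominated by the partial sums of
   B 2^(-i), which are 2 B (1 - 2^(-n)). *)
have bound n : forall x : R, K x -> x <= n%:R ->
    (\int[leb]_(t in oitv 0 x%:E) (k t * w t)%:E <= (2 * B * (1 - 2^-1 ^+ n))%:E)%E.
  elim: n => [|n IHn] x xK xn.
    have -> : oitv 0 x%:E = set0.
      rewrite -subset0 => y [y0 yx]; rewrite !lte_fin in y0 yx.
      by have := lt_le_trans (lt_trans y0 yx) xn; rewrite ltxx.
    by rewrite integral_set0 expr0 subrr mulr0.
  have Bn : 2 * B * (1 - 2^-1 ^+ n) + 2^-1 ^+ n * B = 2 * B * (1 - 2^-1 ^+ n.+1).
    by rewrite exprS; lra.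
  have e0 : 0 <= 2^-1 ^+ n :> R by rewrite exprn_ge0.
  have [xn'|nx] := leP x n%:R.
    apply: (le_trans (IHn x xK xn')); rewrite lee_fin -Bn lerDl.
    exact: mulr_ge0.
  have nK : K n%:R by apply: (closed_domain_between (closed_domain0 a_gt0) xK); rewrite ler0n ltW.
  have sub s : 0 <= s -> oitv s x%:E `<=` I by move=> s0; exact: oitv_closed_domain.
  have n0x : 0 <= (n%:R : R) <= x by apply/andP; split; [exact: ler0n|exact: ltW].
  rewrite (ge0_integral_oitv_split n0x); last 2 first.
  - by apply: mkw; [exact: measurable_oitv|exact: sub].
  - by move=> t /(sub _ (lexx 0))/kw0.
  rewrite -Bn EFinD; apply: leeD; first exact: IHn.
  have mD : measurable (oitv n%:R x%:E : set T) := measurable_oitv n%:R x%:E.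
  have mwD := measurable_decreasing_itv w_decr (ler0n _ n) xK.
  have subn := sub _ (ler0n R n).
  apply: (@le_trans _ _ (\int[leb]_(t in oitv n%:R x%:E) ((2^-1 ^+ n)%:E * (w t)%:E))%E).
    apply: (ge0_le_integral leb mD).
    - by move=> t /subn/kw0.
    - exact: mkw.
    - exact: measurable_funeM.
    - move=> t tD; rewrite -EFinM lee_fin; apply: ler_wpM2r; first exact/w_ge0/subn.
      by rewrite -kn; apply: kd; case: tD => + _; rewrite lte_fin => /ltW.
  rewrite (ge0_integralZl_EFin leb mD _ mwD e0); last first.
    by move=> t /subn tI; rewrite lee_fin w_ge0.
  rewrite (primitive_itv w_decr w_ge0 w_fin n0x xK) -EFinM lee_fin.
  apply: ler_wpM2l => //; apply: (step _ _ (ler0n _ n) xK (ltW nx)).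
  by rewrite -natr1 in xn.
have kw_fin : (\int[leb]_(t in I) (k t * w t)%:E < +oo)%E.
  have B2 : (0 <= (2 * B)%:E)%E by rewrite lee_fin mulr_ge0.
  apply: (le_lt_trans _ (ltry (2 * B))).
  apply: (ge0_integral_oitv_le (ltW a_gt0) (mkw _ mI (fun _ h => h)) kw0 _ B2) => x xI.
  apply: (le_trans (bound (Num.truncn x).+1 x (oitvK xI) (ltW (truncnS_gt x)))).
  rewrite lee_fin ler_piMr ?mulr_ge0// lerBlDr lerDl exprn_ge0//.
have kp t : (k t `^ p^-1) `^ p = k t.
  by rewrite -powRrM mulVf ?gt_eqF// powRr1// ltW.
have pi0 : 0 <= p^-1 by rewrite invr_ge0 ltW.
have hD : decreasing_on a (fun t => k t `^ p^-1).
  exact: (decreasing_powR pi0 kD (fun t _ => ltW (k0 t))).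
have h0 t : I t -> 0 <= k t `^ p^-1 by move=> _; exact: powR_ge0.
exists (fun t => k t `^ p^-1); split.
- exact: hD.
- by move=> t _; rewrite powR_gt0.
split; first exact: measurable_decreasing.
apply: poweR_lty; apply: (le_lt_trans _ kw_fin).
have mh : measurable_fun (I : set T) (EFin \o (fun t => k t `^ p^-1)).
  by apply/measurable_EFinP; exact: measurable_decreasing.
rewrite le_eqVlt; apply/orP; left; apply/eqP.
have mr := measurable_rearrangement a (fun t => k t `^ p^-1) mI.
rewrite (ge0_ae_eq_integral mI (measurable_lorentz_integrand p w_decr mr)
  (measurable_lorentz_integrand p w_decr mh)).
- apply: eq_integral => t _.
  have kE : ((k t `^ p^-1)%:E `^ p = (k t)%:E)%E by rewrite poweR_EFin kp.
  by rewrite EFinM -kE.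
- by move=> t tI; exact: (lorentz_integrand_ge0 p w_gt0).
- by move=> t tI; exact: (lorentz_integrand_ge0 p w_gt0).
- by have := rearrangement_decreasing hD h0; apply: filterS => t h tI; rewrite h.
Qed.

Hypothesis W_infty : a = +oo%E -> forall M, exists2 t, 0 < t & M <= W t.

(* If |f| > l on a set of infinite measure, the norm of f is at least l W(oo)^(1/p). *)
Lemma lorentz_distribution_fin g (l : R) : Lam g -> 0 < l -> (distribution_fun a g l < +oo)%E.
Proof.
move=> Lg l0; have mg := Lg.1; case aE : a => [r| |]; last by move: a_gt0; rewrite aE.
  by have := distribution_fun_le_length (ltW a_gt0) l mg; rewrite aE => /le_lt_trans; apply; exact: ltry.
rewrite ltNge leye_eq; apply/negP => /eqP; rewrite -aE => dE.
set J := (\int[leb]_(t in I) (rearrangement a g t `^ p * (w t)%:E))%E.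
have Jfin : (J < +oo)%E := lorentz_integral_fin Lg.
have J0 : (0 <= J)%E.
  by apply: integral_ge0 => t tI; exact: (lorentz_integrand_ge0 p w_gt0).
have JE : J = (fine J)%:E by rewrite fineK// ge0_fin_numE.
have lp : 0 < l `^ p by rewrite powR_gt0.
(* With this x, l^p W x is at least J + 1, whereas the rearrangement exceeds l on (0, x), so that J
   >= l^p W x. *)
have [x x0 Wx] := W_infty aE ((fine J + 1) / l `^ p).
have xI : I x by split; rewrite ?lte_fin// aE ltry.
have mx : measurable (oitv 0 x%:E : set T) := measurable_oitv 0 x%:E.
have xsub : oitv 0 x%:E `<=` I by apply: oitv_closed_domain => //; exact: oitvK.
have : ((l `^ p * W x)%:E <= J)%E.
  have mr (D : set T) : measurable D -> D `<=` I ->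
      measurable_fun D (fun t => rearrangement a g t `^ p * (w t)%:E)%E.
    move=> mD DI; apply: (measurable_funS mI DI).
    exact: (measurable_lorentz_integrand p w_decr (measurable_rearrangement a g mI)).
  apply: (@le_trans _ _ (\int[leb]_(t in oitv 0 x%:E) (rearrangement a g t `^ p * (w t)%:E))%E); last first.
    apply: (@ge0_subset_integral _ T R leb _ _ mx mI _ (mr _ mI (fun _ h => h)) _ xsub).
    by move=> t tI; exact: (lorentz_integrand_ge0 p w_gt0).
  have mw := measurable_decreasing_itv w_decr (lexx 0) (oitvK xI).
  rewrite EFinM -(primitiveE w_ge0 w_fin (oitvK xI)).
  rewrite -(ge0_integralZl_EFin leb mx _ mw (ltW lp)); last by move=> t /xsub/w_ge0; rewrite lee_fin.
  apply: (ge0_le_integral leb mx).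
  - by move=> t /xsub tI; rewrite -EFinM lee_fin mulr_ge0 ?w_ge0// ltW.
  - exact: measurable_funeM.
  - exact: mr.
  - move=> t tx; have tI := xsub _ tx; apply: lee_wpmul2r; first by rewrite lee_fin w_ge0.
    rewrite -poweR_EFin; apply: gt0_ler_poweR; first exact: ltW.
    + by rewrite in_itv/= lee_fin leey ltW.
    + by rewrite in_itv/= rearrangement_ge0 leey.
    + by apply: ltW; rewrite (rearrangement_gtE _ mg (ltW l0)) dE; case: tI.
rewrite JE lee_fin leNgt; apply/negP; rewrite negbK.
rewrite ler_pdivrMr// in Wx; rewrite mulrC; apply: (lt_le_trans _ Wx).
by rewrite ltrDl.
Qed.

(** Order continuity of the norm. The sets where |u_n| > d decrease to the empty set and have finite
    measure, so the rearrangements tend to 0 pointwise; the rearrangement of g dominates them. *)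
Lemma lorentz_cvg0 g (u : nat -> R -> R) (e : R) : Lam g -> (forall n, L0 a (u n)) ->
  (forall n x, I x -> `|u n x| <= `|g x|) ->
  (forall m n x, (m <= n)%N -> I x -> `|u n x| <= `|u m x|) ->
  (forall x (d : R), I x -> 0 < d -> exists n, `|u n x| <= d) ->
  0 < e -> exists n, (N (u n) <= e%:E)%E.
Proof.
move=> Lg mu ug und u0 e0; have mg := Lg.1.
pose J n := (fun t => rearrangement a (u n) t `^ p * (w t)%:E)%E.
have mr v : measurable_fun (I : set T) (fun t => rearrangement a v t `^ p * (w t)%:E)%E.
  exact: (measurable_lorentz_integrand p w_decr (measurable_rearrangement a v mI)).
have J0 n t : I t -> (0 <= J n t)%E by move=> tI; exact: (lorentz_integrand_ge0 p w_gt0).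
have pow_le (v v' : R -> R) t : (rearrangement a v t <= rearrangement a v' t)%E ->
    (rearrangement a v t `^ p <= rearrangement a v' t `^ p)%E.
  move=> h; apply: gt0_ler_poweR; first exact: ltW.
  - by rewrite in_itv/= rearrangement_ge0 leey.
  - by rewrite in_itv/= rearrangement_ge0 leey.
  - exact: h.
have Jdec t : I t -> {homo J^~ t : m n / (m <= n)%N >-> (n <= m)%E}.
  move=> tI m n mn; apply: lee_wpmul2r; first by rewrite lee_fin w_ge0.
  by apply: pow_le; apply: le_rearrangement => // x xI; exact: und.
have dist0 d t : 0 < d -> I t -> exists n, (rearrangement a (u n) t <= d%:E)%E.
  move=> d0 tI; pose E n : set T := I `&` [set x | d < `|u n x|].
  have mE n : measurable (E n) by exact: measurable_level.
  have E0 : \bigcap_n E n = set0.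
    rewrite -subset0 => x xE; have [xI _] := xE 0%N Logic.I.
    have [n un] := u0 x d xI d0; have [_ /=] := xE n Logic.I.
    by rewrite ltNge un.
  have Efin : (leb (E 0%N) < +oo)%E.
    apply: (@le_lt_trans _ _ (distribution_fun a g d)); last exact: lorentz_distribution_fin.
    apply: le_measure; rewrite ?inE//; first exact: measurable_level.
    by move=> x [xI dx]; split; [exact: xI|exact: (lt_le_trans dx (ug 0%N x xI))].
  have mcap : measurable (\bigcap_n E n) by rewrite E0.
  have Edec : {homo E : m n / (m <= n)%N >-> (n <= m)%O}.
    move=> m n mn; apply/subsetPset => x [xI /= dx]; split => //=.
    exact: lt_le_trans (und _ _ _ mn xI).
  have cE := nonincreasing_cvg_mu Efin mE mcap Edec.
  rewrite E0 measure0 in cE.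
  apply: contrapT => hno; have t0 : (0 < t%:E)%E by case: tI.
  have tE n : (t%:E <= (leb \o E) n)%E.
    rewrite leNgt; apply/negP => h; apply: hno; exists n.
    by apply: rearrangement_le; [exact: ltW|exact: ltW].
  have : (t%:E <= limn (leb \o E))%E.
    by apply: lime_ge; [apply/cvg_ex; eexists; exact: cE|exact: nearW].
  by rewrite (cvg_lim _ cE)// leNgt t0.
have Jcvg t : I t -> J^~ t x @[x --> \oo] --> 0%E.
  move=> tI; have -> : 0%E = ereal_inf (range (J^~ t)).
    apply/eqP; rewrite eq_le; apply/andP; split.
      by apply: le_ereal_inf_tmp => _ [n _ <-]; exact: J0.
    apply/lee_addgt0Pr => d d0; rewrite add0e.
    have wt := w_gt0 tI.
    pose d' := (d / w t) `^ p^-1.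
    have d'0 : 0 < d' by rewrite powR_gt0// divr_gt0.
    have [n un] := dist0 d' t d'0 tI.
    apply: (@le_trans _ _ (J n t)); first by apply: ereal_inf_lbound; exists n.
    apply: (@le_trans _ _ ((d' `^ p)%:E * (w t)%:E)%E).
      apply: lee_wpmul2r; first by rewrite lee_fin ltW.
      rewrite -poweR_EFin; apply: gt0_ler_poweR; first exact: ltW.
      - by rewrite in_itv/= rearrangement_ge0 leey.
      - by rewrite in_itv/= lee_fin leey ltW.
      - exact: un.
    rewrite -EFinM lee_fin /d' -powRrM mulVf ?gt_eqF// powRr1.
      by rewrite divfK// gt_eqF.
    by rewrite divr_ge0// ltW.
  by apply: ereal_nonincreasing_cvgn; exact: Jdec.
have gint : (leb : measure T R).-integrable (I : set T) (fun t => rearrangement a g t `^ p * (w t)%:E)%E.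
  apply/integrableP; split; first exact: mr.
  under eq_integral.
    move=> t; rewrite inE => tI; rewrite gee0_abs; last exact: (lorentz_integrand_ge0 p w_gt0).
    over.
  exact: lorentz_integral_fin.
have Jae : \forall t \ae (leb : measure T R), I t -> J^~ t x @[x --> \oo] --> cst 0%E t.
  by apply: aeW => t tI; exact: Jcvg.
have Jle : \forall t \ae (leb : measure T R), forall n, I t ->
    (`|J n t| <= rearrangement a g t `^ p * (w t)%:E)%E.
  apply: aeW => t n tI; rewrite gee0_abs; last exact: J0.
  apply: lee_wpmul2r; first by rewrite lee_fin w_ge0.
  by apply: pow_le; apply: le_rearrangement => // x xI; exact: ug.
have mJ n : measurable_fun (I : set T) (J n) := mr (u n).
have m0 : measurable_fun (I : set T) (cst 0%E : R -> \bar R) by exact: measurable_cst.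
have [_ _ Jint] := dominated_convergence mI mJ m0 Jae gint Jle.
apply: contrapT => hno.
have ep : 0 < e `^ p by rewrite powR_gt0.
have : ((e `^ p)%:E <= 0)%E.
  rewrite -(@integral0 _ T R leb I) -(cvg_lim _ Jint)//.
  apply: lime_ge; first by apply/cvg_ex; eexists; exact: Jint.
  apply: nearW => n; rewrite leNgt; apply/negP => h; apply: hno; exists n.
  by apply: lorentz_norm_EFin_le => //; exact: ltW.
by rewrite lee_fin leNgt ep.
Qed.

End lorentz_convergence.

Section sign_function.
Context {R : realType}.
Local Notation T := (caratheodory_type (@wlength R idfun)^*%mu).

(** The value at zeros of u is 1, not 0, so that multiplication by this function preserves absolute
    values, hence Lorentz norms. *)
Definition sign_on (D : set R) (u : R -> R) (x : R) : R :=
  2 * \1_(D `&` [set x | 0 <= u x]) x - 1.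

Lemma sign_on_mul D u x : D x -> u x * sign_on D u x = `|u x|.
Proof.
move=> Dx; rewrite /sign_on indicE; case: (boolP (x \in _)); rewrite ?inE ?notin_setE.
  by move=> [_ /= u0]; rewrite ger0_norm//; lra.
move=> nD; have u0 : u x < 0 by rewrite ltNge; apply/negP => u0; apply: nD.
by rewrite ltr0_norm// mulr0 sub0r mulrN1.
Qed.

Lemma norm_sign_on D u x : `|sign_on D u x| = 1.
Proof.
rewrite /sign_on indicE; case: (_ \in _) => /=.
  by rewrite ger0_norm; lra.
by rewrite mulr0 sub0r normrN1.
Qed.

Lemma measurable_nonneg_set (D : set T) (u : R -> R) : measurable D -> measurable_fun D u ->
  measurable (D `&` [set x : R | 0 <= u x] : set T).
Proof.
move=> mD mu; have -> : D `&` [set x : R | 0 <= u x] = D `&` u @^-1` `[0, +oo[%classic.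
  by apply/seteqP; split => x [Dx /= ux]; split => //=; rewrite ?in_itv/= ?andbT// in ux *.
exact: (mu mD _ (measurable_itv _)).
Qed.

Lemma measurable_sign_on (D E : set T) (u : R -> R) : measurable D -> measurable_fun D u ->
  measurable_fun E (sign_on D u).
Proof.
move=> mD mu; apply: measurable_funB; last exact: measurable_cst.
apply: measurable_funM; first exact: measurable_cst.
by apply: measurable_indic; exact: measurable_nonneg_set.
Qed.

End sign_function.

(** * Functionals induced by the Koethe dual *)

Section pairing.
Context {R : realType}.
Local Notation T := (caratheodory_type (@wlength R idfun)^*%mu).
Variables (p : R) (a : \bar R) (w : R -> R).
Hypothesis p_gt1 : 1 < p.
Hypothesis a_gt0 : (0 < a)%E.
Hypothesis w_gt0 : positive_on a w.
Hypothesis w_decr : decreasing_on a w.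
Hypothesis w_int :
  forall t : R, oitv 0 a t -> (\int[leb]_(x in oitv 0 t%:E) (w x)%:E < +oo)%E.
Local Notation I := (oitv 0 a).
Local Notation Lam := (lorentz a p w).
Local Notation N := (lorentz_norm a p w).
Local Notation knorm := (kothe_norm a Lam N).
Local Notation dual := (kothe_dual a Lam N).
Local Notation mu := (@completed_lebesgue_measure R : measure T R).

Let mI := @measurable_oitv R 0 a.
Let p_gt0 : 0 < p := lt_trans ltr01 p_gt1.

Definition pairing (f g : R -> R) : R := \int[mu]_(x in I) (f x * g x).

Lemma lorentz_norm_fin g : Lam g -> N g = (fine (N g))%:E.
Proof. by move=> [_ Ng]; rewrite fineK// ge0_fin_numE// lorentz_norm_ge0. Qed.

Lemma kothe_norm_fin f : dual f -> knorm f = (fine (knorm f))%:E.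
Proof.
by move=> [_ Kf]; rewrite fineK// ge0_fin_numE// (kothe_norm_ge0 f p_gt1 w_gt0 w_decr).
Qed.

Lemma kothe_pairing f g : dual f -> Lam g ->
  (\int[mu]_(x in I) `|f x * g x|%:E <= knorm f * N g)%E.
Proof.
move=> [mf Kf] Lg; rewrite (lorentz_norm_fin Lg).
apply: (kothe_hoelder p_gt1 w_gt0 w_decr mf Kf Lg).
  by apply: fine_ge0; exact: lorentz_norm_ge0.
by rewrite -lorentz_norm_fin.
Qed.

Lemma pairing_integrable f g : dual f -> Lam g ->
  mu.-integrable I (EFin \o (fun x => f x * g x)).
Proof.
move=> df Lg; apply/integrableP; split.
  by apply/measurable_EFinP; exact: (L0M df.1 Lg.1).
apply: (le_lt_trans (kothe_pairing df Lg)).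
by rewrite (lorentz_norm_fin Lg) (kothe_norm_fin df) -EFinM ltry.
Qed.

Lemma pairing_le f g : dual f -> Lam g -> (`|pairing f g|%:E <= knorm f * N g)%E.
Proof.
move=> df Lg; rewrite (EFin_normr_Rintegral mI (pairing_integrable df Lg)).
apply: le_trans (kothe_pairing df Lg).
apply: (le_abse_integral mu mI); apply/measurable_EFinP.
exact: (L0M df.1 Lg.1).
Qed.

Lemma pairing_dual_functional f : dual f -> dual_functional Lam N (pairing f).
Proof.
move=> df; split; last first.
  exists (fine (knorm f)) => g Lg; rewrite -(kothe_norm_fin df).
  exact: pairing_le.
move=> c g h Lg Lh; have ig := pairing_integrable df Lg.
have ih := pairing_integrable df Lh.
rewrite /pairing -(RintegralZl c mI ig) -(RintegralD mI _ ih).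
  by apply: eq_Rintegral => x _; ring.
have := integrableZl mI c ig; apply: (eq_integrable mI) => x _.
by rewrite /= EFinM.
Qed.

Lemma pairing_linear (c : R) f h g : dual f -> dual h -> Lam g ->
  pairing (fun x => c * f x + h x) g = c * pairing f g + pairing h g.
Proof.
move=> df dh Lg; have fg := pairing_integrable df Lg.
have hg := pairing_integrable dh Lg.
rewrite /pairing -(RintegralZl c mI fg) -(RintegralD mI _ hg).
  by apply: eq_Rintegral => x _; ring.
have := integrableZl mI c fg; apply: (eq_integrable mI) => x _.
by rewrite /= EFinM.
Qed.

Lemma pairing_sign f g : dual f -> Lam g -> exists g', [/\ Lam g',
  (N g' <= N g)%E & (pairing f g')%:E = (\int[mu]_(x in I) `|f x * g x|%:E)%E].
Proof.
move=> df Lg; pose s := sign_on I (fun x => f x * g x).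
have mfg : measurable_fun (I : set T) (fun x => f x * g x) := L0M df.1 Lg.1.
have ms : L0 a s by exact: measurable_sign_on.
have mg' : L0 a (fun x => g x * s x) := L0M Lg.1 ms.
have g'g x : `|g x * s x| = `|g x| by rewrite normrM norm_sign_on mulr1.
have Lg' : Lam (fun x => g x * s x).
  by apply: (lorentzS p_gt1 w_gt0 w_decr mg' Lg) => x _; rewrite g'g.
exists (fun x => g x * s x); split; first exact: Lg'.
  by apply: (lorentz_norm_le p_gt1 w_gt0 w_decr mg' Lg.1) => x _; rewrite g'g.
rewrite /pairing /Rintegral fineK; last exact: (integrable_fin_num mI (pairing_integrable df Lg')).
by apply: eq_integral => x; rewrite inE => xI; rewrite mulrA (sign_on_mul _ xI).
Qed.

Lemma dual_norm_pairing f : dual f -> dual_norm Lam N (pairing f) = knorm f.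
Proof.
move=> df; apply/eqP; rewrite eq_le; apply/andP; split.
  apply: ge_ereal_sup => _ [g [Lg Ng] <-]; apply: (le_trans (pairing_le df Lg)).
  rewrite -[leRHS]mule1; apply: lee_wpmul2l => //.
  exact: (kothe_norm_ge0 f p_gt1 w_gt0 w_decr).
apply: ge_ereal_sup => _ [g [Lg Ng] <-].
have [g' [Lg' Ng' <-]] := pairing_sign df Lg.
apply: (@le_trans _ _ `|pairing f g'|%:E); first by rewrite lee_fin ler_norm.
apply: ereal_sup_ubound; exists g'; last by [].
by split; [exact: Lg'|exact: (le_trans Ng' Ng)].
Qed.

(** The test function e sign(f - h), with e a positive element of the Lorentz space, turns equality
    of the functionals into a vanishing integral of |f - h| e. *)
Lemma pairing_inj f h : dual f -> dual h ->
  (forall g, Lam g -> pairing f g = pairing h g) <-> ae_eq_on a f h.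
Proof.
move=> df dh; split; last first.
  move=> fh g Lg; rewrite /pairing /Rintegral; congr fine.
  have fg_hg : ae_eq mu I (EFin \o (fun x => f x * g x)) (EFin \o (fun x => h x * g x)).
    apply: (@filterS _ _ (ae_filter_ringOfSetsType mu) _ _ _ fh) => x fx xI.
    by rewrite /= fx.
  apply: (ae_eq_integral _ _ mI _ _ fg_hg); apply/measurable_EFinP.
    exact: (L0M df.1 Lg.1).
  exact: (L0M dh.1 Lg.1).
move=> fh.
have [e [e_decr e_gt0 Le]] := ex_lorentz_weight p_gt1 a_gt0 w_gt0 w_decr w_int.
pose d x := f x - h x.
have md : L0 a d by apply: measurable_funB; [exact: df.1|exact: dh.1].
pose g x := e x * sign_on I d x.
have ms : L0 a (sign_on I d) by exact: measurable_sign_on.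
have mg : L0 a g := L0M Le.1 ms.
have Lg : Lam g.
  apply: (lorentzS p_gt1 w_gt0 w_decr mg Le) => x _.
  by rewrite /g normrM norm_sign_on mulr1.
have ifg := pairing_integrable df Lg; have ihg := pairing_integrable dh Lg.
have dg x : I x -> f x * g x - h x * g x = `|d x * e x|.
  move=> xI; rewrite normrM (gtr0_norm (e_gt0 _ xI)) -(sign_on_mul d xI).
  by rewrite /g /d; ring.
have d0 : (\int[mu]_(x in I) `|d x * e x|%:E = 0)%E.
  have -> : (\int[mu]_(x in I) `|d x * e x|%:E =
      \int[mu]_(x in I) ((EFin \o (fun x => f x * g x)%R) x - (EFin \o (fun x => h x * g x)%R) x))%E.
    by apply: eq_integral => x; rewrite inE => xI; rewrite -(dg x xI).
  rewrite (integralB mI ifg ihg).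
  have fgE := integrable_fin_num mI ifg; have hgE := integrable_fin_num mI ihg.
  have := congr1 EFin (fh g Lg); rewrite /pairing /Rintegral (fineK fgE) (fineK hgE) => ->.
  exact: subee.
have mde : measurable_fun (I : set T) (EFin \o (fun x => d x * e x)).
  by apply/measurable_EFinP; exact: (L0M md Le.1).
have := (ae_eq_integral_abs mu mI mde).1 d0.
apply: filterS => x h0 xI; have [/eqP] := h0 xI.
by rewrite mulf_eq0 (gt_eqF (e_gt0 _ xI)) orbF subr_eq0 => /eqP.
Qed.

End pairing.

(** * Representation of a bounded functional by a density *)

Section dual_representation.
Context {R : realType}.
Local Notation T := (caratheodory_type (@wlength R idfun)^*%mu).
Variables (p : R) (a : \bar R) (w : R -> R).
Hypothesis p_gt1 : 1 < p.
Hypothesis a_gt0 : (0 < a)%E.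
Hypothesis w_gt0 : positive_on a w.
Hypothesis w_decr : decreasing_on a w.
Hypothesis w_int :
  forall t : R, oitv 0 a t -> (\int[leb]_(x in oitv 0 t%:E) (w x)%:E < +oo)%E.
Hypothesis W_infty : a = +oo%E -> forall M, exists2 t, 0 < t & M <= primitive w t.
Local Notation I := (oitv 0 a).
Local Notation Lam := (lorentz a p w).
Local Notation N := (lorentz_norm a p w).
Local Notation mu := (@completed_lebesgue_measure R : measure T R).

Let mI := @measurable_oitv R 0 a.

Variables (F : (R -> R) -> R) (C : R).
Hypothesis F_linear : forall (c : R) g h, Lam g -> Lam h ->
  F (fun x => c * g x + h x) = c * F g + F h.
Hypothesis C_ge0 : 0 <= C.
Hypothesis F_bounded : forall g, Lam g -> (`|F g|%:E <= C%:E * N g)%E.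

Let lorentz_mono g g' : L0 a g -> Lam g' -> (forall x, I x -> `|g x| <= `|g' x|) -> Lam g.
Proof. exact: (lorentzS p_gt1 w_gt0 w_decr). Qed.

Lemma functional_null g : L0 a g -> N g = 0%E -> F g = 0.
Proof.
move=> mg Ng; have Lg : Lam g by split => //; rewrite Ng ltry.
by have := F_bounded Lg; rewrite Ng mule0 lee_fin normr_le0 => /eqP.
Qed.

Lemma functionalD g h : Lam g -> Lam h -> F (fun x => g x + h x) = F g + F h.
Proof.
move=> Lg Lh; rewrite -[in RHS](mul1r (F g)) -F_linear//.
by congr F; apply/funext => x; rewrite mul1r.
Qed.

(** F is applied to total functions and could depend on values outside I; boundedness excludes this,
    as the difference has norm 0. *)
Lemma functional_eq g h : Lam g -> Lam h -> (forall x, I x -> g x = h x) -> F g = F h.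
Proof.
move=> Lg Lh gh; have md : L0 a (fun x => g x - h x).
  by apply: measurable_funB; [exact: Lg.1|exact: Lh.1].
have Nd : N (fun x => g x - h x) = 0%E.
  apply: (lorentz_negligible w p_gt1 md (@measurable0 _ T) (@measure0 _ T R leb)) => x xI _.
  by rewrite gh// subrr.
have Ld : Lam (fun x => g x - h x) by split => //; rewrite Nd ltry.
rewrite -[RHS]add0r -(functional_null md Nd) -functionalD//.
by congr F; apply/funext => x; rewrite subrK.
Qed.

Lemma functional_cvg0 g (u : nat -> R -> R) : Lam g -> (forall n, L0 a (u n)) ->
  (forall n x, I x -> `|u n x| <= `|g x|) ->
  (forall m n x, (m <= n)%N -> I x -> `|u n x| <= `|u m x|) ->
  (forall x (d : R), I x -> 0 < d -> exists n, `|u n x| <= d) ->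
  F (u n) @[n --> \oo] --> 0.
Proof.
move=> Lg mu_ ug und u0; apply/cvgrPdist_le => e e0.
have C1 : 0 < C + 1 by rewrite ltr_wpDl.
have e1 : 0 < e / (C + 1) by rewrite divr_gt0.
have [n0 Nn0] := lorentz_cvg0 p_gt1 a_gt0 w_gt0 w_decr w_int W_infty Lg mu_ ug und u0 e1.
exists n0 => // n /= n0n; rewrite sub0r normrN -lee_fin.
have Lu : Lam (u n) by apply: (lorentz_mono (mu_ n) Lg) => x xI; exact: ug.
apply: (le_trans (F_bounded Lu)).
apply: (@le_trans _ _ (C%:E * (e / (C + 1))%:E)%E).
  apply: lee_wpmul2l; first by rewrite lee_fin.
  apply: le_trans Nn0; apply: (lorentz_norm_le p_gt1 w_gt0 w_decr (mu_ n) (mu_ n0)) => x xI.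
  exact: und.
by rewrite -EFinM lee_fin mulrCA ler_piMr ?(ltW e0)// ler_pdivrMr// mul1r lerDl.
Qed.

Variable h : R -> R.
Hypothesis h_gt0 : positive_on a h.
Hypothesis Lh : Lam h.

Lemma lorentz_bounded_mul (phi : R -> R) (M : R) : L0 a phi ->
  (forall x, I x -> `|phi x| <= M) -> Lam (fun x => phi x * h x).
Proof.
move=> mphi phiM; have M1 : 0 < `|M| + 1 by rewrite ltr_wpDl.
have Mh : Lam (fun x => (`|M| + 1) * h x).
  split; first by apply: L0M; [exact: measurable_cst|exact: Lh.1].
  apply: (le_lt_trans (lorentz_norm_scale p_gt1 w_gt0 w_decr M1 Lh.1)).
  by rewrite (lorentz_norm_fin Lh) -EFinM ltry.
apply: (lorentz_mono (L0M mphi Lh.1) Mh) => x xI.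
rewrite !normrM; apply: ler_wpM2r => //.
rewrite (le_trans (phiM x xI))// (gtr0_norm M1).
by rewrite (le_trans (ler_norm M))// lerDl.
Qed.

Definition functional_charge (A : set R) : \bar R := (F (fun x => \1_A x * h x))%:E.
Local Notation nu := functional_charge.

Let mindic (A : set T) : measurable A -> L0 a (\1_A : R -> R).
Proof. by move=> mA; exact: measurable_indic. Qed.

Lemma lorentz_indic (A : set T) : measurable A -> Lam (fun x => \1_A x * h x).
Proof.
move=> mA; apply: (@lorentz_bounded_mul _ 1); first exact: mindic.
by move=> x _; rewrite indicE; case: (_ \in _); rewrite ?normr1// normr0.
Qed.

Lemma functional_charge_null (A : set T) : measurable A -> mu A = 0%E -> nu A = 0%E.
Proof.
move=> mA A0; rewrite /nu (functional_null (lorentz_indic mA).1)//.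
apply: (lorentz_negligible w p_gt1 (lorentz_indic mA).1 mA A0) => x _ nA.
by rewrite indicE memNset// mul0r.
Qed.

(** The remainder after n terms is F at h times the indicator of the tail union E n. These tails
    decrease to the empty set, so the remainder tends to 0 by order continuity. *)
Lemma functional_charge_sigma_additive : semi_sigma_additive (nu : set T -> \bar R).
Proof.
move=> A mA tA mUA.
pose E n : set T := \bigcup_(i in [set i | (n <= i)%N]) A i.
have mE n : measurable (E n) by apply: bigcup_measurable => i _; exact: mA.
have AE n x : A n x -> E n.+1 x -> False.
  move=> Anx [i /= ni Aix]; have := tA n i Logic.I Logic.I.
  by move=> /(_ (ex_intro _ x (conj Anx Aix))) ni'; rewrite ni' ltnn in ni.
have indE n x : \1_(E n) x = \1_(A n) x + \1_(E n.+1) x :> R.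
  have [Anx|nAnx] := pselect (A n x).
    have Enx : E n x by exists n => /=.
    have nEx : ~ E n.+1 x by move=> /(AE _ _ Anx).
    by rewrite !indicE (mem_set Anx) (mem_set Enx) (memNset nEx) addr0.
  rewrite [in RHS]indicE (memNset nAnx) add0r; have [Enx|nEnx] := pselect (E n x).
    have Esx : E n.+1 x.
      case: Enx => i /= ni Aix; exists i => //=; move: ni; rewrite leq_eqVlt.
      by move=> /predU1P[ni|//]; rewrite ni in nAnx.
    by rewrite !indicE (mem_set Enx) (mem_set Esx).
  have nEsx : ~ E n.+1 x by move=> [i /= ni Aix]; apply: nEnx; exists i => //=; exact: ltnW.
  by rewrite !indicE (memNset nEnx) (memNset nEsx).
pose u n x := \1_(E n) x * h x.
have Lu n : Lam (u n) by exact: lorentz_indic.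
have step n : F (u 0%N) - \sum_(0 <= i < n) F (fun x => \1_(A i) x * h x) = F (u n).
  elim: n => [|n IHn]; first by rewrite big_geq// subr0.
  rewrite big_nat_recr//= opprD addrA IHn.
  have -> : u n = (fun x => \1_(A n) x * h x + u n.+1 x).
    by apply/funext => x; rewrite /u indE mulrDl.
  by rewrite (functionalD (lorentz_indic (mA n)) (Lu n.+1)) addrAC subrr add0r.
have U0 : \bigcup_n A n = E 0%N.
  by apply/seteqP; split => x [i _ Aix]; exists i.
have cu : F (u n) @[n --> \oo] --> 0.
  apply: (functional_cvg0 Lh (fun n => (Lu n).1)).
  - move=> n x xI; rewrite /u normrM ler_piMl// indicE.
    by case: (_ \in _); rewrite ?normr1// normr0.
  - move=> m n x mn xI; rewrite /u !normrM ler_wpM2r//.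
    rewrite !indicE; case: (boolP (x \in E n)) => [|_]; last by rewrite normr0.
    rewrite inE => -[i /= ni Aix]; rewrite mem_set//; exists i => //=.
    exact: leq_trans ni.
  - move=> x d xI d0; have [[i Aix]|nA] := pselect (exists i, A i x).
      exists i.+1; rewrite /u indicE memNset ?mul0r ?normr0 ?(ltW d0)//.
      exact: AE.
    exists 0%N; rewrite /u indicE memNset ?mul0r ?normr0 ?(ltW d0)//.
    by move=> [i _ Aix]; apply: nA; exists i.
rewrite U0; have sumE n : (\sum_(0 <= i < n) nu (A i) = (F (u 0%N) - F (u n))%:E)%E.
  by rewrite /nu sumEFin -(step n) subKr.
under eq_fun do rewrite sumE.
apply: cvg_EFin; first exact: nearW.
rewrite -[X in _ --> X]subr0; apply: cvgB; last exact: cu.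
exact: cvg_cst.
Qed.

Lemma ex_functional_density : exists k : R -> R,
  mu.-integrable setT (EFin \o k) /\
  forall A : set T, measurable A -> A `<=` I ->
    F (fun x => \1_A x * h x) = \int[mu]_(x in A) k x.
Proof.
have nu0 : nu set0 = 0%E by apply: functional_charge_null; [exact: measurable0|exact: measure0].
have nu_fin (A : set T) : measurable A -> nu A \is a fin_num by [].
pose nuM := isCharge.Build _ T R (nu : set T -> \bar R) nu0 nu_fin functional_charge_sigma_additive.
pose nuC : {charge set T -> \bar R} := HB.pack (nu : set T -> \bar R) nuM.
have nu_mu : nuC `<< mu.
  move=> A A0 B mB BA; apply: functional_charge_null => //; exact: A0.
pose k := Radon_Nikodym nuC (@completed_lebesgue_measure R).
have kE : EFin \o (fine \o k) = k.
  by apply/funext => x /=; rewrite fineK// Radon_Nikodym_fin_num.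
exists (fine \o k); split.
  by rewrite kE; exact: Radon_Nikodym_integrable.
move=> A mA AI; rewrite /Rintegral.
have -> : (\int[mu]_(x in A) (EFin \o (fine \o k)) x = nuC A)%E.
  by rewrite kE (Radon_Nikodym_integral nu_mu mA).
by [].
Qed.

Import HBNNSimple.

Variable k : R -> R.
Hypothesis k_int : mu.-integrable setT (EFin \o k).
Hypothesis kE : forall A : set T, measurable A -> A `<=` I ->
  F (fun x => \1_A x * h x) = \int[mu]_(x in A) k x.

Let k_intI : mu.-integrable I (EFin \o k).
Proof. by apply: (integrableS measurableT mI _ k_int) => x. Qed.

(** Boundedness keeps phi h in the Lorentz space and phi k integrable, so that the class is stable
    under linear combinations. *)
Definition represented (phi : R -> R) : Prop :=
  [/\ L0 a phi, exists M, forall x, I x -> `|phi x| <= M &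
      F (fun x => phi x * h x) = \int[mu]_(x in I) (phi x * k x)].

Lemma bounded_mul_integrable (phi : R -> R) M : L0 a phi ->
  (forall x, I x -> `|phi x| <= M) ->
  mu.-integrable I (EFin \o (fun x => phi x * k x)).
Proof.
move=> mphi phiM; apply: (integrableMr mI mphi _ k_intI).
exists M; split; first exact: num_real.
by move=> y My x /= xI; rewrite (le_trans (phiM x xI))// ltW.
Qed.

Lemma represented_indic (A : set T) : measurable A -> represented (\1_A).
Proof.
move=> mA; have mAI : measurable (I `&` A : set T) by exact: measurableI.
split; first exact: mindic.
  by exists 1 => x _; rewrite indicE; case: (_ \in _); rewrite ?normr1// normr0.
have indE x : I x -> \1_A x = \1_(I `&` A) x :> R.
  by move=> xI; rewrite !indicE in_setI (mem_set xI).
rewrite (functional_eq (lorentz_indic mA) (lorentz_indic mAI)); last first.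
  by move=> x xI; rewrite indE.
rewrite (kE mAI (@subIsetl _ _ _)) /Rintegral; congr fine.
rewrite -(integral_indic_mul (EFin \o k) mI mAI (@subIsetl _ _ _)).
by apply: eq_integral => x; rewrite inE => xI; rewrite indE// mulrC.
Qed.

Lemma represented_linear (c : R) phi psi : represented phi -> represented psi ->
  represented (fun x => c * phi x + psi x).
Proof.
move=> [mphi [M phiM] Fphi] [mpsi [M' psiM] Fpsi]; split.
- apply: measurable_funD; last exact: mpsi.
  by apply: measurable_funM; [exact: measurable_cst|exact: mphi].
- exists (`|c| * M + M') => x xI; apply: (le_trans (ler_normD _ _)).
  by apply: lerD; [rewrite normrM ler_wpM2l// phiM|exact: psiM].
have Lphi := lorentz_bounded_mul mphi phiM.
have Lpsi := lorentz_bounded_mul mpsi psiM.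
have iphi := bounded_mul_integrable mphi phiM.
have ipsi := bounded_mul_integrable mpsi psiM.
have -> : (fun x => (c * phi x + psi x) * h x) =
    (fun x => c * (phi x * h x) + psi x * h x).
  by apply/funext => x; rewrite mulrDl mulrA.
rewrite F_linear// Fphi Fpsi -(RintegralZl c mI iphi) -(RintegralD mI _ ipsi).
  by apply: eq_Rintegral => x _; ring.
have := integrableZl mI c iphi; apply: (eq_integrable mI) => x _.
by rewrite /= EFinM.
Qed.

Lemma represented_sum (r : seq R) (A : R -> set T) : (forall y, measurable (A y)) ->
  represented (fun x => \sum_(y <- r) y * \1_(A y) x).
Proof.
move=> mA; elim: r => [|y r IHr].
  have -> : (fun x => \sum_(y <- [::]) y * \1_(A y) x) = \1_(set0 : set T).
    by apply/funext => x; rewrite big_nil indic0.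
  by apply: represented_indic; exact: measurable0.
have -> : (fun x => \sum_(z <- y :: r) z * \1_(A z) x) =
    (fun x => y * \1_(A y) x + \sum_(z <- r) z * \1_(A z) x).
  by apply/funext => x; rewrite big_cons.
by apply: represented_linear => //; exact: represented_indic.
Qed.

Lemma represented_nnsfun (s : {nnsfun T >-> R}) (B : set T) : measurable B ->
  represented (fun x => s x * \1_B x).
Proof.
move=> mB.
have -> : (fun x => s x * \1_B x) = (fun x => \sum_(y <- finmap.enum_fset (fset_set (range s)))
    y * \1_((s @^-1` [set y]) `&` B) x).
  apply/funext => x; rewrite fimfunE fsbig_finite//= mulr_suml.
  by apply: eq_bigr => y _; rewrite -mulrA indicI.
by apply: represented_sum => y; apply: measurableI => //; exact: measurable_funPTI.
Qed.

(** The inverse of h is written as a power because measurability of real powers then applies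
    directly. *)
Let f x := k x * h x `^ (- 1).

Let h_powN x : I x -> h x * h x `^ (- 1) = 1.
Proof.
move=> xI; have hx := h_gt0 xI.
by rewrite powRN powRr1 ?(ltW hx)// mulfV// gt_eqF.
Qed.

Let mk : L0 a k.
Proof. by apply/measurable_EFinP; exact: (measurable_int mu k_intI). Qed.

Lemma measurable_density : L0 a f.
Proof.
apply: (L0M mk); exact: (measurableT_comp (@measurable_powR R (- 1)) Lh.1).
Qed.

Section nonneg.
Variable g : R -> R.
Hypothesis Lg : Lam g.
Hypothesis g_ge0 : forall x, I x -> 0 <= g x.

Let ratio x := g x * h x `^ (- 1).

Let ratio_ge0 x : I x -> 0 <= ratio x.
Proof. by move=> xI; rewrite mulr_ge0 ?powR_ge0 ?g_ge0. Qed.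

Let mratio : measurable_fun (I : set T) (EFin \o ratio).
Proof.
apply/measurable_EFinP; apply: (L0M Lg.1).
exact: (measurableT_comp (@measurable_powR R (- 1)) Lh.1).
Qed.

Let s (n : nat) : R -> R := nnsfun_approx mI mratio n.

Let s_ge0 n x : 0 <= s n x.
Proof. exact: fun_ge0. Qed.

Let s_nd m n x : (m <= n)%N -> s m x <= s n x.
Proof. by move=> mn; have /lefP := nd_nnsfun_approx mI mratio mn; exact. Qed.

Let s_cvg x : I x -> s n x @[n --> \oo] --> ratio x.
Proof.
move=> xI; have := cvg_nnsfun_approx mI mratio (fun x xI => ratio_ge0 xI) xI.
by move=> /fine_cvgP[_].
Qed.

Let s_le n x : I x -> s n x <= ratio x.
Proof.
move=> xI; rewrite -(cvg_lim _ (s_cvg xI))//; apply: nondecreasing_cvgn_le.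
  by move=> i j ij; exact: s_nd.
by apply/cvg_ex; eexists; exact: s_cvg.
Qed.

Let ms n : L0 a (s n).
Proof. by apply: (measurable_funS measurableT) => //; exact: measurable_funPT. Qed.

Let ratio_h x : I x -> ratio x * h x = g x.
Proof. by move=> xI; rewrite /ratio -mulrA [_ * h x]mulrC h_powN// mulr1. Qed.

Let sh_le n x : I x -> s n x * h x <= g x.
Proof.
by move=> xI; rewrite -[leRHS](ratio_h xI) ler_wpM2r ?s_le// ltW// h_gt0.
Qed.

(** Simple functions s_n increase to g/h, so g - s_n h decreases to 0 and order continuity applies
    to it. *)
Let sh_cvg : F (fun x => s n x * h x) @[n --> \oo] --> F g.
Proof.
have Lsh n : Lam (fun x => s n x * h x).
  apply: (lorentz_mono (L0M (ms n) Lh.1) Lg) => x xI.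
  by rewrite !ger0_norm ?g_ge0 ?sh_le// mulr_ge0// ltW// h_gt0.
pose u n x := g x - s n x * h x.
have u_ge0 n x : I x -> 0 <= u n x by move=> xI; rewrite subr_ge0 sh_le.
have mu_ n : L0 a (u n) by apply: measurable_funB; [exact: Lg.1|exact: (Lsh n).1].
have ug n x : I x -> `|u n x| <= `|g x|.
  move=> xI; rewrite !ger0_norm ?g_ge0 ?u_ge0// lerBlDr lerDl.
  by rewrite mulr_ge0// ltW// h_gt0.
have Lu n : Lam (u n) by apply: (lorentz_mono (mu_ n) Lg) => x xI; exact: ug.
have cu : F (u n) @[n --> \oo] --> 0.
  apply: (functional_cvg0 Lg mu_ ug).
  - move=> m n x mn xI; rewrite !ger0_norm ?u_ge0// lerB// ler_wpM2r ?s_nd//.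
    by rewrite ltW// h_gt0.
  - move=> x d xI d0; have hx := h_gt0 xI.
    have dh : 0 < d / h x by rewrite divr_gt0.
    have /cvgrPdist_le /(_ _ dh) [n _ /(_ n (leqnn n))] := s_cvg xI.
    rewrite ger0_norm ?subr_ge0 ?s_le// ler_pdivlMr// => sd; exists n.
    by rewrite ger0_norm ?u_ge0// /u -[X in X - _](ratio_h xI) -mulrBl.
have E n : F (fun x => s n x * h x) = F g - F (u n).
  apply/eqP; rewrite eq_sym subr_eq; apply/eqP.
  rewrite -(functionalD (Lsh n) (Lu n)).
  by congr F; apply/funext => x; rewrite /u addrC subrK.
have cE : F g - F (u n) @[n --> \oo] --> F g - 0.
  by apply: cvgB; [exact: cvg_cst|exact: cu].
by under eq_fun do rewrite E; rewrite subr0 in cE; exact: cE.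
Qed.

(** F at s_n sign(k) h equals the integral of s_n |k| and is at most C N g, because |s_n h| <= g.
    Monotone convergence turns s_n |k| into |f g|. The estimate provides the integrability that the
    representation of F g relies on. *)
Lemma density_pairing_le : (\int[mu]_(x in I) `|f x * g x|%:E <= C%:E * N g)%E.
Proof.
pose P : set T := I `&` [set x : R | 0 <= k x].
have mP : measurable P by exact: measurable_nonneg_set.
have bound n : (\int[mu]_(x in I) (s n x * `|k x|)%:E <= C%:E * N g)%E.
  have r1 := represented_nnsfun (nnsfun_approx mI mratio n) mP.
  have r2 := represented_nnsfun (nnsfun_approx mI mratio n) (@measurableT _ T).
  (* This is s_n times the sign of k, spelled as a combination of functions already known to be
     represented; the indicator of the empty set fills the last summand of [represented_linear]. *)
  pose phi x := - 1 * (s n x * \1_(setT : set T) x) +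
    (2 * (s n x * \1_P x) + \1_(set0 : set T) x).
  have [mphi [M phiM] Fphi] : represented phi :=
    represented_linear (- 1) r2 (represented_linear 2 r1 (represented_indic (@measurable0 _ T))).
  have phiE x : phi x = s n x * sign_on I k x.
    by rewrite /phi /sign_on -/P indic0 indicT /cst; ring.
  have Lphi := lorentz_bounded_mul mphi phiM.
  have phi_le x : I x -> `|phi x * h x| <= `|g x|.
    move=> xI; rewrite phiE !normrM norm_sign_on mulr1 !ger0_norm ?g_ge0 ?sh_le//.
    by rewrite ltW// h_gt0.
  have -> : (\int[mu]_(x in I) (s n x * `|k x|)%:E = (F (fun x => (phi x * h x)%R))%:E)%E.
    rewrite Fphi /Rintegral fineK; last first.
      exact: (integrable_fin_num mI (bounded_mul_integrable mphi phiM)).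
    apply: eq_integral => x; rewrite inE => xI.
    by rewrite phiE -(sign_on_mul k xI) mulrA mulrAC.
  apply: (@le_trans _ _ `|F (fun x => phi x * h x)|%:E); first by rewrite lee_fin ler_norm.
  apply: (le_trans (F_bounded Lphi)); apply: lee_wpmul2l; first by rewrite lee_fin.
  exact: (lorentz_norm_le p_gt1 w_gt0 w_decr Lphi.1 Lg.1 phi_le).
have mabs : measurable_fun (I : set T) (fun x => `|k x|%:E) by exact: measurable_L0_norm.
have msk n : measurable_fun (I : set T) (fun x => (s n x * `|k x|)%:E).
  apply/measurable_EFinP; apply: measurable_funM; first exact: ms.
  by apply/measurable_EFinP.
have sk0 n x : I x -> (0 <= (s n x * `|k x|)%:E)%E by move=> _; rewrite lee_fin mulr_ge0.
have sknd x : I x -> {homo (fun n => (s n x * `|k x|)%:E) : m n / (m <= n)%N >-> (m <= n)%E}.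
  by move=> _ m n mn; rewrite lee_fin ler_wpM2r// s_nd.
have cvg_int := @cvg_monotone_convergence _ T R mu I mI _ msk sk0 sknd.
have -> : (\int[mu]_(x in I) `|f x * g x|%:E =
    \int[mu]_(x in I) limn (fun n => (s n x * `|k x|)%:E))%E.
  apply: eq_integral => x; rewrite inE => xI; apply/esym/cvg_lim => //.
  apply: cvg_EFin; first exact: nearW.
  have -> : `|f x * g x| = ratio x * `|k x|.
    rewrite /f /ratio !normrM (ger0_norm (g_ge0 xI)) (ger0_norm (powR_ge0 _ _)).
    by ring.
  by apply: cvgM; [exact: s_cvg|exact: cvg_cst].
rewrite -(cvg_lim _ cvg_int)//; apply: lime_le; first by apply/cvg_ex; eexists; exact: cvg_int.
exact: nearW.
Qed.

(** F at s_n h tends to F g by order continuity, and the integrals of s_n k tend to that of f g by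
    dominated convergence. *)
Lemma functional_nonnegE : F g = \int[mu]_(x in I) (f x * g x).
Proof.
have fg_int : mu.-integrable I (EFin \o (fun x => f x * g x)).
  apply/integrableP; split.
    by apply/measurable_EFinP; exact: (L0M measurable_density Lg.1).
  apply: (le_lt_trans density_pairing_le).
  by rewrite (lorentz_norm_fin Lg) -EFinM ltry.
have msk n : measurable_fun (I : set T) (fun x => (s n x * k x)%:E).
  by apply/measurable_EFinP; exact: (L0M (ms n) mk).
have sk_cvg x : I x -> (s n x * k x)%:E @[n --> \oo] --> (f x * g x)%:E.
  move=> xI; apply: cvg_EFin; first exact: nearW.
  have -> : f x * g x = ratio x * k x by rewrite /f /ratio; ring.
  by apply: cvgM; [exact: s_cvg|exact: cvg_cst].
have sk_le n x : I x -> (`|(s n x * k x)%:E| <= `|f x * g x|%:E)%E.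
  move=> xI; rewrite lee_fin; have -> : f x * g x = ratio x * k x by rewrite /f /ratio; ring.
  rewrite (normrM (s n x)) (normrM (ratio x)); apply: ler_wpM2r => //.
  by rewrite (ger0_norm (s_ge0 n x)) (ger0_norm (ratio_ge0 xI)); exact: s_le.
have mfg : measurable_fun (I : set T) (fun x => (f x * g x)%:E) := measurable_int mu fg_int.
have [_ _ DCT] := dominated_convergence mI msk mfg
  (aeW mu sk_cvg) (integrable_abse fg_int) (aeW mu (fun x n xI => sk_le n x xI)).
have sE n : (\int[mu]_(x in I) (s n x * k x)%:E = (F (fun x => (s n x * h x)%R))%:E)%E.
  have [mphi [M phiM] Fphi] :=
    represented_nnsfun (nnsfun_approx mI mratio n) (@measurableT _ T).
  have sT x : s n x * \1_(setT : set T) x = s n x by rewrite indicT mulr1.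
  have -> : (fun x => s n x * h x) = (fun x => s n x * \1_(setT : set T) x * h x).
    by apply/funext => x; rewrite sT.
  rewrite Fphi /Rintegral fineK; last first.
    exact: (integrable_fin_num mI (bounded_mul_integrable mphi phiM)).
  by apply: eq_integral => x _; rewrite sT.
have DCT' : (F (fun x => s n x * h x))%:E @[n --> \oo] -->
    (\int[mu]_(x in I) (f x * g x)%:E)%E.
  by under eq_fun do rewrite -sE.
have Fcvg : (F (fun x => s n x * h x))%:E @[n --> \oo] --> (F g)%:E.
  by apply: cvg_EFin; [exact: nearW|exact: sh_cvg].
have := cvg_unique _ DCT' Fcvg; rewrite /Rintegral => -> //.
Qed.

End nonneg.

End dual_representation.

Lemma dual_functional_pairing {R : realType} (p : R) (a : \bar R) (w : R -> R)
    (F : (R -> R) -> R) :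
  1 < p -> (0 < a)%E -> positive_on a w -> decreasing_on a w ->
  (forall t : R, oitv 0 a t -> (\int[leb]_(x in oitv 0 t%:E) (w x)%:E < +oo)%E) ->
  (a = +oo%E -> forall M, exists2 t, 0 < t & M <= primitive w t) ->
  dual_functional (lorentz a p w) (lorentz_norm a p w) F ->
  exists2 f, kothe_dual a (lorentz a p w) (lorentz_norm a p w) f &
    forall g, lorentz a p w g -> F g = pairing a f g.
Proof.
move=> p_gt1 a_gt0 w_gt0 w_decr w_int W_infty [Flin [C0 FC0]].
(* The constant of a bounded functional is not assumed nonnegative. *)
pose C := `|C0|; have C_ge0 : 0 <= C by exact: normr_ge0.
have FC g : lorentz a p w g -> (`|F g|%:E <= C%:E * lorentz_norm a p w g)%E.
  move=> Lg; apply: (le_trans (FC0 g Lg)); apply: lee_wpmul2r.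
    exact: lorentz_norm_ge0.
  by rewrite lee_fin ler_norm.
have [h [_ h_gt0 Lh]] := ex_lorentz_weight p_gt1 a_gt0 w_gt0 w_decr w_int.
have [k [k_int kE]] :=
  ex_functional_density p_gt1 a_gt0 w_gt0 w_decr w_int W_infty Flin C_ge0 FC Lh.
pose f x := k x * h x `^ (- 1).
have mf : L0 a f := measurable_density Lh k_int.
have df : kothe_dual a (lorentz a p w) (lorentz_norm a p w) f.
  split; first exact: mf.
  apply: (@le_lt_trans _ _ C%:E); last exact: ltry.
  apply: ge_ereal_sup => _ [g [Lg Ng] <-].
  have mg : L0 a (fun x => `|g x|).
    exact: (measurableT_comp (@normr_measurable R setT) Lg.1).
  have Labs : lorentz a p w (fun x => `|g x|).
    by apply: (lorentzS p_gt1 w_gt0 w_decr mg Lg) => x _; rewrite normr_id.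
  have Nabs : (lorentz_norm a p w (fun x => `|g x|%R) <= 1)%E.
    apply: le_trans Ng; apply: (lorentz_norm_le p_gt1 w_gt0 w_decr mg Lg.1) => x _.
    by rewrite normr_id.
  have := density_pairing_le p_gt1 w_gt0 w_decr Flin C_ge0 FC h_gt0 Lh k_int kE Labs
    (fun x _ => normr_ge0 (g x)).
  have -> : (\int[leb]_(x in oitv 0 a) `|f x * g x|%:E =
      \int[leb]_(x in oitv 0 a) `|f x * `|g x| |%:E)%E.
    by apply: eq_integral => x _; rewrite !normrM normr_id.
  move=> /le_trans; apply; rewrite -[leRHS]mule1.
  by apply: lee_wpmul2l; rewrite ?lee_fin.
exists f; first exact: df.
have Fnonneg := functional_nonnegE p_gt1 a_gt0 w_gt0 w_decr w_int W_infty Flin C_ge0 FC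
  h_gt0 Lh k_int kE.
move=> g Lg; pose gp x := Num.max (g x) 0; pose gn x := Num.max (- g x) 0.
have mgp : L0 a gp by apply: measurable_maxr; [exact: Lg.1|exact: measurable_cst].
have mgn : L0 a gn.
  apply: measurable_maxr; last exact: measurable_cst.
  exact: (measurableT_comp (@oppr_measurable R setT) Lg.1).
have gp0 x : 0 <= gp x by rewrite le_max lexx orbT.
have gn0 x : 0 <= gn x by rewrite le_max lexx orbT.
have Lgp : lorentz a p w gp.
  apply: (lorentzS p_gt1 w_gt0 w_decr mgp Lg) => x _.
  by rewrite ger0_norm// ge_max ler_norm normr_ge0.
have Lgn : lorentz a p w gn.
  apply: (lorentzS p_gt1 w_gt0 w_decr mgn Lg) => x _.
  by rewrite ger0_norm// ge_max -normrN ler_norm normr_ge0.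
(* The decomposition into positive and negative parts, in the shape that linearity of F accepts. *)
have gE : g = (fun x => (- 1) * gn x + gp x).
  apply/funext => x; rewrite /gn /gp; have [g0|g0] := leP 0 (g x).
    by rewrite max_r ?oppr_le0// mulr0 add0r.
  by rewrite max_l ?oppr_ge0 ?(ltW g0)// mulN1r opprK addr0.
rewrite gE Flin// (pairing_dual_functional p_gt1 w_gt0 w_decr df).1//.
by rewrite (Fnonneg _ Lgp (fun x _ => gp0 x)) (Fnonneg _ Lgn (fun x _ => gn0 x)).
Qed.

Lemma primitive_unbounded {R : realType} (a : \bar R) (w : R -> R) :
  (0 < a)%E -> positive_on a w -> decreasing_on a w ->
  (forall t : R, oitv 0 a t -> (\int[leb]_(x in oitv 0 t%:E) (w x)%:E < +oo)%E) ->
  (\int[leb]_(x in oitv 0 a) (w x)%:E = +oo)%E ->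
  forall M, exists2 t, 0 < t & M <= primitive w t.
Proof.
move=> a_gt0 w_gt0 w_decr w_int W_oo M; apply: contrapT => hno.
have w_ge0 x : oitv 0 a x -> 0 <= w x by move=> /w_gt0/ltW.
have w_fin := weight_int a_gt0 w_gt0 w_decr w_int.
have mw : measurable_fun (oitv 0 a : set (caratheodory_type (@wlength R idfun)^*%mu)) (EFin \o w).
  by apply/measurable_EFinP; exact: measurable_decreasing.
have M0 : (0 <= `|M|%:E)%E by rewrite lee_fin.
have : (\int[leb]_(x in oitv 0 a) (w x)%:E <= `|M|%:E)%E.
  apply: (ge0_integral_oitv_le (ltW a_gt0) mw _ _ M0).
    by move=> x xI; rewrite lee_fin w_ge0.
  move=> x xI; rewrite (primitiveE w_ge0 w_fin (oitvK xI)) lee_fin.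
  apply: le_trans (ler_norm M); rewrite leNgt; apply/negP => Mx; apply: hno.
  by exists x; [case: xI; rewrite lte_fin|exact: ltW].
by rewrite W_oo.
Qed.

Theorem theorem8p11 (R : realType) (p q : R) (a : \bar R) (w : R -> R)
    (p_gt1 : 1 < p) (pq : p^-1 + q^-1 = 1) (a_gt0 : (0 < a)%E)
    (w_gt0 : positive_on a w) (w_decr : decreasing_on a w)
    (W_fin : forall t : R, oitv 0 a t ->
       (\int[leb]_(x in oitv 0 t%:E) (w x)%:E < +oo)%E) :
  let Lam := lorentz a p w in
  let NLam := lorentz_norm a p w in
  [/\ kothe_dual a Lam NLam = Mspace a q w,
      forall f, Mspace a q w f -> kothe_norm a Lam NLam f = Mnorm a q w f
    & (a = +oo%E -> (\int[leb]_(x in oitv 0 a) (w x)%:E = +oo)%E) ->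
      dual_isometric_to a Lam NLam (Mspace a q w) (Mnorm a q w) /\
      forall F, dual_functional Lam NLam F ->
      exists2 f, Mspace a q w f &
      [/\ forall g, Lam g ->
            (@completed_lebesgue_measure R).-integrable (oitv 0 a)
              (fun x => (f x * g x)%:E) /\
            F g = \int[leb]_(x in oitv 0 a) (f x * g x),
          dual_norm Lam NLam F = Mnorm a q w f,
          Mnorm a q w f =
            ereal_inf [set inv_weight_norm a q w (rearrangement a g) |
                       g in [set g | L0 a g /\ submajorized a f g]],
          Mnorm a q w f =
            ereal_inf [set inv_weight_norm a q v (rearrangement a f) |
                       v in [set v | [/\ submajorized a v w, positive_on a v
                                       & decreasing_on a v]]]
        & Mnorm a q w f = inv_weight_norm a q w (level_fun a w f)]].
Proof.
move=> Lam NLam.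
have dualE := kothe_dualE p_gt1 pq a_gt0 w_gt0 w_decr W_fin.
have normE := kothe_normE p_gt1 pq a_gt0 w_gt0 w_decr W_fin.
split; [exact: dualE|exact: normE|move=> W_oo].
have W_infty : a = +oo%E -> forall M, exists2 t, 0 < t & M <= primitive w t.
  by move=> aE; exact: (primitive_unbounded a_gt0 w_gt0 w_decr W_fin (W_oo aE)).
have Mdual f : Mspace a q w f -> kothe_dual a Lam NLam f by rewrite /Lam /NLam dualE.
have dnorm f : Mspace a q w f -> dual_norm Lam NLam (pairing a f) = Mnorm a q w f.
  move=> Mf; rewrite -(normE f Mf).
  exact: (dual_norm_pairing p_gt1 w_gt0 w_decr (Mdual f Mf)).
have repr F : dual_functional Lam NLam F ->
    exists2 f, Mspace a q w f & forall g, Lam g -> F g = pairing a f g.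
  move=> /(dual_functional_pairing p_gt1 a_gt0 w_gt0 w_decr W_fin W_infty)[f df fE].
  by exists f; [rewrite -dualE|exact: fE].
split.
  exists (pairing a); split.
  - split=> [f Mf|f h Mf Mh].
      exact: (pairing_dual_functional p_gt1 w_gt0 w_decr (Mdual f Mf)).
    exact: (pairing_inj p_gt1 a_gt0 w_gt0 w_decr W_fin (Mdual f Mf) (Mdual h Mh)).
  - move=> c f h Mf Mh g Lg.
    exact: (pairing_linear p_gt1 w_gt0 w_decr c (Mdual f Mf) (Mdual h Mh) Lg).
  - exact: dnorm.
  - exact: repr.
move=> F dF; have [f Mf fE] := repr F dF.
have [level weight] := Mnorm_level_fun p_gt1 pq a_gt0 w_gt0 w_decr W_fin W_infty Mf.
exists f; first exact: Mf.
split; [|rewrite -(dnorm f Mf)|reflexivity|exact: weight|exact: level].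
  move=> g Lg; split; last exact: fE.
  exact: (pairing_integrable p_gt1 w_gt0 w_decr (Mdual f Mf) Lg).
(* F and the pairing with f agree on the Lorentz space, so both dual norms are suprema of the same
   set. *)
congr ereal_sup; apply/seteqP; split => _ [g [Lg Ng] <-].
  by exists g; [exact: (conj Lg Ng)|rewrite (fE g Lg)].
by exists g; [exact: (conj Lg Ng)|rewrite (fE g Lg)].
Qed.
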